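(* Let $T$ be an edge-to-edge tiling of the plane by unit-area pentagons, with only efficient and non-convex pentagons, and with perimeter ratio less than or equal to half the perimeter of a unit-area Prismatic pentagon. Then the fractions $C_1$, $N_1$, and $N_2$ of the pentagons completely inside a disk about the origin of radius $R$ which are efficient, non-convex Type 1, and non-convex Type 2, respectively, satisfy $$C_1>2.6N_1+13.4N_2.$$
   Context: Edge-to-edge means adjacent tiles meet only along entire edges or at vertices. The perimeter ratio of a planar tiling is the limit supremum, as $R\to\infty$, of the perimeter (total edge length of the tiling) inside the disk of radius $R$ about the origin, divided by $\pi R^2$. A Cairo (respectively Prismatic) pentagon is a pentagon with three angles of $2\pi/3$ and two right angles which are nonadjacent (respectively adjacent), circumscribed about a circle; at unit area both have perimeter $2\sqrt{2+\sqrt3}\approx 3.86$. A unit-area pentagon is efficient if its perimeter is less than or equal to that of a unit-area Cairo pentagon. A non-convex pentagon is Type 1 if it has exactly one interior angle larger than $\pi$, and Type 2 if it has two interior angles (adjacent or non-adjacent) larger than $\pi$ (their average is then less than $3\pi/2$).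
   Formalization: The inequality is stated for all sufficiently large R, because for small R the disk contains no pentagon and the fractions are undefined, while the perimeter-ratio hypothesis only constrains the limit as R tends to infinity. *)

(* Defs.v *)
From HB Require Import structures.
From mathcomp Require Import all_boot all_order all_algebra finmap.
From mathcomp Require Import all_classical all_reals all_analysis.

Set Implicit Arguments.
Unset Strict Implicit.
Unset Printing Implicit Defensive.

Import Order.TTheory GRing.Theory Num.Theory.
Import numFieldNormedType.Exports.

Local Open Scope classical_set_scope.
Local Open Scope ring_scope.

(* The plane is [R * R].  Its canonical norm is the max norm, so Euclidean
   lengths are defined by hand; the product topology and the product Lebesgue
   measure are the usual ones. *)
Notation plane R := (R * R)%type.

Section Plane.
Context {R : realType}.
Implicit Types (p q : plane R).

Definition dotp p q : R := p.1 * q.1 + p.2 * q.2.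

Definition enorm p : R := Num.sqrt (dotp p p).

Definition edist p q : R := enorm (p - q).

Definition disk (c : plane R) (r : R) : set (plane R) :=
  [set p | edist c p <= r].

Definition segment p q : set (plane R) :=
  [set (1 - t) *: p + t *: q | t in `[0, 1]].

Definition area (A : set (plane R)) : \bar R :=
  (lebesgue_measure \x lebesgue_measure)%E A.

(* Length of a (possibly empty) line segment given as a point set: for such a
   set, length and diameter agree. *)
Definition seg_length (s : set (plane R)) : R :=
  sup [set edist p q | p in s & q in s].

End Plane.

Section Pentagon.
Context {R : realType}.

(* Vertices are listed in cyclic order; [edge v i] joins the vertices [i] and
   [i + 1] (mod 5). *)
Definition edge (v : 'I_5 -> plane R) (i : 'I_5) : set (plane R) :=
  segment (v i) (v (ordS i)).

Definition simple_polygon (v : 'I_5 -> plane R) : Prop :=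
  [/\ injective v,
      forall i, edge v i `&` edge v (ordS i) = [set v (ordS i)] &
      forall i j, j != i -> j != ordS i -> i != ordS j ->
        edge v i `&` edge v j = set0].

(* A pentagon is the closed region enclosed by a simple closed polygonal curve
   with five vertices, that is, the compact regular closed set whose
   topological boundary is that curve. *)
Record pentagon := Pentagon {
  vertex : 'I_5 -> plane R ;
  region : set (plane R) ;
  vertex_simple : simple_polygon vertex ;
  region_compact : compact region ;
  region_regclosed : regclosed region ;
  region_boundary : closure region `\` region° = \bigcup_i edge vertex i }.

Implicit Types P Q : pentagon.

Definition unit_area P : Prop := area (region P) = 1%E.

Definition perimeter P : R :=
  \sum_(i < 5) edist (vertex P i) (vertex P (ordS i)).

Definition udir (p q : plane R) : plane R := (edist p q)^-1 *: (q - p).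

(* The angle between the two sides at vertex [i], measured through the region.
   The sides make an angle in [0, pi]; that is the interior angle if the
   bisecting ray starts inside the region, and otherwise the interior angle is
   what remains of the full turn.  (For a straight angle the bisector vanishes
   and both alternatives give [pi].) *)
Definition interior_angle P (i : 'I_5) : R :=
  let v := vertex P i in
  let a := udir v (vertex P (ordS i)) in
  let b := udir v (vertex P (ord_pred i)) in
  let alpha := acos (dotp a b) in
  if `[< \forall s \near 0^'+, region P (v + s *: (a + b)) >]
  then alpha else 2 * pi - alpha.

Definition circumscribed P : Prop :=
  exists (c : plane R) (r : R), [/\ 0 < r, disk c r `<=` region P &
    forall i, exists p, edge (vertex P) i p /\ edist c p = r].

Definition adjacent (i j : 'I_5) : bool := (j == ordS i) || (i == ordS j).

Definition right_and_hexagonal_angles P (i j : 'I_5) : Prop :=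
  [/\ interior_angle P i = pi / 2, interior_angle P j = pi / 2 &
      forall k, k != i -> k != j -> interior_angle P k = 2 * pi / 3].

Definition cairo P : Prop :=
  circumscribed P /\
  exists i j, [/\ i != j, ~~ adjacent i j & right_and_hexagonal_angles P i j].

Definition prismatic P : Prop :=
  circumscribed P /\
  exists i j, [/\ i != j, adjacent i j & right_and_hexagonal_angles P i j].

(* [C] is meant to be a unit-area Cairo pentagon; all of them have the same
   perimeter, so the choice of [C] does not matter. *)
Definition efficient (C P : pentagon) : Prop :=
  unit_area P /\ perimeter P <= perimeter C.

Definition non_convex P : Prop :=
  ~ convex_set (region P : set (convex_lmodType (plane R))).

Definition reflex_count P : nat := #|[pred i | pi < interior_angle P i]|.

Definition type1 P : Prop := non_convex P /\ reflex_count P = 1%N.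

Definition type2 P : Prop := non_convex P /\ reflex_count P = 2%N.

End Pentagon.

Arguments pentagon : clear implicits.

Section Tiling.
Context {R : realType} {I : choiceType}.
Implicit Type T : I -> pentagon R.

Definition tiling T : Prop :=
  \bigcup_i region (T i) = setT /\
  forall i j, i != j -> (region (T i))° `&` (region (T j))° = set0.

Definition edge_to_edge T : Prop :=
  forall i j, i != j -> forall p, region (T i) p -> region (T j) p ->
    (exists a b, edge (vertex (T i)) a = edge (vertex (T j)) b /\
                 edge (vertex (T i)) a p) \/
    (exists a b, vertex (T i) a = p /\ vertex (T j) b = p).

(* The edges are collected in a set of point sets, so an edge shared by two
   tiles is counted once. *)
Definition tiling_edges T : set (set (plane R)) :=
  [set e | exists i k, e = edge (vertex (T i)) k].

Definition perimeter_in_disk T (r : R) : \bar R :=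
  (\esum_(e in tiling_edges T) (seg_length (e `&` disk 0 r))%:E)%E.

(* Value in the extended reals: a tiling need not have finite perimeter in a
   disk. *)
Definition perimeter_ratio T : \bar R :=
  limf_esup (fun r : R => perimeter_in_disk T r * ((pi * r ^+ 2)^-1)%:E)%E
    (+oo%R : set_system R).

Definition tiles_in_disk T (r : R) : set I :=
  [set i | region (T i) `<=` disk 0 r].

Definition fraction_in_disk T (A : pentagon R -> Prop) (r : R) : R :=
  #|` fset_set (tiles_in_disk T r `&` [set i | A (T i)])|%:R /
  #|` fset_set (tiles_in_disk T r)|%:R.

End Tiling.

(* Main.v *)
Require Import Defs.
From HB Require Import structures.
From mathcomp Require Import all_boot all_order all_algebra finmap.
From mathcomp Require Import all_classical all_reals all_analysis.
From mathcomp Require Import measurable_realfun ring lra.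
(* Imported again because [all_analysis] shadows [edist]. *)
Require Import Defs.

(* A unit-area pentagon has perimeter at least that of the regular pentagon, at
   least 4 (unit square) when some vertex is reflex, and at least that of the
   equilateral triangle when two vertices are: dropping reflex vertices leaves a
   polygon with fewer sides, no smaller shoelace area and no larger perimeter.
   These values are compared with the prismatic perimeter p = 3.8637...: the sum
   over the tiles inside the disk of 19.29 (p - perimeter) is at most the sum of
   the weights 1, -2.6 and -13.4 of the efficient, Type 1 and Type 2 tiles, with a
   little room to spare. An edge lies on at most two tiles, so the perimeter in
   the disk is at least half the sum of the perimeters of the tiles; each tile
   that meets a slightly smaller disk without lying in the large one contributes
   a long piece of its boundary, so such tiles are too few to prevent the average
   perimeter of the tiles inside from being nearly at most p, up to an error that
   vanishes as the radius grows. *)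

Set Implicit Arguments.
Unset Strict Implicit.
Unset Printing Implicit Defensive.

Import Order.TTheory GRing.Theory Num.Theory.
Import numFieldNormedType.Exports.

Local Open Scope classical_set_scope.
Local Open Scope ring_scope.

(** * The polygonal isoperimetric inequality *)
Section Isoperimetric.
Context {R : realType}.
Implicit Types (p q a b : plane R) (x y : R).

(** A pentagon is given only as a compact regular closed set bounded by a simple closed curve, so
    its orientation, its area formula and the link between angles and convexity have to be
    recovered. The key fact is local: every edge has the region on exactly one side, with the same
    sign [eps] all around. Hence, along a line through no vertex, the membership indicator is [eps]
    times a signed count of crossings. Integrating this count gives the shoelace formula; excluding
    the pattern in, out, in gives convexity when no vertex is reflex. Dropping reflex vertices may
    leave a self-intersecting polygon, which is why the isoperimetric inequality concerns arbitrary
    closed chains and signed area. Tiles can be arbitrarily long, so those meeting the rim of the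
    disk cannot be confined to a thin ring. A tile reaching from radius [r - 24] beyond radius [r]
    is instead charged length 8 inside the disk, more than the bound [q <= 4] on the mean perimeter,
    while it covers area at most 1 of the small disk; such tiles only improve the estimate for the
    others. *)

Definition cr p q : R := p.1 * q.2 - p.2 * q.1.

Definition cot x : R := cos x / sin x.

Lemma le_cot x y : 0 < x -> x <= y -> y < pi -> cot y <= cot x.
Proof.
move=> x0 xy ypi.
have sx : 0 < sin x by apply: sin_gt0_pi; rewrite x0 (le_lt_trans xy).
have sy : 0 < sin y by apply: sin_gt0_pi; rewrite ypi (lt_le_trans x0).
have syx : 0 <= sin (y - x).
  by apply: sin_ge0_pi; rewrite subr_ge0 xy /=; lra.
rewrite -subr_ge0.
have -> : cot x - cot y = sin (y - x) / (sin x * sin y).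
  by rewrite sinB /cot; field; rewrite !gt_eqF.
by rewrite divr_ge0 // mulr_ge0 // ltW.
Qed.

Lemma cotBpi x : cot (pi - x) = - cot x.
Proof. by rewrite /cot sinB cosB sinpi cospi !mul0r !mulN1r addr0 sub0r opprK mulNr. Qed.

Lemma cot_atan x : 0 < x -> cot (atan x) = x^-1.
Proof.
move=> x0; rewrite -{2}[x]atanK /tan /cot invfM invrK mulrC //.
Qed.

(** Multiplied by the three positive sines, the gap is the squared norm of [sin be] times [a] minus
    [sin al] times [b] turned by [- (al + be)]. It vanishes when [a] and [b] are consecutive chords
    of a circle with inscribed angles [al] and [be]. *)
Lemma cot_merge (al be : R) a b :
  0 < sin al -> 0 < sin be -> 0 < sin (al + be) ->
  2 * cr a b + cot (al + be) * dotp (a + b) (a + b) <=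
  cot al * dotp a a + cot be * dotp b b.
Proof.
rewrite /cot sinD cosD.
have := cos2Dsin2 al; have := cos2Dsin2 be.
move: (sin al) (sin be) (cos al) (cos be) => sa sb ca cb hb ha sa0 sb0 s0.
set s := sa * cb + ca * sb in s0 *; set c := ca * cb - sa * sb.
rewrite /cr /dotp /= -subr_ge0.
set D := (X in 0 <= X).
have hD : D * (sa * sb * s) =
  (sb * a.1 - sa * (c * b.1 + s * b.2)) ^+ 2 +
  (sb * a.2 - sa * (c * b.2 - s * b.1)) ^+ 2.
  have -> : D * (sa * sb * s) =
    (sb * a.1 - sa * (c * b.1 + s * b.2)) ^+ 2 +
    (sb * a.2 - sa * (c * b.2 - s * b.1)) ^+ 2 +
    (a.1 ^+ 2 + a.2 ^+ 2) * sb ^+ 2 * (ca ^+ 2 + sa ^+ 2 - 1) -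
    (b.1 ^+ 2 + b.2 ^+ 2) * sa ^+ 2 * ((ca ^+ 2 + sa ^+ 2 - 1) * (cb ^+ 2 + sb ^+ 2)).
    by rewrite /D /c /s; field; rewrite !gt_eqF.
  rewrite ha hb; ring.
have : 0 < sa * sb * s by rewrite !mulr_gt0.
move=> p0; rewrite -(pmulr_lge0 _ p0) hD addr_ge0 ?sqr_ge0 //.
Qed.

Lemma atan_tangent x y : 0 < x -> 0 <= y ->
  atan y <= atan x + (y - x) / (1 + x ^+ 2).
Proof.
move=> x0 y0.
have dat (z : R) : is_derive z 1 atan (1 + z ^+ 2)^-1 by exact: is_derive1_atan.
have ct u w : {within `[u, w], continuous (@atan R)}.
  by apply: continuous_subspaceT => z; exact: continuous_atan.
case: (ltgtP y x) => [yx|xy|->]; last by rewrite subrr mul0r addr0.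
- have [z /[!in_itv]/= /andP[yz zx] hz] := MVT yx (fun z _ => dat z) (ct _ _).
  rewrite -subr_ge0.
  have -> : atan x + (y - x) / (1 + x ^+ 2) - atan y =
     (x - y) * ((1 + z ^+ 2)^-1 - (1 + x ^+ 2)^-1).
    have -> : atan x = atan y + (1 + z ^+ 2)^-1 * (x - y) by rewrite -hz; ring.
    ring.
  apply: mulr_ge0; first by lra.
  rewrite subr_ge0 lef_pV2 ?posrE; nra.
- have [z /[!in_itv]/= /andP[xz zy] hz] := MVT xy (fun z _ => dat z) (ct _ _).
  rewrite -subr_ge0.
  have -> : atan x + (y - x) / (1 + x ^+ 2) - atan y =
     (y - x) * ((1 + x ^+ 2)^-1 - (1 + z ^+ 2)^-1).
    have -> : atan y = atan x + (1 + z ^+ 2)^-1 * (y - x) by rewrite -hz; ring.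
    ring.
  apply: mulr_ge0; first by lra.
  rewrite subr_ge0 lef_pV2 ?posrE; nra.
Qed.

(** By induction, [cot_merge] replaces the chain so far by its chord, with the sum of its angles;
    the [cr] terms collect twice the signed area of the fan of triangles from the starting point. *)
Lemma cot_chain (al : nat -> R) (e : nat -> plane R) n :
  (forall j, (j <= n)%N -> 0 < al j) -> \sum_(j < n.+1) al j < pi ->
  2 * (\sum_(k < n.+1) cr (\sum_(j < k) e j) (e k)) +
  cot (\sum_(j < n.+1) al j) * dotp (\sum_(j < n.+1) e j) (\sum_(j < n.+1) e j)
  <= \sum_(j < n.+1) cot (al j) * dotp (e j) (e j).
Proof.
elim: n => [|n IH] al0.
  rewrite !big_ord_recr !big_ord0 /= !add0r => _.
  by rewrite /cr /= !mul0r subr0 mulr0 add0r.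
rewrite big_ord_recr /=; set S := \sum_(_ < _) al _ => Spi.
have Sn0 : 0 < S.
  rewrite /S big_ord_recl; apply: ltr_wpDr; last exact: al0.
  by apply: sumr_ge0 => j _; apply/ltW/al0/ltnW/(ltn_ord (lift ord0 j)).
have an0 : 0 < al n.+1 by exact: al0.
have {}IH := IH (fun j jn => al0 j (leqW jn)).
have {}IH := IH ltac:(rewrite -/S; lra).
rewrite [X in 2 * X]big_ord_recr [X in dotp X X]big_ord_recr [leRHS]big_ord_recr /=.
have sS : 0 < sin S by apply: sin_gt0_pi; lra.
have sa : 0 < sin (al n.+1) by apply: sin_gt0_pi; lra.
have sSa : 0 < sin (S + al n.+1) by apply: sin_gt0_pi; lra.
have := @cot_merge S (al n.+1) (\sum_(j < n.+1) e j) (e n.+1) sS sa sSa.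
move: IH; rewrite -/S; lra.
Qed.

(* With angles [al j] whose tangents are proportional to the side lengths, the
   weighted sum of squares in [cot_chain] is proportional to the squared
   perimeter, and concavity of [atan] bounds the sum of the angles by [pi]. *)
Theorem isoperimetric (n : nat) (e : nat -> plane R) : (2 < n)%N ->
  \sum_(j < n) e j = 0 -> (forall j, (j < n)%N -> 0 < enorm (e j)) ->
  2 * (\sum_(k < n) cr (\sum_(j < k) e j) (e k)) <=
  (\sum_(j < n) enorm (e j)) ^+ 2 / (n%:R * tan (pi / n%:R)).
Proof.
move=> n2 e0 l0; set L := \sum_(j < n) enorm (e j).
have n0 : 2 < n%:R :> R by rewrite ltr_nat.
have nn0 : 0 < n%:R :> R by lra.
have p0 := pi_gt0 R.
have q0 : 0 < pi / n%:R :> R by rewrite divr_gt0.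
have q1 : pi / n%:R < pi / 2 :> R.
  by rewrite ltr_pM2l // ltf_pV2 ?posrE.
have t0 : 0 < tan (pi / n%:R : R).
  rewrite /tan divr_gt0 //.
    by apply: sin_gt0_pi; rewrite q0 /=; lra.
  by apply: cos_gt0_pihalf; rewrite q1 andbT; lra.
have atant : atan (tan (pi / n%:R : R)) = pi / n%:R.
  by rewrite tanK // in_itv /= q1 andbT; lra.
move: (tan _) t0 atant => t t0 atant.
have L0 : 0 < L.
  rewrite /L; case: n n2 {e0 n0 nn0 q0 q1 t t0 atant L} l0 => // n _ l0.
  rewrite big_ord_recl; apply: ltr_wpDr; last exact: l0.
  by apply: sumr_ge0 => j _; apply: sqrtr_ge0.
(* The arguments average [t], the tangent of [pi / n], so the tangent lines to [atan] at [t] add up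
   to exactly [pi]. *)
pose al j := atan (n%:R * t * enorm (e j) / L).
have al0 j : (j < n)%N -> 0 < al j.
  by move=> jn; rewrite -(atan0 R); apply: lt_atan; rewrite divr_gt0 ?mulr_gt0 ?l0.
have alpi : \sum_(j < n) al j <= pi.
  apply: (@le_trans _ _ (\sum_(j < n) (pi / n%:R + (n%:R * t * enorm (e j) / L - t) / (1 + t ^+ 2)))).
    apply: ler_sum => j _; rewrite -atant; apply: atan_tangent => //.
    by rewrite divr_ge0 ?mulr_ge0 // ?ltW // l0.
  have t1 : 0 < 1 + t ^+ 2 by rewrite ltr_wpDr ?sqr_ge0.
  rewrite (eq_bigr (fun j : 'I_n => (pi / n%:R - t / (1 + t ^+ 2)) +
      enorm (e j) * (n%:R * t / (L * (1 + t ^+ 2))))); last first.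
    by move=> j _; field; rewrite !gt_eqF.
  rewrite big_split /= -mulr_suml -/L sumr_const card_ord -mulr_natl.
  rewrite le_eqVlt; apply/orP; left; apply/eqP; field.
  by rewrite !gt_eqF.
have cotal j : (j < n)%N -> cot (al j) * dotp (e j) (e j) = L / (n%:R * t) * enorm (e j).
  move=> jn; rewrite cot_atan; last by rewrite divr_gt0 // !mulr_gt0 ?l0.
  have -> : dotp (e j) (e j) = enorm (e j) ^+ 2.
    by rewrite sqr_sqrtr // /dotp addr_ge0 // -expr2 sqr_ge0.
  by field; rewrite !gt_eqF ?l0.
(* All the angles together may reach [pi], which [cot_chain] does not allow; the last side is kept
   out of the chain. *)
case: n n2 {n0 nn0 q0 q1} e0 l0 @L t t0 atant L0 @al al0 alpi cotal => [//|[//|n]] n2 e0 l0 L t t0 atant L0 al al0 alpi cotal.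
set S := \sum_(j < n.+1) al j; set a := al n.+1.
have a0 : 0 < a by exact: al0.
have alE : \sum_(j < n.+2) al j = S + a by rewrite big_ord_recr.
have Spi : S < pi by lra.
have := @cot_chain al e n (fun j jn => al0 j (leqW jn)) Spi.
rewrite -/S => ch.
have eE : \sum_(j < n.+1) e j = - e n.+1.
  by move/eqP: e0; rewrite big_ord_recr /= addr_eq0 => /eqP.
have S0 : 0 < S.
  rewrite /S big_ord_recl; apply: ltr_wpDr; last exact: al0.
  by apply: sumr_ge0 => j _; apply/ltW/al0/(leqW (ltn_ord (lift ord0 j))).
(* As [S + a <= pi], the angle [S] of the chord can be traded for the angle [a] of the last side,
   which is the opposite vector. *)
have cS : - cot a <= cot S.
  by rewrite -cotBpi; apply: le_cot => //; lra.
have dd : 0 <= dotp (e n.+1) (e n.+1) by rewrite /dotp addr_ge0 // -expr2 sqr_ge0.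
rewrite big_ord_recr /= eE.
have -> : cr (- e n.+1) (e n.+1) = 0 by rewrite /cr /=; ring.
have dE : dotp (- e n.+1) (- e n.+1) = dotp (e n.+1) (e n.+1) by rewrite /dotp /=; ring.
rewrite eE dE in ch.
have : \sum_(j < n.+2) cot (al j) * dotp (e j) (e j) = L ^+ 2 / (n.+2%:R * t).
  rewrite (eq_bigr (fun j : 'I__ => L / (n.+2%:R * t) * enorm (e j))); last by move=> j _; rewrite cotal.
  by rewrite -mulr_sumr -/L; ring.
rewrite big_ord_recr /= -/a => <-.
rewrite addr0; nra.
Qed.

Lemma tan_pi3 : tan (pi / 3%:R) = Num.sqrt 3 :> R.
Proof.
have p0 := pi_gt0 R.
have c0 : 0 < cos (pi / 3%:R : R) by apply: cos_gt0_pihalf; lra.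
have s0 : 0 < sin (pi / 3%:R : R) by apply: sin_gt0_pi; lra.
have : cos (pi / 3%:R + pi / 3%:R) = - cos (pi / 3%:R : R).
  have -> : pi / 3%:R + pi / 3%:R = - (pi / 3%:R) + pi :> R by field.
  by rewrite cosDpi cosN.
have := cos2Dsin2 (pi / 3%:R : R); rewrite cosD /tan.
move: (cos _) (sin _) c0 s0 => c s c0 s0 h1 h2.
have c2 : c = 1 / 2 by nra.
have s2 : s ^+ 2 = 3 / 4 by subst c; lra.
apply/eqP; rewrite -(@eqrXn2 _ 2) ?sqrtr_ge0 ?divr_ge0 ?ltW // sqr_sqrtr //.
rewrite expr_div_n s2 c2; by apply/eqP; field.
Qed.

(** At [pi / 5] the sines of the double and the triple angle agree, so the cosine is the positive
    root of 4c^2 - 2c - 1. *)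
Lemma tan_pi5 : tan (pi / 5%:R) ^+ 2 = 5 - 2 * Num.sqrt 5 :> R.
Proof.
have p0 := pi_gt0 R.
have c0 : 0 < cos (pi / 5%:R : R) by apply: cos_gt0_pihalf; lra.
have s0 : 0 < sin (pi / 5%:R : R) by apply: sin_gt0_pi; lra.
set th := pi / 5%:R in c0 s0 *.
have : sin (th + th + th) = sin (th + th).
  have -> : th + th + th = - (th + th) + pi by rewrite /th; field.
  by rewrite sinDpi sinN opprK.
have := cos2Dsin2 th; rewrite !sinD cosD /tan.
move: (cos _) (sin _) c0 s0 => c s c0 s0 h1 h2.
have h3 : 4 * c ^+ 2 - 2 * c - 1 = 0.
  apply: (mulfI (lt0r_neq0 s0)); rewrite mulr0.
  have s2 : s ^+ 2 = 1 - c ^+ 2 by lra.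
  have : s * (3 * c ^+ 2 - s ^+ 2 - 2 * c) = 0 by lra.
  rewrite s2; lra.
have q0 : 0 <= Num.sqrt 5 :> R := sqrtr_ge0 _.
have q2 : Num.sqrt 5 ^+ 2 = 5 :> R by rewrite sqr_sqrtr.
have cE : c = (1 + Num.sqrt 5) / 4.
  have : (4 * c - 1 - Num.sqrt 5) * (4 * c - 1 + Num.sqrt 5) = 0 by nra.
  move/eqP; rewrite mulf_eq0 => /orP[] /eqP; first by lra.
  move=> h; nra.
rewrite expr_div_n; apply: (mulIf (lt0r_neq0 (exprn_gt0 2 c0))).
rewrite divfK ?gt_eqF ?exprn_gt0 //.
have -> : s ^+ 2 = 1 - c ^+ 2 by lra.
rewrite cE; move: (Num.sqrt 5) q2 => q q2.
have : q ^+ 3 = 5 * q by rewrite exprS q2; ring.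
move: q2; clear; nra.
Qed.

End Isoperimetric.

(** * Interior and orientation of a pentagon *)
Section Boxes.
Context {R : realType}.
Implicit Types (p q z : plane R) (r t x y : R).

(** The open ball of the max norm, written as four inequalities so that membership becomes linear
    arithmetic. *)
Definition box z r : set (plane R) :=
  [set p | [/\ z.1 - r < p.1, p.1 < z.1 + r, z.2 - r < p.2 & p.2 < z.2 + r]].

Lemma box_nbhs z r : 0 < r -> nbhs z (box z r).
Proof.
move=> r0; apply/nbhs_ballP; exists r => //= p [].
rewrite /ball /= !ltr_norml => /andP[h1 h2] /andP[h3 h4].
by split; lra.
Qed.

Lemma nbhs_box z (A : set (plane R)) : nbhs z A -> exists2 r, 0 < r & box z r `<=` A.
Proof.
move=> /nbhs_ballP[r /= r0 rA]; exists r => // p [h1 h2 h3 h4]; apply: rA.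
by split; rewrite /ball /= ltr_norml; apply/andP; split; lra.
Qed.

Lemma box_open z r p : box z r p -> exists2 r', 0 < r' & box p r' `<=` box z r.
Proof.
case=> h1 h2 h3 h4.
exists (Num.min (Num.min (p.1 - (z.1 - r)) (z.1 + r - p.1))
                (Num.min (p.2 - (z.2 - r)) (z.2 + r - p.2))).
  by rewrite !lt_min !subr_gt0 h1 h2 h3.
set m := Num.min _ _.
have m1 : m <= p.1 - (z.1 - r) by rewrite !ge_min lexx.
have m2 : m <= z.1 + r - p.1 by rewrite !ge_min lexx !orbT.
have m3 : m <= p.2 - (z.2 - r) by rewrite !ge_min lexx !orbT.
have m4 : m <= z.2 + r - p.2 by rewrite !ge_min lexx !orbT.
by move=> q [g1 g2 g3 g4]; split; lra.
Qed.

Lemma conv_gt t x y c : 0 <= t <= 1 -> c < x -> c < y -> c < (1 - t) * x + t * y.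
Proof.
move=> /andP[t0 t1] cx cy; have [tE|tx] := eqVneq t 0; first by rewrite tE; lra.
have t0' : 0 < t by rewrite lt_neqAle eq_sym tx.
have : 0 < t * (y - c) by rewrite mulr_gt0 // subr_gt0.
have : 0 <= (1 - t) * (x - c) by rewrite mulr_ge0 // subr_ge0 // ltW.
lra.
Qed.

Lemma conv_lt t x y c : 0 <= t <= 1 -> x < c -> y < c -> (1 - t) * x + t * y < c.
Proof.
move=> t01 cx cy; rewrite -ltrN2.
have -> : - ((1 - t) * x + t * y) = (1 - t) * - x + t * - y by ring.
by apply: conv_gt; rewrite // ltrN2.
Qed.

Lemma box_conv z r p q t : 0 <= t <= 1 -> box z r p -> box z r q ->
  box z r ((1 - t) *: p + t *: q).
Proof.
by move=> t01 [h1 h2 h3 h4] [g1 g2 g3 g4]; split;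
  [exact: conv_gt|exact: conv_lt|exact: conv_gt|exact: conv_lt].
Qed.

Lemma plane_eq p q : p.1 = q.1 -> p.2 = q.2 -> p = q.
Proof. by case: p q => [a b] [c d] /= -> ->. Qed.

Lemma fstZ t p : (t *: p).1 = t * p.1. Proof. by []. Qed.
Lemma sndZ t p : (t *: p).2 = t * p.2. Proof. by []. Qed.
Lemma fstD p q : (p + q).1 = p.1 + q.1. Proof. by []. Qed.
Lemma sndD p q : (p + q).2 = p.2 + q.2. Proof. by []. Qed.
Lemma fstN p : (- p).1 = - p.1. Proof. by []. Qed.
Lemma sndN p : (- p).2 = - p.2. Proof. by []. Qed.
Definition coordE := (fstD, sndD, fstN, sndN, fstZ, sndZ).

Lemma cr_conv (e : plane R) z p q t :
  cr e ((1 - t) *: p + t *: q - z) = (1 - t) * cr e (p - z) + t * cr e (q - z).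
Proof. by rewrite /cr !coordE; ring. Qed.

Lemma box_small z (d : plane R) r : 0 < r ->
  exists2 s0, 0 < s0 & forall s, 0 < s -> s < s0 -> box z r (z + s *: d).
Proof.
move=> r0; exists (r / (1 + `|d.1| + `|d.2|)).
  by rewrite divr_gt0 // -addrA ltr_wpDr // addr_ge0.
move=> s s0; have m0 : 0 < 1 + `|d.1| + `|d.2| by rewrite -addrA ltr_wpDr // addr_ge0.
rewrite ltr_pdivlMr // => h.
have n1 := normr_ge0 d.1; have n2 := normr_ge0 d.2.
have := ler_norm d.1; have := ler_norm (- d.1); have := ler_norm d.2; have := ler_norm (- d.2).
rewrite !normrN /box /mkset !coordE => a1 a2 a3 a4.
by split; nra.
Qed.

Lemma continuous_path p q : continuous (fun t : R => (1 - t) *: p + t *: q).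
Proof.
move=> t; apply: cvgD.
  apply: cvgZl; apply: cvgB; [exact: cvg_cst|exact: cvg_id].
by apply: cvgZl; exact: cvg_id.
Qed.

Lemma segment_connected_plane p q : connected (segment p q).
Proof.
apply: connected_continuous_connected; first exact: segment_connected.
by apply: continuous_subspaceT; exact: continuous_path.
Qed.

Lemma compact_segment p q : compact (segment p q).
Proof.
apply: continuous_compact; last exact: segment_compact.
by apply: continuous_subspaceT; exact: continuous_path.
Qed.

Lemma segmentP p q z : segment p q z <->
  exists2 t, 0 <= t <= 1 & z = (1 - t) *: p + t *: q.
Proof.
split=> [[t] | [t t01 ->]]; first by rewrite /= in_itv /= => t01 <-; exists t.
by exists t => //=; rewrite in_itv.
Qed.

Lemma conv0 p q : (1 - 0) *: p + 0 *: q = p.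
Proof. by rewrite subr0 scale1r scale0r addr0. Qed.

Lemma conv1 p q : (1 - 1) *: p + 1 *: q = q.
Proof. by rewrite subrr scale1r scale0r add0r. Qed.

End Boxes.

Section Local.
Context {R : realType} (P : pentagon R).
Let v := vertex P.
Let K := region P.
Implicit Types (p q z x : plane R) (r s t : R) (i j : 'I_5).

Definition curve : set (plane R) := \bigcup_i edge v i.

Definition edgev i : plane R := v (ordS i) - v i.

Definition edge_point i t : plane R := (1 - t) *: v i + t *: v (ordS i).

Lemma region_closed : closed K.
Proof. by apply: compact_closed; [exact: norm_hausdorff|exact: region_compact]. Qed.

Lemma curveE : curve = K `\` K°.
Proof.
rewrite /curve -region_boundary; congr (_ `\` _).
by symmetry; apply/closure_id/region_closed.
Qed.

Lemma curve_region p : curve p -> K p.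
Proof. by rewrite curveE => -[]. Qed.

Lemma curve_interior p : curve p -> ~ K° p.
Proof. by rewrite curveE => -[]. Qed.

Lemma region_interior p : K p -> ~ curve p -> K° p.
Proof. by rewrite curveE => Kp h; apply: contrapT => np; apply: h. Qed.

(** Off the curve, [K] and its interior coincide, so [K] cuts out a subset of [S] that is both open
    and closed in [S]. *)
Lemma connected_side (S : set (plane R)) p q : connected S -> S `&` curve = set0 ->
  S p -> S q -> K p -> K q.
Proof.
move=> cS Sc Sp Sq Kp.
suff SK : S `&` K = S by move: Sq; rewrite -{1}SK => -[].
have SKo : S `&` K = S `&` K°.
  apply/seteqP; split => [y [Sy Ky]|y [Sy Ky]]; split => //.
    by apply: region_interior => // cy; rewrite -[False]/(set0 y) -Sc.
  exact: interior_subset Ky.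
apply: cS; first by exists p.
- by exists K°; [exact: open_interior|].
- by exists K => //; exact: region_closed.
Qed.

Lemma seg_side p q :
  (forall t, 0 <= t <= 1 -> ~ curve ((1 - t) *: p + t *: q)) -> K p -> K q.
Proof.
move=> h; apply: (@connected_side (segment p q)).
- exact: segment_connected_plane.
- by apply/seteqP; split => // z [/segmentP[t t01 ->]] /h; apply.
- by apply/segmentP; exists 0; rewrite ?conv0 ?lexx ?ler01.
- by apply/segmentP; exists 1; rewrite ?conv1 ?lexx ?ler01.
Qed.

Lemma seg_side_iff p q :
  (forall t, 0 <= t <= 1 -> ~ curve ((1 - t) *: p + t *: q)) -> (K p <-> K q).
Proof.
move=> h; split; first exact: seg_side.
apply: seg_side => t /andP[t0 t1].
have -> : (1 - t) *: q + t *: p = (1 - (1 - t)) *: p + (1 - t) *: q.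
  by rewrite subKr addrC.
by apply: h; rewrite subr_ge0 t1 gerBl t0.
Qed.

Lemma edgeP i z : edge v i z <-> exists2 t, 0 <= t <= 1 & z = edge_point i t.
Proof. exact: segmentP. Qed.

Lemma vertex_inj : injective v.
Proof. by case: (vertex_simple P). Qed.

Lemma ordS5_neq i : ordS i != i.
Proof. by rewrite -val_eqE /=; case: i => [[|[|[|[|[|]]]]]]. Qed.

Lemma edge_point_lt_neq i t : t < 1 -> edge_point i t <> v (ordS i).
Proof.
move=> t1 h; have : (1 - t) *: (v (ordS i) - v i) = 0.
  have : v (ordS i) - edge_point i t = 0 by rewrite h subrr.
  by rewrite /edge_point => <-; rewrite scalerBr scalerBl scale1r opprD addrA addrAC.
move/eqP; rewrite scaler_eq0 subr_eq0 gt_eqF //= subr_eq0 => /eqP /vertex_inj /eqP.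
by rewrite (negPf (ordS5_neq i)).
Qed.

Lemma edge_point_gt_neq i t : 0 < t -> edge_point i t <> v i.
Proof.
move=> t0 h; have : t *: (v (ordS i) - v i) = 0.
  have : edge_point i t - v i = 0 by rewrite h subrr.
  by rewrite /edge_point => <-; rewrite scalerBr scalerBl scale1r addrAC addrAC [RHS]addrC addrA addKr addrC.
move/eqP; rewrite scaler_eq0 subr_eq0 gt_eqF //= => /eqP /vertex_inj /eqP.
by rewrite (negPf (ordS5_neq i)).
Qed.

Lemma edge_point_unique i j t : 0 < t < 1 -> edge v j (edge_point i t) -> j = i.
Proof.
move=> /andP[t0 t1] ej.
have ei : edge v i (edge_point i t) by apply/edgeP; exists t => //; rewrite !ltW.
have [_ adj disj] := vertex_simple P; rewrite -/v in adj disj.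
have [//|ji] := eqVneq j i.
have [jS|jS] := eqVneq j (ordS i).
  have : (edge v i `&` edge v (ordS i)) (edge_point i t) by rewrite -jS.
  by rewrite adj => /edge_point_lt_neq.
have [iS|iS] := eqVneq i (ordS j).
  have : (edge v j `&` edge v (ordS j)) (edge_point i t) by rewrite -iS.
  by rewrite adj -iS => /edge_point_gt_neq.
have : (edge v i `&` edge v j) (edge_point i t) by [].
by rewrite disj.
Qed.

Lemma vertex_edges i j : edge v j (v (ordS i)) -> j = i \/ j = ordS i.
Proof.
move=> ej.
have eS : edge v (ordS i) (v (ordS i)).
  by apply/edgeP; exists 0; rewrite ?lexx ?ler01 // /edge_point conv0.
have [_ adj disj] := vertex_simple P; rewrite -/v in adj disj.
have [->|jS] := eqVneq j (ordS i); first by right.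
have [jSS|jSS] := eqVneq j (ordS (ordS i)).
  have : (edge v (ordS i) `&` edge v (ordS (ordS i))) (v (ordS i)) by rewrite -jSS.
  by rewrite adj => /vertex_inj /eqP; rewrite eq_sym (negPf (ordS5_neq _)).
have [/(can_inj (@ordSK 5)) <-|iS] := eqVneq (ordS i) (ordS j); first by left.
have : (edge v (ordS i) `&` edge v j) (v (ordS i)) by [].
by rewrite disj.
Qed.

Lemma closed_edge j : closed (edge v j).
Proof. by apply: compact_closed; [exact: norm_hausdorff|exact: compact_segment]. Qed.

(** Each of the five closed edges that misses [z] misses a neighbourhood of [z]. *)
Lemma near_edges z : exists2 r, 0 < r &
  forall p j, box z r p -> edge v j p -> edge v j z.
Proof.
have : \forall p \near z, forall j, edge v j p -> edge v j z.
  apply: (@filter_forall _ _ (fun j p => edge v j p -> edge v j z) (nbhs z)) => j.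
  have [ez|nez] := pselect (edge v j z); first by apply: nearW.
  have : nbhs z (~` edge v j).
    by apply: open_nbhs_nbhs; split => //; apply: closed_openC; exact: closed_edge.
  by apply: filterS => p np /np.
by move=> /nbhs_box[r r0 h]; exists r => // p j /h /(_ j).
Qed.

End Local.

(** * The side of an edge on which the region lies *)

Section Side.
Context {R : realType} (P : pentagon R).
Notation v := (vertex P).
Notation K := (region P).
Implicit Types (p q z x : plane R) (r s t eps : R) (i j : 'I_5).

Definition perp p : plane R := (- p.2, p.1).

Lemma crrr p : cr p p = 0. Proof. by rewrite /cr; ring. Qed.

Lemma cr_perp p : cr p (perp p) = dotp p p.
Proof. by rewrite /cr /perp /dotp /=; ring. Qed.

Lemma dotpp_gt0 p : p != 0 -> 0 < dotp p p.
Proof.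
move=> pn0; rewrite lt_neqAle /dotp addr_ge0 -?expr2 ?sqr_ge0 // andbT eq_sym.
rewrite paddr_eq0 ?sqr_ge0 // !sqrf_eq0; apply: contra pn0 => /andP[/eqP a /eqP b].
by apply/eqP/plane_eq.
Qed.

Lemma edgev_neq0 i : edgev P i != 0.
Proof.
rewrite subr_eq0; apply/eqP => /vertex_inj /eqP.
by rewrite (negPf (ordS5_neq i)).
Qed.

Lemma cr_perp_gt0 i : 0 < cr (edgev P i) (perp (edgev P i)).
Proof. by rewrite cr_perp dotpp_gt0 // edgev_neq0. Qed.

Lemma edge_pointD i t s : edge_point P i s = edge_point P i t + (s - t) *: edgev P i.
Proof.
by apply: plane_eq; rewrite /edge_point /edgev !coordE; ring.
Qed.

Lemma cr_edge_point i t s p :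
  cr (edgev P i) (p - edge_point P i s) = cr (edgev P i) (p - edge_point P i t).
Proof. by rewrite (edge_pointD i t s) /cr !coordE; ring. Qed.

Lemma cr_shift (e p d z : plane R) s :
  cr e (p + s *: d - z) = cr e (p - z) + s * cr e d.
Proof. by rewrite /cr !coordE; ring. Qed.

Lemma edge_cr0 i t p : edge v i p -> cr (edgev P i) (p - edge_point P i t) = 0.
Proof.
move=> /edgeP[s _ ->]; rewrite (cr_edge_point i s t) subrr /cr /=; ring.
Qed.

(** Near the point, the region is to the left of the edge if [eps = 1] and to the right if
    [eps = -1]; nothing is said on the line of the edge itself. *)
Definition side i t eps := exists2 r, 0 < r &
  forall p, box (edge_point P i t) r p ->
    cr (edgev P i) (p - edge_point P i t) != 0 ->
    (K p <-> 0 < eps * cr (edgev P i) (p - edge_point P i t)).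

(** Near an inner point of an edge the curve stays on the line of that edge, so each half of a small
    box is entirely inside or entirely outside the region. It remains to exclude that both halves
    are alike. *)
Lemma side_ex i t : 0 < t < 1 -> side i t 1 \/ side i t (-1).
Proof.
move=> t01; set z := edge_point P i t; set e := edgev P i; set n := perp e.
have en : 0 < cr e n := cr_perp_gt0 i.
have [r r0 hr] := near_edges P z.
have avoid p : box z r p -> cr e (p - z) != 0 -> ~ curve P p.
  move=> bp cp [j _ ejp].
  have ji : j = i by apply: (edge_point_unique t01); exact: hr bp ejp.
  by rewrite ji in ejp; move: cp; rewrite /e /z (edge_cr0 t ejp) eqxx.
have half (g : R) p q : box z r p -> box z r q -> 0 < g * cr e (p - z) ->
    0 < g * cr e (q - z) -> (K p <-> K q).
  move=> bp bq cp cq; apply: seg_side_iff => u u01; apply: avoid.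
    exact: box_conv.
  rewrite cr_conv; apply/eqP => h.
  have := conv_gt u01 cp cq.
  have -> : (1 - u) * (g * cr e (p - z)) + u * (g * cr e (q - z)) =
    g * ((1 - u) * cr e (p - z) + u * cr e (q - z)) by ring.
  by rewrite h mulr0 ltxx.
have [s0 s00 hs0] := box_small z n r0.
have [s1 s10 hs1] := box_small z (- n) r0.
pose s := Num.min s0 s1 / 2.
have sgt0 : 0 < s by rewrite divr_gt0 // lt_min s00.
have m0 : 0 < Num.min s0 s1 by rewrite lt_min s00.
have sm0 : s < s0 by apply: (@lt_le_trans _ _ (Num.min s0 s1)); rewrite ?ge_min ?lexx // /s; lra.
have sm1 : s < s1 by apply: (@lt_le_trans _ _ (Num.min s0 s1)); rewrite ?ge_min ?lexx ?orbT // /s; lra.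
pose p0 := z + s *: n; pose p1 := z + s *: - n.
have b0 : box z r p0 by exact: hs0.
have b1 : box z r p1 by exact: hs1.
have c0 : 0 < cr e (p0 - z).
  rewrite /p0 cr_shift subrr (_ : cr e 0 = 0) ?add0r ?mulr_gt0 //.
  by rewrite /cr /=; ring.
have c1 : 0 < - cr e (p1 - z).
  rewrite /p1 cr_shift subrr (_ : cr e 0 = 0) ?add0r; last by rewrite /cr /=; ring.
  by rewrite (_ : - _ = s * cr e n) ?mulr_gt0 // /cr /=; ring.
have cz : curve P z by exists i => //; apply/edgeP; exists t => //; case/andP: t01 => *; rewrite !ltW.
have left p : box z r p -> 0 < cr e (p - z) -> (K p <-> K p0).
  by move=> bp cp; apply: (half 1) => //; rewrite mul1r.
have right p : box z r p -> cr e (p - z) < 0 -> (K p <-> K p1).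
  by move=> bp cp; apply: (half (-1)) => //; rewrite mulN1r // oppr_gt0.
have nbox p : box z r p -> exists2 s', 0 < s' & forall s, 0 < s -> s < s' -> box z r (p + s *: n).
  move=> /box_open[r' r'0 hr']; have [s' s'0 hs'] := box_small p n r'0.
  by exists s' => // u u0 us; apply/hr'/hs'.
(* Otherwise [z] would be interior: a point of the line off the curve is joined to one half along
   the normal. *)
have notboth : ~ (K p0 /\ K p1).
  move=> [K0 K1]; apply: (curve_interior cz); apply: filterS (box_nbhs z r0) => p bp.
  have [cp|cp|cp] := ltgtP (cr e (p - z)) 0.
  - by apply/(right p).
  - by apply/(left p).
  have [/curve_region //|ncp] := pselect (curve P p).
  have [s' s'0 hs'] := nbox p bp.
  have s2 : s' / 2 < s' by lra.
  have s20 : 0 < s' / 2 by lra.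
  apply: (@seg_side _ _ (p + (s' / 2) *: n)); last first.
    apply: (proj2 (left _ (hs' _ s20 s2) _)) => //.
    by rewrite cr_shift cp add0r mulr_gt0.
  move=> u /andP[u0 u1].
  have -> : (1 - u) *: (p + (s' / 2) *: n) + u *: p = p + ((1 - u) * (s' / 2)) *: n.
    by apply: plane_eq; rewrite !coordE; ring.
  have [->|u1'] := eqVneq u 1; first by rewrite subrr mul0r scale0r addr0.
  have u1'' : 0 < 1 - u by rewrite subr_gt0 lt_neqAle u1'.
  apply: avoid; last by rewrite cr_shift cp add0r !mulf_neq0 // gt_eqF.
  apply: hs'; first by rewrite mulr_gt0.
  by apply: le_lt_trans s2; rewrite ger_pMl //; lra.
(* Regular closedness gives interior points near [z]; one lying on the line is pushed off it along
   the normal. *)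
have notnone : K p0 \/ K p1.
  have : closure K° z by rewrite region_regclosed; exact: curve_region.
  move=> /(_ _ (box_nbhs z r0)) [y [Koy by_]].
  have [cp|cp|cp] := ltgtP (cr e (y - z)) 0.
  - by right; apply/(right y) => //; exact: interior_subset.
  - by left; apply/(left y) => //; exact: interior_subset.
  left; have [r' r'0 hr'] := nbhs_box Koy.
  have [s' s'0 hs'] := nbox y by_.
  have [s'' s''0 hs''] := box_small y n r'0.
  pose u := Num.min s' s'' / 2.
  have mu : 0 < Num.min s' s'' by rewrite lt_min s'0.
  have u0 : 0 < u by rewrite divr_gt0.
  have us' : u < s' by apply: (@lt_le_trans _ _ (Num.min s' s'')); rewrite ?ge_min ?lexx // /u; lra.
  have us'' : u < s'' by apply: (@lt_le_trans _ _ (Num.min s' s'')); rewrite ?ge_min ?lexx ?orbT // /u; lra.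
  apply: (proj1 (left _ (hs' _ u0 us') _)).
    by rewrite cr_shift cp add0r mulr_gt0.
  by apply: hr'; exact: hs''.
have [K0|nK0] := pselect (K p0).
  left; exists r => // p bp; rewrite -/e -/z mul1r neq_lt => /orP[cp|cp].
    rewrite (right p bp cp); split=> [K1|]; first by case: notboth.
    by rewrite ltNge ltW.
  by rewrite (left p bp cp).
right; exists r => // p bp; rewrite -/e -/z mulN1r oppr_gt0 neq_lt => /orP[cp|cp].
  by rewrite (right p bp cp); split => // _; case: notnone.
rewrite (left p bp cp); split => //.
by rewrite ltNge ltW.
Qed.

Lemma side_near_perp i t eps : side i t eps -> eps = 1 \/ eps = -1 ->
  exists2 s0, 0 < s0 & forall s, 0 < s -> s < s0 ->
    K (edge_point P i t + s *: (eps *: perp (edgev P i))) /\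
    ~ K (edge_point P i t - s *: (eps *: perp (edgev P i))).
Proof.
move=> [r r0 hr] eps1; set z := edge_point P i t in hr *; set e := edgev P i in hr *.
have [s0 s00 hs0] := box_small z (eps *: perp e) r0.
have [s1 s10 hs1] := box_small z (- (eps *: perp e)) r0.
have en : 0 < cr e (perp e) := cr_perp_gt0 i.
have ee : eps * eps = 1 by case: eps1 => ->; ring.
have cE s : cr e (z + s *: (eps *: perp e) - z) = s * eps * cr e (perp e).
  by rewrite /cr !coordE; ring.
have en0 : eps != 0 by case: eps1 => ->; rewrite ?oppr_eq0 oner_eq0.
exists (Num.min s0 s1); first by rewrite lt_min s00.
move=> s sgt0; rewrite lt_min => /andP[ss0 ss1]; split.
  apply/hr; [exact: hs0| |]; rewrite cE.
    by rewrite !mulf_neq0 // gt_eqF.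
  have -> : eps * (s * eps * cr e (perp e)) = s * cr e (perp e) * (eps * eps) by ring.
  by rewrite ee mulr1 mulr_gt0.
rewrite -scaleNr -[(- s) *: _]/((- s) *: (eps *: perp e)).
have bs : box z r (z + (- s) *: (eps *: perp e)).
  by rewrite scaleNr -scalerN; exact: hs1.
rewrite (hr _ bs) cE; last by rewrite !mulf_neq0 ?oppr_eq0 // gt_eqF.
have -> : eps * (- s * eps * cr e (perp e)) = - (s * cr e (perp e) * (eps * eps)) by ring.
by rewrite ee mulr1 oppr_gt0 => h; have := mulr_gt0 sgt0 en; rewrite ltNge ltW.
Qed.

Lemma side_uniq i t : side i t 1 -> side i t (-1) -> False.
Proof.
move=> h1 h2.
have [s0 s00 a0] := side_near_perp h1 (or_introl erefl).
have [s1 s10 a1] := side_near_perp h2 (or_intror erefl).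
pose u := Num.min s0 s1 / 2.
have mu : 0 < Num.min s0 s1 by rewrite lt_min s00.
have u0 : 0 < u by rewrite divr_gt0.
have us0 : u < s0 by apply: (@lt_le_trans _ _ (Num.min s0 s1)); rewrite ?ge_min ?lexx // /u; lra.
have us1 : u < s1 by apply: (@lt_le_trans _ _ (Num.min s0 s1)); rewrite ?ge_min ?lexx ?orbT // /u; lra.
have [k _] := a0 u u0 us0; have [_ nk] := a1 u u0 us1; apply: nk.
by rewrite scale1r scaleN1r scalerN opprK in k *.
Qed.

Lemma side_nbhs i t eps : side i t eps -> \forall t' \near t, side i t' eps.
Proof.
move=> [r r0 hr].
have r20 : 0 < r / 2 by lra.
have : \forall t' \near t, box (edge_point P i t) (r / 2) (edge_point P i t').
  exact: (@continuous_path _ (v i) (v (ordS i)) t _ (box_nbhs _ r20)).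
apply: filterS => t' bt'; exists (r / 2) => // p bp.
rewrite -(cr_edge_point i t' t) => c; apply: hr => //.
  by move: bt' bp; move=> [h1 h2 h3 h4] [g1 g2 g3 g4]; split; lra.
Qed.

(** The parameters with sign [eps] and those with sign [- eps] are disjoint open sets covering the
    connected interval ]0, 1[. *)
Lemma side_const i t t' : 0 < t < 1 -> 0 < t' < 1 ->
  forall eps, eps = 1 \/ eps = -1 -> side i t eps -> side i t' eps.
Proof.
move=> t01 t'01 eps e1 st.
pose A := [set u : R | 0 < u < 1].
have cA : connected A.
  apply/connected_intervalP => a b /= /andP[a0 a1] /andP[b0 b1] c /andP[ac cb].
  by rewrite /A /=; lra.
have opn g : open [set u : R | 0 < u < 1 /\ side i u g].
  rewrite openE => u /= [/andP[u0 u1] su].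
  apply: filterS3 (side_nbhs su) (lt_nbhsr u0) (lt_nbhsl u1) => w sw w0 w1.
  by split => //; rewrite w0.
have ng : - eps = 1 \/ - eps = -1 by case: e1 => ->; rewrite ?opprK; [right|left].
have ex u : 0 < u < 1 -> side i u eps \/ side i u (- eps).
  by move=> u01; have [h|h] := side_ex i u01; case: e1 => ->; rewrite ?opprK;
    [left|right|right|left].
have un u : side i u eps -> side i u (- eps) -> False.
  case: e1 => -> ; first exact: side_uniq.
  by rewrite opprK => h1 h2; exact: (side_uniq h2 h1).
have AE : A `&` [set u | 0 < u < 1 /\ side i u eps] = A.
  apply: cA.
  - by exists t.
  - by exists [set u | 0 < u < 1 /\ side i u eps].
  - exists (~` [set u | 0 < u < 1 /\ side i u (- eps)]); first exact/open_closedC/opn.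
    apply/seteqP; split=> u [Au].
      by move=> [_ su]; split => // -[_]; exact: un.
    by move=> /= nsu; split => //; split => //; case: (ex u Au) => // su; case: nsu.
have : A t' by [].
by rewrite -AE => -[_ []].
Qed.

End Side.

(** * One orientation for all five edges *)

Section Orientation.
Context {R : realType} (P : pentagon R).
Notation v := (vertex P).
Notation K := (region P).
Implicit Types (p q z w x : plane R) (r s t eps c : R) (i j : 'I_5).

Lemma small2 (s0 s1 : R) : 0 < s0 -> 0 < s1 -> exists s, [/\ 0 < s, s < s0 & s < s1].
Proof.
move=> h0 h1; exists (Num.min s0 s1 / 2).
have m0 : 0 < Num.min s0 s1 by rewrite lt_min h0.
have l0 : Num.min s0 s1 <= s0 by rewrite ge_min lexx.
have l1 : Num.min s0 s1 <= s1 by rewrite ge_min lexx orbT.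
split; lra.
Qed.

Definition oriented j eps := forall t, 0 < t < 1 -> side P j t eps.

(** Carries the side of an edge over to its endpoints: if no other piece of the curve near [w] lies
    strictly on the side of [p], then a segment from [p] to a point just off the edge, on the same
    side, avoids the curve. *)
Lemma halfplane_side j w tw rho eps p : w = edge_point P j tw -> 0 <= tw <= 1 -> 0 < rho ->
  oriented j eps ->
  (forall q, box w rho q -> curve P q -> edge v j q \/
     cr (edgev P j) (q - w) * cr (edgev P j) (p - w) <= 0) ->
  box w rho p -> cr (edgev P j) (p - w) != 0 ->
  (K p <-> 0 < eps * cr (edgev P j) (p - w)).
Proof.
move=> wE /andP[tw0 tw1] rho0 orj hq bp; set e := edgev P j in hq *; set c := cr e (p - w).
move=> cn0; have en : 0 < cr e (perp e) := cr_perp_gt0 P j.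
(* A small move towards the midpoint, since [w] may be an endpoint and the side is known only at
   inner points. *)
have [s0 s00 hs0] := box_small w ((1 / 2 - tw) *: e) rho0.
have [s [sgt0 ss0 s1]] := small2 s00 ltr01.
pose t := tw + s * (1 / 2 - tw).
have t01 : 0 < t < 1 by apply/andP; split; rewrite /t; nra.
have zE : edge_point P j t = w + s *: ((1 / 2 - tw) *: e).
  by apply: plane_eq; rewrite wE /t /e /edge_point /edgev !coordE; ring.
have bz : box w rho (edge_point P j t) by rewrite zE; exact: hs0.
have [r r0 hr] := orj t t01.
have [r' r'0 hr'] := box_open bz.
have [a0 a00 ha0] := box_small (edge_point P j t) (c *: perp e) r0.
have [a1 a10 ha1] := box_small (edge_point P j t) (c *: perp e) r'0.
have [a [agt0 aa0 aa1]] := small2 a00 a10.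
pose p1 := edge_point P j t + a *: (c *: perp e).
have crE q : cr e (q - w) = cr e (q - edge_point P j t) by rewrite wE (@cr_edge_point _ P j t tw).
have c1 : cr e (p1 - w) = c * (a * cr e (perp e)).
  by rewrite crE /p1 /cr !coordE; ring.
have a'0 : 0 < a * cr e (perp e) by rewrite mulr_gt0.
rewrite -(@seg_side_iff _ P p1 p); last first.
  move=> u u01 cu; have bu : box w rho ((1 - u) *: p1 + u *: p).
    by apply: box_conv => //; apply/hr'/ha1.
  have cc : 0 < c * cr e ((1 - u) *: p1 + u *: p - w).
    rewrite cr_conv c1 -/c.
    have -> : c * ((1 - u) * (c * (a * cr e (perp e))) + u * c) =
      (1 - u) * (c ^+ 2 * (a * cr e (perp e))) + u * c ^+ 2 by ring.
    have c2 : 0 < c ^+ 2 by rewrite lt_neqAle sqr_ge0 eq_sym sqrf_eq0 cn0.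
    by apply: conv_gt => //; rewrite mulr_gt0.
  have [ej|] := hq _ bu cu; last by rewrite mulrC leNgt cc.
  by move: cc; rewrite wE (edge_cr0 tw ej) mulr0 ltxx.
rewrite hr; last 2 first.
- exact: ha0.
- by rewrite -crE c1 mulf_neq0 // gt_eqF.
by rewrite -crE c1 mulrA pmulr_lgt0.
Qed.

Lemma edge_next i q : edge v (ordS i) q ->
  exists2 t, 0 <= t <= 1 & q - v (ordS i) = t *: edgev P (ordS i).
Proof.
move=> /edgeP[t t01 ->]; exists t => //.
by apply: plane_eq; rewrite /edge_point /edgev !coordE; ring.
Qed.

Lemma edge_prev i q : edge v i q ->
  exists2 t, 0 <= t <= 1 & q - v (ordS i) = - t *: edgev P i.
Proof.
move=> /edgeP[t t01 ->]; exists (1 - t); first by case/andP: t01 => *; apply/andP; split; lra.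
by apply: plane_eq; rewrite /edge_point /edgev !coordE; ring.
Qed.

Lemma crNl p q : cr p q = - cr q p. Proof. by rewrite /cr; ring. Qed.

Lemma crZr t p q : cr p (t *: q) = t * cr p q.
Proof. by rewrite /cr !coordE; ring. Qed.

Lemma vertex_curve i : exists2 rho, 0 < rho &
  forall q, box (v (ordS i)) rho q -> curve P q -> edge v i q \/ edge v (ordS i) q.
Proof.
have [rho rho0 h] := near_edges P (v (ordS i)); exists rho => // q bq [j _ ejq].
by have [ji|ji] := vertex_edges (h _ _ bq ejq); rewrite -ji; [left|right].
Qed.

(** For points not on the side of the line of edge [i] towards which the next edge turns; there the
    next edge is no obstacle. [next_side] is the same with the two edges exchanged. *)
Lemma prev_side i eps : oriented i eps -> exists2 rho, 0 < rho &
  forall p, box (v (ordS i)) rho p -> cr (edgev P i) (p - v (ordS i)) != 0 ->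
  cr (edgev P i) (p - v (ordS i)) * cr (edgev P i) (edgev P (ordS i)) <= 0 ->
  (K p <-> 0 < eps * cr (edgev P i) (p - v (ordS i))).
Proof.
move=> ori; have [rho rho0 hrho] := vertex_curve i; exists rho => // p bp cp cc.
apply: (halfplane_side (tw := 1) _ _ rho0) => //.
- by rewrite /edge_point conv1.
- by rewrite ler01 lexx.
move=> q bq /(hrho _ bq)[|/edge_next[t /andP[t0 t1] ->]]; [by left|right].
by rewrite crZr -mulrA mulr_ge0_le0 // mulrC.
Qed.

Lemma next_side i eps : oriented (ordS i) eps -> exists2 rho, 0 < rho &
  forall p, box (v (ordS i)) rho p -> cr (edgev P (ordS i)) (p - v (ordS i)) != 0 ->
  cr (edgev P (ordS i)) (p - v (ordS i)) * cr (edgev P i) (edgev P (ordS i)) <= 0 ->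
  (K p <-> 0 < eps * cr (edgev P (ordS i)) (p - v (ordS i))).
Proof.
move=> ori; have [rho rho0 hrho] := vertex_curve i; exists rho => // p bp cp cc.
apply: (halfplane_side (tw := 0) _ _ rho0) => //.
- by rewrite /edge_point conv0.
- by rewrite ler01 lexx.
move=> q bq /(hrho _ bq)[/edge_prev[t /andP[t0 t1] ->]|]; [right|by left].
rewrite crZr crNl.
have -> : - t * - cr (edgev P i) (edgev P (ordS i)) * cr (edgev P (ordS i)) (p - v (ordS i)) =
  t * (cr (edgev P (ordS i)) (p - v (ordS i)) * cr (edgev P i) (edgev P (ordS i))) by ring.
exact: mulr_ge0_le0.
Qed.

(** The two positive products describe the sector of angle less than [pi] between the edges at the
    vertex. It is convex and free of the curve, so membership can be tested at one point of it close
    to edge [i]. *)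
Lemma sector_side i eps : oriented i eps -> exists2 rho, 0 < rho &
  forall p, box (v (ordS i)) rho p ->
  0 < cr (edgev P i) (p - v (ordS i)) * cr (edgev P i) (edgev P (ordS i)) ->
  0 < cr (edgev P (ordS i)) (p - v (ordS i)) * cr (edgev P i) (edgev P (ordS i)) ->
  (K p <-> 0 < eps * cr (edgev P i) (edgev P (ordS i))).
Proof.
move=> ori; have [rho rho0 hrho] := vertex_curve i; exists rho => // p bp.
set w := v (ordS i) in hrho bp *; set e := edgev P i; set e' := edgev P (ordS i).
set c := cr e e' => h1 h2.
have cn0 : c != 0 by apply/eqP => c0; rewrite c0 mulr0 ltxx in h1.
have en : 0 < cr e (perp e) := cr_perp_gt0 P i.
have [s0 s00 hs0] := box_small w (- e) rho0.
have [s [sgt0 ss0 s1]] := small2 s00 ltr01.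
have t01 : 0 < 1 - s < 1 by apply/andP; split; lra.
have zE : edge_point P i (1 - s) = w + s *: - e.
  by apply: plane_eq; rewrite /edge_point /e /w /edgev !coordE; ring.
have bz : box w rho (edge_point P i (1 - s)) by rewrite zE; exact: hs0.
have [r r0 hr] := ori _ t01.
have [r' r'0 hr'] := box_open bz.
have [a0 a00 ha0] := box_small (edge_point P i (1 - s)) (c *: perp e) r0.
have [a1 a10 ha1] := box_small (edge_point P i (1 - s)) (c *: perp e) r'0.
have [a' [agt0' aa0' aa1']] := small2 a00 a10.
have m0 : 0 < 1 + `|cr e' (perp e)| by rewrite ltr_wpDr.
(* The push [a] off edge [i] is small compared with the distance [s] back from the vertex, so that
   the test point stays on the right side of the next edge as well. *)
have s20 : 0 < s / (1 + `|cr e' (perp e)|) by rewrite divr_gt0.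
have [a [agt0 aa' as_]] := small2 agt0' s20.
have aa0 : a < a0 by exact: lt_trans aa' aa0'.
have aa1 : a < a1 by exact: lt_trans aa' aa1'.
pose p1 := edge_point P i (1 - s) + a *: (c *: perp e).
have c1 : cr e (p1 - w) = c * (a * cr e (perp e)).
  by rewrite /p1 zE /cr !coordE; ring.
have c1' : cr e' (p1 - w) = c * (s + a * cr e' (perp e)).
  by rewrite /p1 zE /c /cr !coordE; ring.
have a'0 : 0 < a * cr e (perp e) by rewrite mulr_gt0.
have a''0 : 0 < s + a * cr e' (perp e).
  move: as_; rewrite ltr_pdivlMr // => as_.
  have := ler_norm (- cr e' (perp e)); rewrite normrN; nra.
have c2 : 0 < c ^+ 2 by rewrite lt_neqAle sqr_ge0 eq_sym sqrf_eq0 cn0.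
rewrite -(@seg_side_iff _ P p1 p); last first.
  move=> u u01 cu; have bu : box w rho ((1 - u) *: p1 + u *: p).
    by apply: box_conv => //; apply/hr'/ha1.
  have cc : 0 < cr e ((1 - u) *: p1 + u *: p - w) * c.
    rewrite cr_conv c1 mulrDl -!mulrA; apply: conv_gt => //.
    by have := mulr_gt0 c2 a'0; congr (_ < _); ring.
  have cc' : 0 < cr e' ((1 - u) *: p1 + u *: p - w) * c.
    rewrite cr_conv c1' mulrDl -!mulrA; apply: conv_gt => //.
    by have := mulr_gt0 c2 a''0; congr (_ < _); ring.
  have [/edge_prev[t t01' hE]|/edge_next[t t01' hE]] := hrho _ bu cu.
    by move: cc; rewrite hE crZr crrr mulr0 mul0r ltxx.
  by move: cc'; rewrite hE crZr crrr mulr0 mul0r ltxx.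
have crz : cr e (p1 - edge_point P i (1 - s)) = c * (a * cr e (perp e)).
  by rewrite /p1 /cr !coordE; ring.
rewrite hr; last 2 first.
- exact: ha0.
- by rewrite crz mulf_neq0 // gt_eqF.
by rewrite crz mulrA pmulr_lgt0.
Qed.

Lemma cr0_proportional p q : cr p q = 0 -> dotp p p *: q = dotp p q *: p.
Proof.
move=> c0; apply: plane_eq; rewrite !coordE; apply: subr0_eq.
  by transitivity (- p.2 * cr p q); [rewrite /cr /dotp; ring|rewrite c0 mulr0].
by transitivity (p.1 * cr p q); [rewrite /cr /dotp; ring|rewrite c0 mulr0].
Qed.

(** Collinear consecutive edges continue straight on: if they folded back they would share more than
    a vertex. *)
Lemma straight_dot i : cr (edgev P i) (edgev P (ordS i)) = 0 ->
  0 < dotp (edgev P i) (edgev P (ordS i)).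
Proof.
set e := edgev P i; set e' := edgev P (ordS i) => c0.
have en : 0 < dotp e e by apply/dotpp_gt0/edgev_neq0.
have e'n : 0 < dotp e' e' by apply/dotpp_gt0/edgev_neq0.
rewrite ltNge; apply/negP => d0.
pose k := - dotp e e' / dotp e e.
have k0 : 0 <= k by rewrite divr_ge0 ?oppr_ge0 // ltW.
have e'E : e' = - k *: e.
  have h1 := cr0_proportional c0.
  have -> : - k = (dotp e e)^-1 * dotp e e' by rewrite /k mulNr opprK mulrC.
  by rewrite -scalerA -h1 scalerA mulVf ?scale1r // gt_eqF.
(* With [e' = - k *: e], parameter [t] on the next edge is parameter [1 - t * k] on edge [i]; this
   choice makes both lie in the unit interval. *)
pose t := (1 + k)^-1.
have k1 : 0 < 1 + k by rewrite ltr_wpDr.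
have t0 : 0 < t by rewrite invr_gt0.
have t1 : t <= 1 by rewrite invf_le1 //; lra.
have tk : t * k <= 1 by rewrite /t mulrC ler_pdivrMr //; lra.
pose q := v (ordS i) + t *: e'.
have eS : edge v (ordS i) q.
  apply/edgeP; exists t; first by rewrite t1 ltW.
  by apply: plane_eq; rewrite /q /e' /edge_point /edgev !coordE; ring.
have ei : edge v i q.
  apply/edgeP; exists (1 - t * k); first by rewrite subr_ge0 tk gerBl mulr_ge0 // ltW.
  by apply: plane_eq; rewrite /q e'E /e /edge_point /edgev !coordE; ring.
have [_ adj _] := vertex_simple P.
have : (edge v i `&` edge v (ordS i)) q by [].
rewrite adj /= => /eqP; rewrite -subr_eq0 /q addrAC subrr add0r scaler_eq0.
by rewrite (negPf (edgev_neq0 _ _)) gt_eqF.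
Qed.

(** A direction [d] at the common vertex to which both [prev_side] and [next_side] apply, with the
    same sign for both edges, forces the signs to agree: [e - e'] if the vertex turns, the normal if
    it is straight. *)
Lemma oriented_next i eps eps' : eps = 1 \/ eps = -1 -> eps' = 1 \/ eps' = -1 ->
  oriented i eps -> oriented (ordS i) eps' -> eps = eps'.
Proof.
move=> e1 e1' oi oi'.
set e := edgev P i; set e' := edgev P (ordS i); set c := cr e e'; set w := v (ordS i).
have [r0 r00 h0] := prev_side oi; have [r1 r10 h1] := next_side oi'.
suff [d [d1 d2 d3 d4]] : exists d, [/\ 0 < cr e d * cr e' d, cr e d != 0,
    cr e d * c <= 0 & cr e' d * c <= 0].
  have [s0 s00 hs0] := box_small w d r00; have [s1 s10 hs1] := box_small w d r10.
  have [s [sgt0 ss0 ss1]] := small2 s00 s10.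
  have E (f : plane R) : cr f (w + s *: d - w) = s * cr f d by rewrite /cr !coordE; ring.
  have dn' : cr e' d != 0 by apply/eqP => h; rewrite h mulr0 ltxx in d1.
  have k0 : K (w + s *: d) <-> 0 < eps * cr e d.
    rewrite -(pmulr_rgt0 (eps * _) sgt0) mulrCA -E; apply: h0; first exact: hs0.
      by rewrite E mulf_neq0 // gt_eqF.
    by rewrite E -mulrA pmulr_rle0.
  have k1 : K (w + s *: d) <-> 0 < eps' * cr e' d.
    rewrite -(pmulr_rgt0 (eps' * _) sgt0) mulrCA -E; apply: h1; first exact: hs1.
      by rewrite E mulf_neq0 // gt_eqF.
    by rewrite E -mulrA pmulr_rle0.
  have {k0 k1} : 0 < eps * cr e d <-> 0 < eps' * cr e' d by rewrite -k0 -k1.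
  move: (cr e d) (cr e' d) d1 d2 dn' => x y xy x0 y0 [a b].
  have {}a : 0 < eps * x -> 0 < eps' * y := a.
  have {}b : 0 < eps' * y -> 0 < eps * x := b.
  have x2 : 0 < x * x by rewrite -expr2 lt_neqAle sqr_ge0 eq_sym sqrf_eq0 x0.
  move: a b; case: e1 => ->; case: e1' => -> //; rewrite !mul1r !mulN1r !oppr_gt0 => a b.
    by have [h|h|h] := ltgtP x 0; [have := b ltac:(nra)|have := a h|]; nra.
  by have [h|h|h] := ltgtP x 0; [have := a h|have := b ltac:(nra)|]; nra.
have [c0|cn0] := eqVneq c 0.
  exists (perp e); rewrite c0 !mulr0 lexx; split => //.
    rewrite mulr_gt0 ?cr_perp_gt0 //.
    have -> : cr e' (perp e) = dotp e e' by rewrite /cr /perp /dotp /=; ring.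
    exact: straight_dot.
  by rewrite gt_eqF // cr_perp_gt0.
have c2 : 0 < c ^+ 2 by rewrite lt_neqAle sqr_ge0 eq_sym sqrf_eq0 cn0.
exists (e - e').
have -> : cr e (e - e') = - c by rewrite /c /cr !coordE; ring.
have -> : cr e' (e - e') = - c by rewrite /c /cr !coordE; ring.
rewrite mulrNN -expr2 c2 oppr_eq0 cn0 mulNr -expr2 oppr_le0 ltW //.
Qed.

Lemma orientation_ex : exists2 eps, eps = 1 \/ eps = -1 & forall j, oriented j eps.
Proof.
have H j : exists2 eps, eps = 1 \/ eps = -1 & oriented j eps.
  have h01 : (0 < (2^-1 : R) < 1)%R by rewrite invr_gt0 invf_lt1 //; lra.
  have [h|h] := side_ex P j h01; [exists 1|exists (-1)]; try by [left|right].
    by move=> t t01; apply: side_const h => //; left.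
  by move=> t t01; apply: side_const h => //; right.
have N j eps : eps = 1 \/ eps = -1 -> oriented j eps -> oriented (ordS j) eps.
  by move=> e1 oj; have [eps' e1' oj'] := H (ordS j); rewrite (oriented_next e1 e1' oj oj').
have [eps e1 o0] := H ord0; exists eps => //.
have o1 := N _ _ e1 o0; have o2 := N _ _ e1 o1; have o3 := N _ _ e1 o2.
have o4 := N _ _ e1 o3.
move=> j.
have [] : [\/ j = ord0, j = ordS ord0 | j = ordS (ordS ord0)] \/
    j = ordS (ordS (ordS ord0)) \/ j = ordS (ordS (ordS (ordS ord0))).
  case: j => [[|[|[|[|[|]]]]]] // jn.
  - by left; apply: Or31; apply/val_inj.
  - by left; apply: Or32; apply/val_inj.
  - by left; apply: Or33; apply/val_inj.
  - by right; left; apply/val_inj.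
  - by right; right; apply/val_inj.
- by case=> ->.
- by case=> ->.
Qed.

End Orientation.

(** * The shoelace formula *)
Section PuncturedConst.
Context {R : realType}.
Implicit Types (s c : R).

(** Points are punctured because the functions compared later may disagree exactly at a crossing.
    The sets [A c] are open, disjoint and cover the line, so connectedness leaves only [A 0]. *)
Lemma punctured_const (g : R -> R) s1 :
  (forall s0, exists2 r, 0 < r &
     exists c, forall s, s != s0 -> `|s - s0| < r -> g s = c) ->
  (forall s, s < s1 -> g s = 0) ->
  forall s0, exists2 r, 0 < r & forall s, s != s0 -> `|s - s0| < r -> g s = 0.
Proof.
move=> loc g0.
pose A c := [set s0 | exists2 r, 0 < r & forall s, s != s0 -> `|s - s0| < r -> g s = c].
have nb s0 r : 0 < r -> \forall s \near s0, `|s - s0| < r.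
  by move=> r0; near=> s; rewrite distrC; near: s; apply: cvgr_dist_lt.
have oA c : open (A c).
  rewrite openE => s0 [r r0 h]; apply: filterS (nb s0 r r0) => s sr.
  have [->|ss0] := eqVneq s s0; first by exists r.
  exists (Num.min `|s - s0| (r - `|s - s0|)).
    by rewrite lt_min normr_gt0 !subr_gt0 subr_eq0 ss0.
  move=> u us; rewrite lt_min => /andP[h1 h2]; apply: h.
    by apply/eqP => us0; rewrite us0 distrC ltxx in h1.
  by have := ler_normD (u - s) (s - s0); rewrite subrKA; lra.
have cT : connected [set: R] by apply/connected_intervalP => a b _ _ c _.
have : A 0 = setT.
  apply: cT; [|exists (A 0)|exists (~` \bigcup_(c in [set c | c != 0]) A c)].
  - exists (s1 - 1); exists 1 => // s _ /ltr_distlDr h; apply: g0.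
    by rewrite subrK in h.
  - exact: oA.
  - by rewrite setTI.
  - by apply: open_closedC; apply: bigcup_open => c _; exact: oA.
  rewrite setTI; apply/seteqP; split=> s0 /=.
    move=> [r r0 h] [c /= c0 [r' r'0 h']].
    have [u [u0 ur ur']] := small2 r0 r'0.
    have us : s0 + u != s0 by rewrite -subr_eq0 addrAC subrr add0r gt_eqF.
    have e : `|s0 + u - s0| = u by rewrite addrAC subrr add0r gtr0_norm.
    by move: c0; rewrite -(h' _ us) ?e // (h _ us) ?e // eqxx.
  move=> nh; have [r r0 [c hc]] := loc s0.
  have [c0|c0] := eqVneq c 0; first by exists r => //; rewrite -c0.
  by case: nh; exists c => //; exists r.
move=> AT s0; have : A 0 s0 by rewrite AT.
by [].
Unshelve. all: end_near. Qed.

End PuncturedConst.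

(** * Membership along a line as a signed count of crossings *)

Section Slice.
Context {R : realType} (P : pentagon R) (eps : R).
Hypothesis eps1 : eps = 1 \/ eps = -1.
Hypothesis ori : forall j, oriented P j eps.
Notation v := (vertex P).
Notation K := (region P).
Variables (p d : plane R).

Let h (i : 'I_5) : R := cr d (v i - p).
Hypothesis h_neq0 : forall i, h i != 0.

Definition cross_sign (i : 'I_5) : R :=
  (0 < cr d (v i - p))%R%:R - (0 < cr d (v (ordS i) - p))%R%:R.

Definition cross_time (i : 'I_5) : R :=
  cr d (v i - p) / (cr d (v i - p) - cr d (v (ordS i) - p)).

(** Meaningful only if edge [i] crosses the line; otherwise [cross_sign i] is 0 and cancels the
    arbitrary value in [crossings]. *)
Definition cross_pos (i : 'I_5) : R :=
  dotp d (edge_point P i (cross_time i) - p) / dotp d d.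

Definition crossings (s : R) : R := \sum_i cross_sign i * (cross_pos i < s)%R%:R.

Lemma slice_dir_neq0 : d != 0.
Proof.
apply/eqP => d0; have := h_neq0 ord0.
by rewrite /h d0 /cr /= !mul0r subr0 eqxx.
Qed.

Lemma cr_edge_pointE i t : cr d (edge_point P i t - p) = (1 - t) * h i + t * h (ordS i).
Proof. exact: cr_conv. Qed.

Lemma dotp_shift (s : R) : dotp d (p + s *: d - p) = s * dotp d d.
Proof. by rewrite /dotp !coordE; ring. Qed.

Lemma cross_sign_cases i :
  [\/ [/\ cross_sign i = 1, 0 < h i & h (ordS i) < 0],
      [/\ cross_sign i = -1, h i < 0 & 0 < h (ordS i)] |
      cross_sign i = 0 /\ 0 < h i * h (ordS i)].
Proof.
rewrite /cross_sign -/(h i) -/(h (ordS i)).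
have := h_neq0 i; have := h_neq0 (ordS i).
have [x|x|//] := ltgtP (h i) 0; have [y|y|//] := ltgtP (h (ordS i)) 0 => _ _.
- by apply: Or33; rewrite subr0; split => //; nra.
- by apply: Or32; rewrite sub0r.
- by apply: Or31; rewrite subr0.
- by apply: Or33; rewrite subrr; split => //; nra.
Qed.

Lemma cross_point i : cross_sign i != 0 ->
  0 < cross_time i < 1 /\ edge_point P i (cross_time i) = p + cross_pos i *: d.
Proof.
move=> si0; have dd := dotpp_gt0 slice_dir_neq0.
have hn : h i - h (ordS i) != 0.
  apply/eqP => e; have [[_ a b]|[_ a b]|[e0 _]] := cross_sign_cases i.
  - lra.
  - lra.
  - by rewrite e0 eqxx in si0.
split.
  rewrite /cross_time -/(h i) -/(h (ordS i)).
  have [[_ a b]|[_ a b]|[e0 _]] := cross_sign_cases i.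
  - by rewrite divr_gt0 ?ltr_pdivrMr //; lra.
  - rewrite -mulrNN -invrN divr_gt0 ?ltr_pdivrMr //; lra.
  - by rewrite e0 eqxx in si0.
have c0 : cr d (edge_point P i (cross_time i) - p) = 0.
  rewrite cr_edge_pointE /cross_time -/(h i) -/(h (ordS i)); field.
  exact: hn.
have := cr0_proportional c0; rewrite /cross_pos mulrC -scalerA => <-.
by rewrite scalerA mulVf ?scale1r ?gt_eqF // addrC subrK.
Qed.

Lemma cross_edge i (s : R) : edge v i (p + s *: d) ->
  cross_sign i != 0 /\ s = cross_pos i.
Proof.
move=> /edgeP[t t01 E]; have dd := dotpp_gt0 slice_dir_neq0.
have := cr_edge_pointE i t; rewrite -E.
have -> : cr d (p + s *: d - p) = 0 by rewrite /cr !coordE; ring.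
move=> c0.
have si0 : cross_sign i != 0.
  have [[-> a b]|[-> a b]|[_ e0]] := cross_sign_cases i.
  - by rewrite oner_eq0.
  - by rewrite oppr_eq0 oner_eq0.
  exfalso; have := h_neq0 i; have := h_neq0 (ordS i).
  have [x|x|//] := ltgtP (h i) 0; have [y|y|//] := ltgtP (h (ordS i)) 0 => _ _.
  - by have := conv_lt t01 x y; rewrite -c0 ltxx.
  - by move: e0; rewrite ltNge nmulr_rle0 // ltW.
  - by move: e0; rewrite ltNge pmulr_rle0 // ltW.
  - by have := conv_gt t01 x y; rewrite -c0 ltxx.
split => //.
have tE : t = cross_time i.
  rewrite /cross_time -/(h i) -/(h (ordS i)).
  have hn : h i - h (ordS i) != 0.
    apply/eqP => e; have [[_ a b]|[_ a b]|[e0 _]] := cross_sign_cases i.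
    - lra.
    - lra.
    - by rewrite e0 eqxx in si0.
  by apply: (mulIf hn); rewrite divfK //; lra.
by rewrite /cross_pos -tE -E dotp_shift mulfK // gt_eqF.
Qed.

Lemma box_line (s0 r : R) : 0 < r -> exists2 r', 0 < r' &
  forall s, `|s - s0| < r' -> box (p + s0 *: d) r (p + s *: d).
Proof.
move=> r0.
have [a a0 ha] := box_small (p + s0 *: d) d r0.
have [b b0 hb] := box_small (p + s0 *: d) (- d) r0.
have [u [u0 ua ub]] := small2 a0 b0.
exists u => // s; have [ss|ss|->] := ltgtP s s0.
- rewrite ltr0_norm ?subr_lt0 // opprB => us.
  have -> : p + s *: d = p + s0 *: d + (s0 - s) *: - d.
    by apply: plane_eq; rewrite !coordE; ring.
  apply: hb; lra.
- rewrite gtr0_norm ?subr_gt0 // => us.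
  have -> : p + s *: d = p + s0 *: d + (s - s0) *: d.
    by apply: plane_eq; rewrite !coordE; ring.
  apply: ha; lra.
by move=> _; split; lra.
Qed.

Lemma sum_step_near (x : 'I_5 -> R) (s0 : R) : exists2 r, 0 < r &
  forall i, x i != s0 -> forall s, `|s - s0| < r -> (x i < s) = (x i < s0).
Proof.
have : \forall r \near 0^'+, forall i, x i != s0 -> forall s, `|s - s0| < r -> (x i < s) = (x i < s0).
  apply: (@filter_forall _ _ (fun i r => x i != s0 -> forall s, `|s - s0| < r -> (x i < s) = (x i < s0)) (0^'+)) => i.
  have [->|xs] := eqVneq (x i) s0; first by apply: nearW.
  have x0 : 0 < `|x i - s0| by rewrite normr_gt0 subr_eq0.
  near=> r => _ s.
  have : r < `|x i - s0| by near: r; exact: nbhs_right_lt.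
  rewrite ltr_norml => hr /andP[h1 h2].
  move: hr; have [a|a|a] := ltgtP (x i) s0.
  - by rewrite ltr0_norm ?subr_lt0 // => hr; rewrite (_ : x i < s) //; lra.
  - rewrite gtr0_norm ?subr_gt0 // => hr; apply/negbTE; rewrite -leNgt; lra.
  - by rewrite a eqxx in xs.
move=> H.
have [r [r0 hr]] := filter_ex (filterI (nbhs_right_gt (0 : R)) H).
by exists r.
Unshelve. all: end_near. Qed.

Lemma sign_pos (x : R) : 0 < x ->
  ((0 < 1 * x) = true) * ((0 < -1 * x) = false) *
  ((1 * x < 0) = false) * ((-1 * x < 0) = true).
Proof.
by move=> x0; rewrite mul1r mulN1r oppr_gt0 oppr_lt0 x0 !ltNge ltW.
Qed.

Lemma sign_neg (x : R) : x < 0 ->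
  ((0 < 1 * x) = false) * ((0 < -1 * x) = true) *
  ((1 * x < 0) = true) * ((-1 * x < 0) = false).
Proof.
by move=> x0; rewrite mul1r mulN1r oppr_gt0 oppr_lt0 x0 !ltNge ltW.
Qed.

Definition slice_defect (s : R) : R :=
  (`[< K (p + s *: d) >])%:R - eps * crossings s.

(** Off the curve neither term changes. At a crossing exactly one edge is met, and its [side] makes
    the indicator jump by [eps] times its [cross_sign]. *)
Lemma slice_local (s0 : R) : exists2 r, 0 < r & exists c,
  (forall s, s != s0 -> `|s - s0| < r -> slice_defect s = c) /\
  (~ curve P (p + s0 *: d) -> slice_defect s0 = c).
Proof.
have [r2 r20 hr2] := sum_step_near cross_pos s0.
have [[j _ ej]|nc] := pselect (curve P (p + s0 *: d)); last first.
  have : nbhs (p + s0 *: d) (~` curve P).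
    apply: open_nbhs_nbhs; split => //; apply: closed_openC; apply: closed_bigcup; first exact: finite_finset.
    by move=> i _; exact: closed_edge.
  move=> /nbhs_box[r r0 hr]; have [r1 r10 hr1] := box_line s0 r0.
  have [m [m0 m1 m2]] := small2 r10 r20.
  exists m => //; exists (slice_defect s0); split => // s ss0 sm.
  rewrite /slice_defect; congr (_ - _ * _).
    congr (_%:R); congr nat_of_bool; apply: asbool_equiv_eq.
    apply: seg_side_iff => t t01; apply: hr; apply: box_conv => //.
      by apply: hr1; lra.
    by apply: hr1; rewrite subrr normr0.
  apply: eq_bigr => i _.
  have [->|si0] := eqVneq (cross_sign i) 0; first by rewrite !mul0r.
  rewrite hr2 //; last by lra.
  apply/eqP => pi0; apply: nc; exists i => //; apply/edgeP.
  have [/andP[t0 t1] E] := cross_point si0; rewrite pi0 in E.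
  by exists (cross_time i); rewrite // !ltW.
have [sj0 s0E] := cross_edge ej.
have [t01 zE] := cross_point sj0; rewrite -s0E in zE.
have [r r0 hr] := ori j t01; rewrite zE in hr.
have [r1 r10 hr1] := box_line s0 r0.
have [m [m0 m1 m2]] := small2 r10 r20.
pose W := \sum_(i | i != j) cross_sign i * (cross_pos i < s0)%R%:R.
have cW s : `|s - s0| < m -> crossings s = cross_sign j * (s0 < s)%R%:R + W.
  move=> sm; rewrite /crossings (bigD1 j) //= -s0E; congr (_ + _).
  apply: eq_bigr => i ij.
  have [->|si0] := eqVneq (cross_sign i) 0; first by rewrite !mul0r.
  rewrite hr2 //; last by lra.
  apply/eqP => pi0; have [ti01 ziE] := cross_point si0; rewrite pi0 -zE in ziE.
  have /(edge_point_unique ti01) ji : edge v j (edge_point P i (cross_time i)).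
    rewrite ziE; apply/edgeP; exists (cross_time j) => //.
    by case/andP: t01 => *; rewrite !ltW.
  by rewrite ji eqxx in ij.
have dd := dotpp_gt0 slice_dir_neq0.
have crE s : cr (edgev P j) (p + s *: d - (p + s0 *: d)) = (s - s0) * (h j - h (ordS j)).
  by rewrite /h /edgev /cr !coordE; ring.
have KE s : s != s0 -> `|s - s0| < m ->
    (K (p + s *: d) <-> 0 < eps * ((s - s0) * (h j - h (ordS j)))).
  move=> ss0 sm; rewrite -crE; apply: hr; first by apply: hr1; lra.
  rewrite crE mulf_neq0 ?subr_eq0 //.
  have [[_ a b]|[_ a b]|[e _]] := cross_sign_cases j; last by rewrite e eqxx in sj0.
    by rewrite gt_eqF //; lra.
  by rewrite lt_eqF //; lra.
(* The first term is the indicator just before the crossing, the second the contribution of the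
   other edges. *)
pose c : R := (eps * (h j - h (ordS j)) < 0)%R%:R - eps * W.
exists m => //; exists c; split; last by move=> nc; case: nc; exists j.
move=> s ss0 sm; rewrite /slice_defect cW //.
suff -> : (`[< K (p + s *: d) >])%:R =
    (eps * (h j - h (ordS j)) < 0)%R%:R + eps * (cross_sign j * (s0 < s)%R%:R).
  by rewrite /c; ring.
rewrite (asbool_equiv_eq (KE s ss0 sm)) asboolb.
have [[-> a b]|[-> a b]|[e _]] := cross_sign_cases j; last by rewrite e eqxx in sj0.
- have g0 : 0 < h j - h (ordS j) by lra.
  have [sl|sl|e] := ltgtP s s0; last by rewrite e eqxx in ss0.
    have g1 : (s - s0) * (h j - h (ordS j)) < 0 by rewrite pmulr_llt0 ?subr_lt0.
    by case: eps1 => ->; rewrite (sign_neg g1) (sign_pos g0) !mulr0 addr0.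
  have g1 : 0 < (s - s0) * (h j - h (ordS j)) by apply: mulr_gt0; rewrite ?g0 ?subr_gt0.
  by case: eps1 => ->; rewrite (sign_pos g1) (sign_pos g0) /=; ring.
- have g0 : h j - h (ordS j) < 0 by lra.
  have [sl|sl|e] := ltgtP s s0; last by rewrite e eqxx in ss0.
    have g1 : 0 < (s - s0) * (h j - h (ordS j)) by rewrite nmulr_lgt0 // subr_lt0.
    by case: eps1 => ->; rewrite (sign_pos g1) (sign_neg g0) !mulr0 addr0.
  have g1 : (s - s0) * (h j - h (ordS j)) < 0 by rewrite pmulr_rlt0 ?subr_gt0.
  by case: eps1 => ->; rewrite (sign_neg g1) (sign_neg g0) /=; ring.
Qed.

Lemma region_bounded : exists2 M : R, 0 < M &
  forall q, K q -> - M < q.1 < M /\ - M < q.2 < M.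
Proof.
have [M [Mr HM]] := compact_bounded (region_compact (p := P)).
exists (`|M| + 1); first by rewrite ltr_wpDl.
move=> q Kq; have : `|q| <= `|M| + 1 / 2.
  by apply: (HM (`|M| + 1 / 2)) => //; have := ler_norm M; lra.
rewrite prod_normE ge_max !ler_norml => /andP[/andP[a1 a2] /andP[a3 a4]].
by split; apply/andP; split; lra.
Qed.

(** The defect is constant off the crossings and vanishes far out on the line, where the bounded
    region has not begun and no crossing has been passed. *)
Theorem slice (s : R) : ~ curve P (p + s *: d) ->
  (`[< K (p + s *: d) >])%:R = eps * crossings s :> R.
Proof.
move=> nc; apply/eqP; rewrite -subr_eq0; apply/eqP; rewrite -/(slice_defect s).
have [M M0 hM] := region_bounded.
have dd := dotpp_gt0 slice_dir_neq0.
pose B := (`|d.1| + `|d.2|) * M + `|dotp d p|.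
(* Below [s1] no crossing has been passed, and the scalar product with [d] is too small for a point
   of the region, whose coordinates are bounded by [M]. *)
pose s1 := Num.min (- B / dotp d d) (\big[Num.min/0]_i cross_pos i).
have [r r0 hr] : exists2 r, 0 < r & forall u, u != s -> `|u - s| < r -> slice_defect u = 0.
  apply: (@punctured_const _ _ s1).
    by move=> s0; have [r r0 [c [hc _]]] := slice_local s0; exists r => //; exists c.
  move=> u; rewrite /s1 lt_min => /andP[u1 u2]; rewrite /slice_defect.
  have -> : crossings u = 0.
    rewrite /crossings big1 // => i _; rewrite (_ : (_ < u) = false) ?mulr0 //.
    apply/negbTE; rewrite -leNgt; apply: (le_trans (ltW u2)).
    exact: bigmin_le.
  rewrite mulr0 subr0 (_ : `[< _ >] = false) //; apply/asboolPn => /hM[/andP[a1 a2] /andP[b1 b2]].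
  move: u1; rewrite ltr_pdivlMr //.
  have -> : u * dotp d d = dotp d (p + u *: d) - dotp d p by rewrite /dotp !coordE; ring.
  move: a1 a2 b1 b2; rewrite /B; set q := p + u *: d => a1 a2 b1 b2.
  have h1 : - (`|d.1| * M) <= d.1 * q.1.
    have : `|d.1 * q.1| <= `|d.1| * M by rewrite normrM ler_wpM2l // ler_norml !ltW.
    by rewrite ler_norml => /andP[].
  have h2 : - (`|d.2| * M) <= d.2 * q.2.
    have : `|d.2 * q.2| <= `|d.2| * M by rewrite normrM ler_wpM2l // ler_norml !ltW.
    by rewrite ler_norml => /andP[].
  have h3 := ler_norm (dotp d p).
  have -> : dotp d q = d.1 * q.1 + d.2 * q.2 by [].
  lra.
have [r' r'0 [c [hc hc0]]] := slice_local s.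
have [m [m0 mr mr']] := small2 r0 r'0.
have us : s + m != s by rewrite -subr_eq0 addrAC subrr add0r gt_eqF.
have e : `|s + m - s| = m by rewrite addrAC subrr add0r gtr0_norm.
by rewrite hc0 // -(hc (s + m)) ?e // hr ?e.
Qed.

End Slice.

(** * Measurability in the plane and integrals of affine functions *)

Section PlaneMeasure.
Context {R : realType}.
Local Notation mu := (@lebesgue_measure R).

(** An open set is a countable union of boxes with rational centre and rational half-side, and boxes
    are products of intervals. *)
Lemma open_measurable_plane (A : set (plane R)) : open A ->
  measurable (A : set (measurableTypeR R * measurableTypeR R)).
Proof.
move=> oA.
pose B (q : rat * rat * rat) : set (plane R) := box (ratr q.1.1, ratr q.1.2) (ratr q.2).
have -> : A = \bigcup_(q in [set q | B q `<=` A]) B q.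
  apply/seteqP; split=> [p Ap|p [q qA /qA //]].
  have [r r0 hr] := nbhs_box (open_nbhs_nbhs (conj oA Ap)).
  have hr2 : r / 4 < r / 2 by lra.
  have [c] := rat_in_itvoo hr2; rewrite in_itv /= => /andP[c1 c2].
  have ha1 : p.1 - r / 4 < p.1 by lra.
  have [a] := rat_in_itvoo ha1; rewrite in_itv /= => /andP[a1 a2].
  have hb1 : p.2 - r / 4 < p.2 by lra.
  have [b] := rat_in_itvoo hb1; rewrite in_itv /= => /andP[b1 b2].
  exists (a, b, c); last by split => /=; lra.
  by move=> q [/= h1 h2 h3 h4]; apply: hr; split; lra.
rewrite bigcup_mkcond; apply: countable_bigcupT_measurable => // q.
case: ifPn => // _.
have -> : B q = `]ratr q.1.1 - ratr q.2, ratr q.1.1 + ratr q.2[ `*`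
                `]ratr q.1.2 - ratr q.2, ratr q.1.2 + ratr q.2[.
  apply/seteqP; split=> [p [/= h1 h2 h3 h4]|p]; rewrite /= !in_itv /=.
    by rewrite h1 h2 h3 h4.
  by move=> [/andP[h1 h2] /andP[h3 h4]].
by apply: measurableX; exact: measurable_itv.
Qed.

Lemma closed_measurable_plane (A : set (plane R)) : closed A ->
  measurable (A : set (measurableTypeR R * measurableTypeR R)).
Proof.
by move/closed_openC/open_measurable_plane/measurableC; rewrite setCK.
Qed.

Lemma finite_measurable (A : set (measurableTypeR R)) : finite_set A -> measurable A.
Proof.
move=> fA; have -> : A = \bigcup_(x in A) [set x] by rewrite bigcup_imset1 image_id.
by apply: fin_bigcup_measurable => // x _; exact: measurable_set1.
Qed.

Lemma affine_integral (a b al be : R) : a < b ->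
  (\int[mu]_(x in `]a, b]) (al + be * x)%:E =
   ((b - a) * (al + be * (a + b) / 2))%:E)%E.
Proof.
move=> ab; pose F x := al * x + be / 2 * x ^+ 2.
have cf : continuous (fun x : R => al + be * x).
  by move=> x; apply: cvgD; [exact: cvg_cst|apply: cvgMr; exact: cvg_id].
have dF (x : R) : is_derive x 1 F (al + be * x).
  by rewrite /F; apply: is_derive_eq; rewrite -!/(_ * _) /GRing.scale /=; lra.
have cF : continuous F.
  by move=> x; apply/differentiable_continuous/derivable1_diffP; case: (dF x).
rewrite integral_itv_obnd_cbnd; last first.
  apply/measurable_EFinP/measurable_funTS; exact: continuous_measurable_fun.
rewrite (@continuous_FTC2 _ _ F) //.
- by rewrite -EFinD; congr (_%:E); rewrite /F; field.
- exact: continuous_subspaceT.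
- split; first by move=> x _; case: (dF x).
    by apply: cvg_at_right_filter; exact: cF.
  by apply: cvg_at_left_filter; exact: cF.
- by move=> x _; rewrite derive1E; case: (dF x).
Qed.

Lemma affine_integrable (a b al be : R) :
  mu.-integrable `]a, b] (EFin \o (fun x => al + be * x)).
Proof.
have cf : continuous (fun x : R => al + be * x).
  by move=> x; apply: cvgD; [exact: cvg_cst|apply: cvgMr; exact: cvg_id].
apply: (@integrableS _ _ _ mu `[a, b] `]a, b]) => //.
  by move=> x /=; rewrite !in_itv /= => /andP[h1 h2]; rewrite ltW.
by apply: continuous_compact_integrable; [exact: segment_compact|exact: continuous_subspaceT].
Qed.

End PlaneMeasure.

(** * The contribution of an edge to the area *)

Section Green.
Context {R : realType}.
Local Notation mu := (@lebesgue_measure R).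

Lemma step_integrable (M c y : R) :
  mu.-integrable `]- M, M] (EFin \o (fun s : R => c * (y < s)%R%:R)).
Proof.
apply: measurable_bounded_integrable => //.
- by rewrite /= lebesgue_measure_itv /=; case: ifP => // _; rewrite -EFinD ltry.
- have -> : (fun s : R => c * (y < s)%R%:R) = (fun s : R => c * \1_(`]y, +oo[ : set R) s).
    apply/funext => s; rewrite indicE; congr (_ * _%:R); congr nat_of_bool.
    by apply/idP/idP; rewrite inE /= in_itv /= andbT.
  by apply: measurable_funM => //; apply: measurable_indic; exact: measurable_itv.
- exists `|c|; split; first exact: num_real.
  move=> z cz s _; apply: le_trans (ltW cz); rewrite normrM.
  by case: (y < s)%R; rewrite ?normr1 ?normr0 ?mulr1 ?mulr0.
Qed.

(** For the edge from [(a, ya)] to [(b, yb)]: the length of the vertical line at [x] between the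
    edge and height [M], signed by the direction of the edge, and 0 if [x] is not between [a] and
    [b]. *)
Definition edge_weight (M a b ya yb x : R) : R :=
  ((a < x)%R%:R - (b < x)%R%:R) * (M - ya - (x - a) * ((yb - ya) / (b - a))).

(** One form for three cases: an edge running to the left swaps the interval and the sign, and a
    vertical edge gets the empty interval with [c = d]. *)
Lemma edge_weightE (M a b ya yb : R) : exists al be c d,
  [/\ c <= d, EFin \o edge_weight M a b ya yb = (EFin \o (fun x => al + be * x)) \_ `]c, d]
   & (d - c) * (al + be * (c + d) / 2) = (b - a) * (M - (ya + yb) / 2)].
Proof.
pose k := (yb - ya) / (b - a).
have [ab|ba|<-] := ltgtP a b.
- exists (M - ya + a * k), (- k), a, b; split; first exact: ltW.
    apply/funext => x; rewrite /= patchE /edge_weight -/k mem_setE in_itv /=.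
    have [ax|xa] := ltP a x; have [bx|xb] := ltP b x => /=; rewrite ?subrr ?mul0r //.
    + rewrite subr0; congr (_%:E); ring.
    + by exfalso; lra.
  by rewrite /k; field; lra.
- exists (- (M - ya + a * k)), k, b, a; split; first exact: ltW.
    apply/funext => x; rewrite /= patchE /edge_weight -/k mem_setE in_itv /=.
    have [ax|xa] := ltP a x; have [bx|xb] := ltP b x => /=; rewrite ?subrr ?mul0r //.
    + by exfalso; lra.
    + rewrite sub0r; congr (_%:E); ring.
  by rewrite /k; field; lra.
- exists 0, 0, a, a; split => //; last by rewrite !subrr !mul0r.
  apply/funext => x; rewrite /= patchE /edge_weight subrr mul0r mem_setE in_itv /=.
  by case: ifP => // /andP[]; rewrite ltNge => /negP h /h.
Qed.

Lemma edge_weight_integrable (M a b ya yb : R) :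
  mu.-integrable setT (EFin \o edge_weight M a b ya yb).
Proof.
have [al [be [c [d [_ -> _]]]]] := edge_weightE M a b ya yb.
by apply/(integrable_mkcond _ _).1 => //; exact: affine_integrable.
Qed.

Lemma edge_weight_integral (M a b ya yb : R) :
  (\int[mu]_x (edge_weight M a b ya yb x)%:E = ((b - a) * (M - (ya + yb) / 2))%:E)%E.
Proof.
have [al [be [c [d [cd E <-]]]]] := edge_weightE M a b ya yb.
rewrite -[LHS]/(\int[mu]_x ((EFin \o edge_weight M a b ya yb) x))%E E -integral_mkcond.
move: cd; rewrite le_eqVlt => /predU1P[<-|cd]; last exact: affine_integral.
rewrite subrr mul0r set_itv_ge ?integral_set0 //.
by rewrite bnd_simp ltxx.
Qed.

Lemma step_integral (M c y : R) : - M < y < M ->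
  (\int[mu]_(s in `](- M)%R, M]) (c * (y < s)%R%:R)%:E = (c * (M - y))%:E)%E.
Proof.
move=> /andP[My yM].
have -> : c * (M - y) = (M - y) * (c + 0 * (y + M) / 2).
  by rewrite !mul0r addr0 mulrC.
rewrite -affine_integral //.
rewrite integral_mkcond [RHS]integral_mkcond; apply: eq_integral => s _.
rewrite !patchE !mem_setE !in_itv /= mul0r addr0.
have [sM|Ms] := leP s M; rewrite ?andbF //= !andbT.
have [ys|sy] := ltP y s; first by rewrite (lt_trans My ys) mulr1.
by rewrite mulr0; case: ifP.
Qed.

End Green.

Section GreenFormula.
Context {R : realType} (P : pentagon R) (eps : R).
Hypothesis eps1 : eps = 1 \/ eps = -1.
Hypothesis ori : forall j, oriented P j eps.
Local Notation mu := (@lebesgue_measure R).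
Notation v := (vertex P).
Notation K := (region P).

Let up : plane R := (0, 1).

Lemma vertical_line (x s : R) : (x, 0) + s *: up = (x, s) :> plane R.
Proof. by apply: plane_eq; rewrite !coordE /=; ring. Qed.

Lemma cr_up (x : R) (q : plane R) : cr up (q - (x, 0)) = x - q.1.
Proof. by rewrite /cr !coordE /=; ring. Qed.

Lemma measurable_region : measurable (K : set (measurableTypeR R * measurableTypeR R)).
Proof. by apply: closed_measurable_plane; exact: region_closed. Qed.

(** [slice] along the upward line at [x], integrated up to [M]: off finitely many heights the
    indicator is a sum of steps, and a step at height y integrates to M - y. *)
Lemma slice_measure (M x : R) : (forall q, K q -> - M < q.1 < M /\ - M < q.2 < M) ->
  (forall i, (v i).1 != x) ->
  mu (xsection K x) =
  (\sum_i eps * edge_weight M (v i).1 (v (ordS i)).1 (v i).2 (v (ordS i)).2 x)%:E.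
Proof.
move=> KM vx.
have hn i : cr up (v i - (x, 0)) != 0 by rewrite cr_up subr_eq0 eq_sym.
have mS : measurable (xsection K x : set (measurableTypeR R)).
  by apply: measurable_xsection; exact: measurable_region.
have Kx s : xsection K x s <-> K (x, s) by rewrite /xsection /mkset inE.
pose g s := crossings P (x, 0) up s.
have posM i : cross_sign P (x, 0) up i != 0 -> - M < cross_pos P (x, 0) up i < M.
  move=> si0; have [/andP[t0 t1] zE] := cross_point hn si0.
  have : K (edge_point P i (cross_time P (x, 0) up i)).
    by apply: curve_region; exists i => //; apply/edgeP; eexists => //; rewrite !ltW.
  by rewrite zE vertical_line => /KM[].
pose N := [set cross_pos P (x, 0) up i | i in [set: 'I_5]].
have fN : finite_set N by apply: finite_image; exact: finite_finset.
have gE s : ~ N s -> (`[< K (x, s) >])%:R = eps * g s.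
  move=> Ns; rewrite /g -vertical_line -slice //; rewrite vertical_line.
  move=> [i _]; rewrite -vertical_line => /(cross_edge hn)[_ sE].
  by apply: Ns; exists i.
have stepI i : mu.-integrable `]- M, M]
    (fun s => (eps * cross_sign P (x, 0) up i * (cross_pos P (x, 0) up i < s)%R%:R)%:E).
  exact: step_integrable.
have sumE s : (eps * g s)%:E = (\sum_(i < 5)
    (eps * cross_sign P (x, 0) up i * (cross_pos P (x, 0) up i < s)%R%:R)%:E)%E.
  by rewrite sumEFin /g /crossings mulr_sumr; congr (_%:E); apply: eq_bigr => i _; rewrite mulrA.
have -> : mu (xsection K x) = (\int[mu]_(s in `](- M)%R, M]) (\1_(xsection K x) s)%:E)%E.
  rewrite integral_indic //; congr (mu _); apply/seteqP; split=> [s|s []//] Ks.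
  split => //; have /Kx/KM[_ /= /andP[h1 h2]] := Ks.
  by rewrite in_itv /= h1 ltW.
rewrite (@ae_eq_integral _ _ _ mu _ (fun s => (eps * g s)%:E)) //; first last.
- exists N; split.
  + exact: finite_measurable.
  + by apply: countable_lebesgue_measure0; exact: finite_set_countable.
  + move=> s /=; apply: contra_notP => Ns _; congr (_%:E).
    rewrite -gE // indicE; congr (_%:R); congr nat_of_bool.
    by apply/idP/asboolP; rewrite inE; [move/Kx|move/Kx].
- rewrite (_ : (fun s => _) = (fun s => (\sum_(i < 5)
    (eps * cross_sign P (x, 0) up i * (cross_pos P (x, 0) up i < s)%R%:R)%:E)%E)); last first.
    exact/funext.
  by apply: emeasurable_sum => i; exact: measurable_int (stepI i).
- by apply/measurable_EFinP; apply: measurable_indic.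
under eq_integral do rewrite sumE.
rewrite integral_sum // -sumEFin; apply: eq_bigr => i _.
have wE : cross_sign P (x, 0) up i = ((v i).1 < x)%R%:R - ((v (ordS i)).1 < x)%R%:R.
  by rewrite /cross_sign !cr_up !subr_gt0.
have [si0|si0] := eqVneq (cross_sign P (x, 0) up i) 0.
  rewrite si0 /edge_weight -wE si0 mul0r mulr0.
  by apply: integral0_eq => s _; rewrite mul0r.
rewrite step_integral ?posM // -mulrA wE; congr (_ * (_ * _))%:E.
rewrite /cross_pos /cross_time !cr_up /dotp /edge_point !coordE /=.
have h1 : x - (v i).1 - (x - (v (ordS i)).1) != 0.
  apply: contra si0; rewrite wE => /eqP h.
  by have -> : (v i).1 = (v (ordS i)).1; [lra|rewrite subrr].
have h2 : (v (ordS i)).1 - (v i).1 != 0.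
  by apply: contra h1 => /eqP h; apply/eqP; lra.
by field.
Qed.

(** The area is the integral of the lengths of vertical sections, hence a signed sum of trapezoids,
    one for each edge. *)
Theorem green : area K = (eps / 2 * \sum_i cr (v i) (v (ordS i)))%:E.
Proof.
have [M M0 KM] := region_bounded P.
pose N := [set (v i).1 | i in [set: 'I_5]].
have fN : finite_set N by apply: finite_image; exact: finite_finset.
pose f i x := eps * edge_weight M (v i).1 (v (ordS i)).1 (v i).2 (v (ordS i)).2 x.
have intf i : mu.-integrable setT (fun x => (f i x)%:E).
  by apply: (integrableZl _ _ (edge_weight_integrable _ _ _ _ _)).
rewrite /area /product_measure1.
rewrite (@ae_eq_integral _ _ _ mu _ (fun x => (\sum_(i < 5) (f i x)%:E)%E)) //; first last.
- exists N; split.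
  + exact: finite_measurable.
  + by apply: countable_lebesgue_measure0; exact: finite_set_countable.
  + move=> x /=; apply: contra_notP => Nx _.
    rewrite sumEFin; apply: slice_measure => // i; apply/eqP => h.
    by apply: Nx; exists i.
- by apply: emeasurable_sum => i; exact: measurable_int (intf i).
- by apply: measurable_fun_xsection; exact: measurable_region.
rewrite integral_sum //.
rewrite (eq_bigr (fun i : 'I_5 => (eps * (((v (ordS i)).1 - (v i).1) *
   (M - ((v i).2 + (v (ordS i)).2) / 2)))%:E)); last first.
  move=> i _; rewrite EFinM -edge_weight_integral -integralZl //.
  exact: edge_weight_integrable.
rewrite sumEFin; congr (_%:E).
have tele (h : 'I_5 -> R) : \sum_i h (ordS i) = \sum_i h i.
  by rewrite [RHS](reindex_inj (@ordS_inj 5)).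
rewrite -mulr_sumr -mulrA; congr (_ * _).
(* Trapezoid and [cr] term differ by a difference of [g] at the two ends; summed around the polygon
   it cancels, and [M] with it. *)
pose g i := M * (v i).1 - (v i).1 * (v i).2 / 2.
rewrite mulr_sumr (eq_bigr (fun i : 'I_5 => (g (ordS i) - g i) + 2^-1 * cr (v i) (v (ordS i)))).
  by rewrite big_split sumrB /= tele subrr add0r.
by move=> i _; rewrite /g /cr; field.
Qed.

End GreenFormula.

(** * Perimeters of pentagons with reflex vertices *)
Section Distances.
Context {R : realType}.
Implicit Types (p q a b c d : plane R).

Lemma enormN p : enorm (- p) = enorm p.
Proof. by rewrite /enorm /dotp /= !mulrNN. Qed.

Lemma sqr_enorm p : enorm p ^+ 2 = dotp p p.
Proof. by rewrite sqr_sqrtr // /dotp addr_ge0 // -expr2 sqr_ge0. Qed.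

Lemma enorm_ge0 p : 0 <= enorm p. Proof. exact: sqrtr_ge0. Qed.

Lemma enorm_gt0 p : p != 0 -> 0 < enorm p.
Proof. by move=> p0; rewrite sqrtr_gt0 dotpp_gt0. Qed.

Lemma lagrange p q : dotp p q ^+ 2 + cr p q ^+ 2 = dotp p p * dotp q q.
Proof. by rewrite /dotp /cr; ring. Qed.

Lemma dotp_le p q : dotp p q <= enorm p * enorm q.
Proof.
apply: le_trans (ler_norm _) _.
rewrite -(@ler_pXn2r _ 2) ?nnegrE ?mulr_ge0 ?enorm_ge0 //.
by rewrite real_normK ?num_real // exprMn !sqr_enorm -lagrange lerDl sqr_ge0.
Qed.

Lemma enormD p q : enorm (p + q) <= enorm p + enorm q.
Proof.
rewrite -(@ler_pXn2r _ 2) ?nnegrE ?addr_ge0 ?enorm_ge0 //.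
have -> : enorm (p + q) ^+ 2 = dotp p p + dotp q q + 2 * dotp p q.
  by rewrite sqr_enorm /dotp !coordE; ring.
rewrite sqrrD !sqr_enorm -mulr_natl; have := dotp_le p q; lra.
Qed.

Lemma edistC p q : edist p q = edist q p.
Proof. by rewrite /edist -enormN opprB. Qed.

Lemma edist_triangle q p r : edist p r <= edist p q + edist q r.
Proof. by rewrite /edist -(subrKA q); exact: enormD. Qed.

Lemma edist_gt0 p q : p != q -> 0 < edist p q.
Proof. by move=> pq; rewrite enorm_gt0 // subr_eq0. Qed.

(** The points are found by dividing in the ratio of signed distances. Strictness at one end of each
    segment keeps the denominators away from 0, while the other end may just touch. *)
Lemma segment_cross a b c d :
  cr (d - c) (a - c) != 0 -> cr (d - c) (a - c) * cr (d - c) (b - c) <= 0 ->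
  cr (b - a) (c - a) != 0 -> cr (b - a) (c - a) * cr (b - a) (d - a) <= 0 ->
  exists z, segment a b z /\ segment c d z.
Proof.
set al := cr (d - c) (a - c); set be := cr (d - c) (b - c).
set ga := cr (b - a) (c - a); set de := cr (b - a) (d - a).
have par (x y : R) : x != 0 -> x * y <= 0 -> x - y != 0 /\ 0 <= x / (x - y) <= 1.
  move=> x0 xy; have [x1|x1|/eqP] := ltgtP x 0; last by rewrite (negPf x0).
    have y0 : 0 <= y by rewrite -(nmulr_rle0 _ x1).
    have d0 : x - y < 0 by lra.
    split; first by rewrite lt_eqF.
    rewrite -mulrNN -invrN divr_ge0 ?ler_pdivrMr ?mul1r; lra.
  have y0 : y <= 0 by rewrite -(pmulr_rle0 _ x1).
  have d0 : 0 < x - y by lra.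
  split; first by rewrite gt_eqF.
  rewrite divr_ge0 ?ler_pdivrMr ?mul1r; lra.
move=> al0 ab ga0 gd; have [ab0 s01] := par _ _ al0 ab; have [gd0 t01] := par _ _ ga0 gd.
exists ((1 - al / (al - be)) *: a + (al / (al - be)) *: b); split.
  by apply/segmentP; exists (al / (al - be)).
apply/segmentP; exists (ga / (ga - de)) => //.
move: ab0 gd0; rewrite /al /be /ga /de /cr => ab0 gd0.
by apply: plane_eq; rewrite !coordE; field; rewrite ?ab0 ?gd0.
Qed.

End Distances.

(** * The isoperimetric inequality for closed chains of points *)

Section PolygonIsoperimetric.
Context {R : realType}.
Implicit Types (w : nat -> plane R) (p q r s : plane R) (eps : R).

Lemma isoperimetric_points n w : (2 < n)%N -> w n = w 0%N ->
  (forall j, (j < n)%N -> w j.+1 != w j) ->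
  2 * (\sum_(k < n) cr (w k) (w k.+1)) <=
  (\sum_(k < n) edist (w k) (w k.+1)) ^+ 2 / (n%:R * tan (pi / n%:R)).
Proof.
move=> n2 wn wneq; pose e j := w j.+1 - w j.
have sE k : \sum_(j < k) e j = w k - w 0%N.
  elim: k => [|k IH]; first by rewrite big_ord0 subrr.
  by rewrite big_ord_recr /= IH /e addrC subrKA.
have := @isoperimetric _ n e n2; rewrite sE wn subrr => /(_ erefl).
have en j : enorm (e j) = edist (w j) (w j.+1) by rewrite edistC.
under [\sum_(j < n) enorm _]eq_bigr do rewrite en.
have e0 j : (j < n)%N -> 0 < enorm (e j).
  by move=> jn; apply: enorm_gt0; rewrite subr_eq0 wneq.
move=> /(_ e0) /(le_trans _); apply.
rewrite ler_pM2l // le_eqVlt; apply/orP; left; apply/eqP.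
(* Measuring the area from the first vertex instead of the origin changes it by a telescoping
   sum. *)
rewrite [RHS](eq_bigr (fun k : 'I_n => cr (w k) (w k.+1) - cr (w 0%N) (w k.+1 - w k))); last first.
  by move=> k _; rewrite sE /e /cr !coordE; ring.
rewrite [RHS]sumrB.
have -> : \sum_(k < n) cr (w 0%N) (w k.+1 - w k) = cr (w 0%N) (\sum_(j < n) e j).
  apply/esym/(big_morph (cr (w 0%N))) => [x y|]; rewrite /cr ?coordE /=; ring.
by rewrite sE wn subrr {3}/cr /=; ring.
Qed.

Definition mirror p : plane R := (p.1, - p.2).

Lemma cr_mirror p q : cr (mirror p) (mirror q) = - cr p q.
Proof. by rewrite /cr /mirror /=; ring. Qed.

Lemma edist_mirror p q : edist (mirror p) (mirror q) = edist p q.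
Proof.
rewrite /edist /enorm; congr Num.sqrt; rewrite /dotp /mirror !coordE /=; ring.
Qed.

Lemma mirror_inj : injective mirror.
Proof. by move=> [a b] [c d] [-> /oppr_inj ->]. Qed.

(** A reflection changes the sign of the area and keeps the lengths, which settles clockwise
    chains. *)
Lemma isoperimetric_signed eps n w : eps = 1 \/ eps = -1 -> (2 < n)%N -> w n = w 0%N ->
  (forall j, (j < n)%N -> w j.+1 != w j) ->
  2 * (eps * \sum_(k < n) cr (w k) (w k.+1)) <=
  (\sum_(k < n) edist (w k) (w k.+1)) ^+ 2 / (n%:R * tan (pi / n%:R)).
Proof.
case=> -> n2 wn wneq; first by rewrite mul1r; exact: isoperimetric_points.
have := @isoperimetric_points n (mirror \o w) n2; rewrite /= wn => /(_ erefl).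
under eq_bigr do rewrite cr_mirror.
under [\sum_(j < n) edist _ _]eq_bigr do rewrite edist_mirror.
rewrite sumrN mulN1r; apply => j jn.
by rewrite (inj_eq mirror_inj) wneq.
Qed.

Lemma triangle_isoperimetric eps p q r : eps = 1 \/ eps = -1 ->
  p != q -> q != r -> r != p ->
  2 * (eps * (cr p q + cr q r + cr r p)) <=
  (edist p q + edist q r + edist r p) ^+ 2 / (3 * Num.sqrt 3).
Proof.
move=> e1 pq qr rp.
have := @isoperimetric_signed eps 3 (fun k => nth 0 [:: p; q; r; p] k) e1 isT erefl.
rewrite !big_ord_recl !big_ord0 /= !addr0 !addrA tan_pi3; apply.
by move=> [|[|[|]]] //= _; rewrite eq_sym.
Qed.

Lemma quad_isoperimetric eps p q r s : eps = 1 \/ eps = -1 ->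
  p != q -> q != r -> r != s -> s != p ->
  2 * (eps * (cr p q + cr q r + cr r s + cr s p)) <=
  (edist p q + edist q r + edist r s + edist s p) ^+ 2 / 4.
Proof.
move=> e1 pq qr rs sp.
have := @isoperimetric_signed eps 4 (fun k => nth 0 [:: p; q; r; s; p] k) e1 isT erefl.
rewrite !big_ord_recl !big_ord0 /= !addr0 !addrA tan_piquarter mulr1; apply.
by move=> [|[|[|[|]]]] //= _; rewrite eq_sym.
Qed.

End PolygonIsoperimetric.

Section SumFive.
Context {V : zmodType}.

Lemma sum_ordS (F : 'I_5 -> V) i : \sum_k F k =
  F i + F (ordS i) + F (ordS (ordS i)) + F (ordS (ordS (ordS i))) +
  F (ordS (ordS (ordS (ordS i)))).
Proof.
have base : \sum_k F k = F ord0 + F (ordS ord0) + F (ordS (ordS ord0)) +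
    F (ordS (ordS (ordS ord0))) + F (ordS (ordS (ordS (ordS ord0)))).
  rewrite !big_ord_recl big_ord0 addr0 !addrA.
  by do !congr (_ + _); congr F; apply/val_inj.
have step (j : 'I_5) : F j + F (ordS j) + F (ordS (ordS j)) + F (ordS (ordS (ordS j))) +
    F (ordS (ordS (ordS (ordS j)))) = F (ordS j) + F (ordS (ordS j)) +
    F (ordS (ordS (ordS j))) + F (ordS (ordS (ordS (ordS j)))) +
    F (ordS (ordS (ordS (ordS (ordS j))))).
  have -> : ordS (ordS (ordS (ordS (ordS j)))) = j.
    by apply/val_inj; case: j => [[|[|[|[|[|]]]]]].
  by rewrite [RHS]addrC !addrA.
have [n ->] : exists n, i = iter n (@ordS 5) ord0.
  by exists i; apply/val_inj; case: i => [[|[|[|[|[|]]]]]].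
by elim: n => [//|n IH]; rewrite IH step.
Qed.

End SumFive.

(** * Interior angles and turns *)

Section Angles.
Context {R : realType} (P : pentagon R) (eps : R).
Hypothesis eps1 : eps = 1 \/ eps = -1.
Hypothesis ori : forall j, oriented P j eps.
Notation v := (vertex P).
Notation K := (region P).
Implicit Types (i : 'I_5).

(** Indexed by the edge that arrives: [turn i], like [side_next i] and [side_prev i], belongs to the
    vertex [ordS i]. Together with [eps] its sign tells convex from reflex. *)
Definition turn i : R := cr (edgev P i) (edgev P (ordS i)).

Definition side_next i : plane R := udir (v (ordS i)) (v (ordS (ordS i))).
Definition side_prev i : plane R := udir (v (ordS i)) (v i).

Lemma elen_gt0 i : 0 < edist (v i) (v (ordS i)).
Proof. by apply: edist_gt0; rewrite eq_sym -subr_eq0; exact: edgev_neq0. Qed.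

Lemma side_nextE i :
  side_next i = (edist (v (ordS i)) (v (ordS (ordS i))))^-1 *: edgev P (ordS i).
Proof. by []. Qed.

Lemma side_prevE i : side_prev i = (edist (v i) (v (ordS i)))^-1 *: - edgev P i.
Proof. by rewrite /side_prev /udir edistC /edgev opprB. Qed.

Lemma udir_unit (p q : plane R) : p != q -> dotp (udir p q) (udir p q) = 1.
Proof.
move=> pq; have l0 := edist_gt0 pq.
have : edist p q ^+ 2 = dotp (q - p) (q - p) by rewrite edistC sqr_enorm.
rewrite /udir /dotp !coordE => h.
transitivity ((edist p q)^-1 ^+ 2 * edist p q ^+ 2); first by rewrite h; ring.
by rewrite -exprMn mulVf ?expr1n // gt_eqF.
Qed.

Lemma vertex_neq i : v i != v (ordS i).
Proof. by rewrite eq_sym -subr_eq0; exact: edgev_neq0. Qed.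

Lemma turn_sides i : exists2 k, 0 < k & cr (side_next i) (side_prev i) = k * turn i.
Proof.
exists ((edist (v (ordS i)) (v (ordS (ordS i))))^-1 * (edist (v i) (v (ordS i)))^-1).
  by rewrite mulr_gt0 // invr_gt0 elen_gt0.
by rewrite side_nextE side_prevE /turn /cr !coordE; ring.
Qed.

Lemma sides_lagrange i :
  dotp (side_next i) (side_prev i) ^+ 2 + cr (side_next i) (side_prev i) ^+ 2 = 1.
Proof.
rewrite lagrange !udir_unit ?mulr1 //; first by rewrite eq_sym vertex_neq.
exact: vertex_neq.
Qed.

Lemma sides_dot_bound i : -1 <= dotp (side_next i) (side_prev i) <= 1.
Proof.
have := sides_lagrange i; set x := dotp _ _; set y := cr _ _ => h.
have : x ^+ 2 <= 1 by rewrite -h lerDl sqr_ge0.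
move=> x2; rewrite -ler_norml.
by rewrite -(@ler_pXn2r _ 2) ?nnegrE // real_normK ?num_real // expr1n.
Qed.

Lemma sides_dot_strict i : turn i != 0 -> -1 < dotp (side_next i) (side_prev i) < 1.
Proof.
move=> t0; have [k k0 crE] := turn_sides i.
have := sides_lagrange i; set x := dotp _ _; rewrite crE => h.
have y0 : 0 < (k * turn i) ^+ 2.
  by rewrite lt_neqAle sqr_ge0 eq_sym sqrf_eq0 mulf_neq0 // gt_eqF.
have : x ^+ 2 < 1 by rewrite -h ltrDl.
move=> x2; rewrite -ltr_norml.
by rewrite -(@ltr_pXn2r _ 2) ?nnegrE // real_normK ?num_real // expr1n.
Qed.

Lemma interior_angleE i : interior_angle P (ordS i) =
  if `[< \forall s \near 0^'+, K (v (ordS i) + s *: (side_next i + side_prev i)) >]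
  then acos (dotp (side_next i) (side_prev i))
  else 2 * pi - acos (dotp (side_next i) (side_prev i)).
Proof. by rewrite /interior_angle ordSK. Qed.

(** The bisecting ray runs in the sector of angle less than [pi], so [sector_side] decides whether
    it starts inside. *)
Lemma bisector_inside i : turn i != 0 ->
  `[< \forall s \near 0^'+, K (v (ordS i) + s *: (side_next i + side_prev i)) >] =
  (0 < eps * turn i).
Proof.
move=> t0; have [rho rho0 hrho] := sector_side (ori i).
set b := side_next i + side_prev i.
have [s0 s00 hs0] := box_small (v (ordS i)) b rho0.
have l0 := elen_gt0 i; have l1 := elen_gt0 (ordS i).
have t2 : 0 < turn i ^+ 2 by rewrite lt_neqAle sqr_ge0 eq_sym sqrf_eq0 t0.
have H s : 0 < s -> s < s0 -> (K (v (ordS i) + s *: b) <-> 0 < eps * turn i).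
  move=> sgt0 ss0; apply: hrho; first exact: hs0.
    have -> : cr (edgev P i) (v (ordS i) + s *: b - v (ordS i)) *
        cr (edgev P i) (edgev P (ordS i)) =
        s / edist (v (ordS i)) (v (ordS (ordS i))) * turn i ^+ 2.
      by rewrite /b side_nextE side_prevE /turn /cr !coordE; ring.
    by rewrite mulr_gt0 // divr_gt0.
  have -> : cr (edgev P (ordS i)) (v (ordS i) + s *: b - v (ordS i)) *
      cr (edgev P i) (edgev P (ordS i)) = s / edist (v i) (v (ordS i)) * turn i ^+ 2.
    by rewrite /b side_nextE side_prevE /turn /cr !coordE; ring.
  by rewrite mulr_gt0 // divr_gt0.
apply/asboolP/idP => [h|h].
  have [s [Ks [sgt0 ss0]]] :=
    filter_ex (filterI h (filterI (nbhs_right_gt (0 : R)) (nbhs_right_lt s00))).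
  by apply/(H s).
near=> s.
have sgt0 : 0 < s by near: s; exact: nbhs_right_gt.
have ss0 : s < s0 by near: s; exact: nbhs_right_lt.
by apply/(H s sgt0 ss0).
Unshelve. all: end_near. Qed.

(** The unit directions have scalar product 1 or -1, and [straight_dot] excludes 1. *)
Lemma flat_angle i : turn i = 0 -> interior_angle P (ordS i) = pi.
Proof.
move=> t0; rewrite interior_angleE.
have dE : dotp (side_next i) (side_prev i) = -1.
  have [k k0 crE] := turn_sides i.
  have := sides_lagrange i; rewrite crE t0 mulr0 expr0n addr0 => /eqP.
  rewrite sqrf_eq1 => /orP[/eqP d1|/eqP //].
  have : dotp (side_next i) (side_prev i) < 0; last by rewrite d1 ltr10.
  have -> : dotp (side_next i) (side_prev i) =
      - ((edist (v (ordS i)) (v (ordS (ordS i))))^-1 * (edist (v i) (v (ordS i)))^-1 *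
      dotp (edgev P i) (edgev P (ordS i))).
    by rewrite side_nextE side_prevE /dotp !coordE; ring.
  by rewrite oppr_lt0 mulr_gt0 ?straight_dot // mulr_gt0 // invr_gt0 elen_gt0.
by rewrite dE acosN1; case: ifP => // _; ring.
Qed.

Lemma convex_angle i : 0 < eps * turn i ->
  interior_angle P (ordS i) = acos (dotp (side_next i) (side_prev i)) /\
  interior_angle P (ordS i) < pi.
Proof.
move=> t0; have tn : turn i != 0 by apply/eqP => e; rewrite e mulr0 ltxx in t0.
rewrite interior_angleE bisector_inside // t0; split => //.
have /andP[d1 d2] := sides_dot_strict tn.
by rewrite acos_ltpi // d1 ltW.
Qed.

Lemma reflex_angle i : eps * turn i < 0 -> pi < interior_angle P (ordS i).
Proof.
move=> t0; have tn : turn i != 0 by apply/eqP => e; rewrite e mulr0 ltxx in t0.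
rewrite interior_angleE bisector_inside // (_ : (0 < _) = false); last first.
  by apply/negbTE; rewrite -leNgt ltW.
have /andP[d1 d2] := sides_dot_strict tn.
have : acos (dotp (side_next i) (side_prev i)) < pi by rewrite acos_ltpi // d1 ltW.
lra.
Qed.

Lemma reflexP i : (pi < interior_angle P (ordS i)) = (eps * turn i < 0).
Proof.
have [t0|t0|t0] := ltgtP (eps * turn i) 0; first by rewrite reflex_angle.
  by have [_ h] := convex_angle t0; rewrite ltNge ltW.
suff h : turn i = 0 by rewrite flat_angle // ltxx.
by case: eps1 t0 => ->; rewrite ?mul1r // mulN1r => /eqP; rewrite oppr_eq0 => /eqP.
Qed.

Lemma ordS_surj (k : 'I_5) : exists i, k = ordS i.
Proof. by exists (ord_pred k); rewrite ord_predK. Qed.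

End Angles.

Lemma ordS5 (i : 'I_5) : ordS (ordS (ordS (ordS (ordS i)))) = i.
Proof. by apply/val_inj; case: i => [[|[|[|[|[|]]]]]]. Qed.

Lemma ordS2_neq (i : 'I_5) : i != ordS (ordS i).
Proof. by case: i => [[|[|[|[|[|]]]]]]. Qed.

Lemma ordS3_neq (i : 'I_5) : i != ordS (ordS (ordS i)).
Proof. by case: i => [[|[|[|[|[|]]]]]]. Qed.

Section Perimeters.
Context {R : realType} (P : pentagon R) (eps : R).
Hypothesis eps1 : eps = 1 \/ eps = -1.
Hypothesis ori : forall j, oriented P j eps.
Hypothesis area1 : unit_area P.
Notation v := (vertex P).

Lemma shoelace_unit : eps * \sum_i cr (v i) (v (ordS i)) = 2.
Proof.
have := green eps1 ori; rewrite area1 => -[h]; lra.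
Qed.

Lemma pentagon_perimeter : 20 * tan (pi / 5%:R) <= perimeter P ^+ 2.
Proof.
have p0 := pi_gt0 R.
have t0 : 0 < tan (pi / 5%:R : R).
  rewrite /tan divr_gt0 //; first by apply: sin_gt0_pi; lra.
  by apply: cos_gt0_pihalf; lra.
pose w k := v (iter k (@ordS 5) ord0).
have := @isoperimetric_signed _ eps 5 w eps1 isT.
have w5 : w 5%N = w 0%N by rewrite /w; congr v; apply/val_inj.
have wn j : (j < 5)%N -> w j.+1 != w j by move=> _; rewrite /w /= eq_sym vertex_neq.
move=> /(_ w5 wn).
have E (F : plane R -> plane R -> R) : \sum_(k < 5) F (w k) (w k.+1) =
    \sum_i F (v i) (v (ordS i)).
  by rewrite [RHS](sum_ordS _ ord0) !big_ord_recl big_ord0 addr0 !addrA.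
have t5 : 0 < 5%:R * tan (pi / 5%:R : R) by apply: mulr_gt0.
rewrite !E shoelace_unit ler_pdivlMr // /perimeter => h; apply: le_trans h; lra.
Qed.

(** The triangle at the dropped vertex [ordS i] has negative signed area, so the other four vertices
    span signed area at least 1; 16 is the squared perimeter of the unit square. *)
Lemma reflex_perimeter i : eps * turn P i < 0 -> 16 <= perimeter P ^+ 2.
Proof.
move=> ti; have := shoelace_unit; rewrite /perimeter !(sum_ordS _ i).
have S5 := ordS5 i; rewrite S5.
have vinj := @vertex_inj _ P.
set i1 := ordS i; set i2 := ordS i1; set i3 := ordS i2; set i4 := ordS i3.
have n02 : v i != v i2.
  by rewrite (inj_eq vinj) ordS2_neq.
have n23 : v i2 != v i3 by exact: vertex_neq.
have n34 : v i3 != v i4 by exact: vertex_neq.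
have n40 : v i4 != v i by rewrite -[X in _ != v X]S5; exact: vertex_neq.
have := quad_isoperimetric eps1 n02 n23 n34 n40.
have := edist_triangle (v i1) (v i) (v i2).
move: ti; rewrite /turn /edgev -/i1 -/i2.
have e0 : 0 <= edist (v i) (v i2) by exact: enorm_ge0.
have e1 : 0 <= edist (v i) (v i1) by exact: enorm_ge0.
have e2 : 0 <= edist (v i1) (v i2) by exact: enorm_ge0.
have e3 : 0 <= edist (v i2) (v i3) by exact: enorm_ge0.
have e4 : 0 <= edist (v i3) (v i4) by exact: enorm_ge0.
have e5 : 0 <= edist (v i4) (v i) by exact: enorm_ge0.
move=> ti tri quad area.
have h1 : 2 <= eps * (cr (v i) (v i2) + cr (v i2) (v i3) + cr (v i3) (v i4) + cr (v i4) (v i)).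
  move: ti area; rewrite /cr !coordE; lra.
have h2 : edist (v i) (v i2) + edist (v i2) (v i3) + edist (v i3) (v i4) + edist (v i4) (v i) <=
  edist (v i) (v i1) + edist (v i1) (v i2) + edist (v i2) (v i3) + edist (v i3) (v i4) + edist (v i4) (v i).
  lra.
have : (edist (v i) (v i2) + edist (v i2) (v i3) + edist (v i3) (v i4) + edist (v i4) (v i)) ^+ 2 <=
  (edist (v i) (v i1) + edist (v i1) (v i2) + edist (v i2) (v i3) + edist (v i3) (v i4) + edist (v i4) (v i)) ^+ 2.
  by rewrite ler_pXn2r ?nnegrE //; rewrite !addr_ge0.
move: quad h1; lra.
Qed.

End Perimeters.

Section TwoReflex.
Context {R : realType} (P : pentagon R) (eps : R).
Hypothesis eps1 : eps = 1 \/ eps = -1.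
Hypothesis ori : forall j, oriented P j eps.
Hypothesis area1 : unit_area P.
Notation v := (vertex P).
Implicit Types (p q r s : plane R).

Lemma triangle_perimeter p q r : p != q -> q != r -> r != p ->
  2 <= eps * (cr p q + cr q r + cr r p) ->
  edist p q + edist q r + edist r p <= perimeter P ->
  12 * Num.sqrt 3 <= perimeter P ^+ 2.
Proof.
move=> pq qr rp h hl; have := triangle_isoperimetric eps1 pq qr rp.
have q0 : 0 < Num.sqrt 3 :> R by rewrite sqrtr_gt0.
have l0 : 0 <= edist p q + edist q r + edist r p.
  by rewrite !addr_ge0 //; exact: enorm_ge0.
have q3 : 0 < 3 * Num.sqrt 3 :> R by rewrite mulr_gt0.
rewrite ler_pdivlMr // => h1.
have : (edist p q + edist q r + edist r p) ^+ 2 <= perimeter P ^+ 2.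
  by rewrite ler_pXn2r ?nnegrE // (le_trans l0).
apply: le_trans; apply: le_trans h1; nra.
Qed.

Lemma edges_disjoint i z : edge v i z -> edge v (ordS (ordS i)) z -> False.
Proof.
move=> h1 h2; have [_ _ disj] := vertex_simple P.
have : (edge v i `&` edge v (ordS (ordS i))) z by [].
rewrite disj //.
- by rewrite eq_sym ordS2_neq.
- by rewrite ordS5_neq.
- exact: ordS3_neq.
Qed.

(** The reflex vertices are the first and the third after [i]; not being adjacent, they can be cut
    off independently. *)
Lemma two_reflex_opposite i : eps * turn P i < 0 -> eps * turn P (ordS (ordS i)) < 0 ->
  12 * Num.sqrt 3 <= perimeter P ^+ 2.
Proof.
move=> t1 t3; have S5 := ordS5 i; have vinj := @vertex_inj _ P.
have := shoelace_unit eps1 ori area1; rewrite (sum_ordS _ i) => area.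
apply: (@triangle_perimeter (v i) (v (ordS (ordS i))) (v (ordS (ordS (ordS (ordS i)))))).
- by rewrite (inj_eq vinj) ordS2_neq.
- by rewrite (inj_eq vinj) ordS2_neq.
- by rewrite -[X in _ != v X]S5 vertex_neq.
- by move: t1 t3 area; rewrite S5 /turn /edgev /cr !coordE; lra.
have := edist_triangle (v (ordS i)) (v i) (v (ordS (ordS i))).
have := edist_triangle (v (ordS (ordS (ordS i)))) (v (ordS (ordS i)))
  (v (ordS (ordS (ordS (ordS i))))).
rewrite /perimeter (sum_ordS _ i) S5; lra.
Qed.

(* The chain [i, i+1, i+2, i+3] turns twice to the outside; unless its first and
   last edges cross, the quadrilateral it spans has nonpositive area. *)
Lemma two_reflex_adjacent i : eps * turn P i < 0 -> eps * turn P (ordS i) < 0 ->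
  12 * Num.sqrt 3 <= perimeter P ^+ 2.
Proof.
move=> t1 t2; have S5 := ordS5 i; have vinj := @vertex_inj _ P.
have := shoelace_unit eps1 ori area1; rewrite (sum_ordS _ i) S5 => area.
set a := v i in area *; set b := v (ordS i) in area *.
set c := v (ordS (ordS i)) in area *; set d := v (ordS (ordS (ordS i))) in area *.
set e := v (ordS (ordS (ordS (ordS i)))) in area *.
have h1 : eps * cr (b - a) (c - b) < 0 by [].
have h2 : eps * cr (c - b) (d - c) < 0 by [].
(* Split along a diagonal, the quadrilateral consists of two triangles, one of them negative by a
   reflex turn. If for neither diagonal the other triangle is nonpositive, the edges ab and cd
   cross. *)
have Q : eps * (cr a b + cr b c + cr c d + cr d a) <= 0.
  have [h3|h3] := leP (eps * cr (c - a) (d - c)) 0.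
    by move: h1 h3; clear -a b c d; rewrite /cr !coordE; lra.
  have [h4|h4] := leP (eps * cr (b - a) (d - b)) 0.
    by move: h2 h4; clear -a b c d; rewrite /cr !coordE; lra.
  exfalso.
  have sc1 : cr (d - c) (a - c) = cr (c - a) (d - c) by rewrite /cr !coordE; ring.
  have sc2 : cr (d - c) (b - c) = cr (c - b) (d - c) by rewrite /cr !coordE; ring.
  have sc3 : cr (b - a) (c - a) = cr (b - a) (c - b) by rewrite /cr !coordE; ring.
  have sc4 : cr (b - a) (d - a) = cr (b - a) (d - b) by rewrite /cr !coordE; ring.
  have prod (x y : R) : 0 < eps * x -> eps * y < 0 -> x * y <= 0.
    by case: eps1 => ->; rewrite ?mul1r ?mulN1r => *; nra.
  have nz (x : R) : eps * x != 0 -> x != 0.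
    by move=> h; apply/eqP => x0; rewrite x0 mulr0 eqxx in h.
  have [|||| z [z1 z2]] := @segment_cross _ a b c d.
  - by rewrite sc1 nz // gt_eqF.
  - by rewrite sc1 sc2 prod.
  - by rewrite sc3 nz // lt_eqF.
  - by rewrite sc3 sc4 mulrC prod.
  exact: (edges_disjoint z1 z2).
apply: (@triangle_perimeter a d e).
- by rewrite (inj_eq vinj) ordS3_neq.
- exact: vertex_neq.
- by rewrite /a -[X in _ != v X]S5 vertex_neq.
- by move: Q area; clear -a b c d e; rewrite /cr; lra.
have := edist_triangle b a d; have := edist_triangle c b d.
rewrite /perimeter (sum_ordS _ i) S5 -/a -/b -/c -/d -/e; lra.
Qed.

Lemma two_reflex_perimeter i j : i != j -> eps * turn P i < 0 -> eps * turn P j < 0 ->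
  12 * Num.sqrt 3 <= perimeter P ^+ 2.
Proof.
have cases : i != j -> [\/ j = ordS i, j = ordS (ordS i) | i = ordS j] \/ i = ordS (ordS j).
  case: i => [[|[|[|[|[|]]]]]] // hi; case: j => [[|[|[|[|[|]]]]]] // hj;
    rewrite -val_eqE //= => _;
    first [by left; apply: Or31; apply/val_inj|by left; apply: Or32; apply/val_inj
          |by left; apply: Or33; apply/val_inj|by right; apply/val_inj].
move=> /cases[[]|] -> t1 t2.
- exact: two_reflex_adjacent t1 t2.
- exact: two_reflex_opposite t1 t2.
- exact: two_reflex_adjacent t2 t1.
- exact: two_reflex_opposite t2 t1.
Qed.

End TwoReflex.

(** * A pentagon without reflex vertices is convex *)
Section CrossingPatterns.
Context {R : realType}.
Implicit Types (x y t c : R).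

(** When both entries precede both exits, the count first rises and then falls, so it cannot return
    to 1 after having dropped from 1 to 0. *)
Lemma four_cross x1 x2 y1 y2 t0 t1 t2 :
  x1 <= y1 -> x1 <= y2 -> x2 <= y1 -> x2 <= y2 -> t0 < t1 -> t1 < t2 ->
  (x1 < t0)%R%:R + (x2 < t0)%R%:R - (y1 < t0)%R%:R - (y2 < t0)%R%:R = 1 :> R ->
  (x1 < t1)%R%:R + (x2 < t1)%R%:R - (y1 < t1)%R%:R - (y2 < t1)%R%:R = 0 :> R ->
  (x1 < t2)%R%:R + (x2 < t2)%R%:R - (y1 < t2)%R%:R - (y2 < t2)%R%:R = 1 :> R -> False.
Proof.
move=> h1 h2 h3 h4 t01 t12.
have tr x : x < t1 -> (x < t2) = true by move=> h; apply: lt_trans t12.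
have [a1|a1] := ltP y1 t1; have [a2|a2] := ltP y2 t1.
- by move=> _ _; rewrite !tr //=; lra.
- have b1 : x1 < t1 by lra.
  have b2 : x2 < t1 by lra.
  by move=> _; rewrite b1 b2 /=; lra.
- have b1 : x1 < t1 by lra.
  have b2 : x2 < t1 by lra.
  by move=> _; rewrite b1 b2 /=; lra.
have [b1|b1] := ltP x1 t1; have [b2|b2] := ltP x2 t1 => /=; try lra.
have [c1|c1] := ltP x1 t0; first by lra.
have [c2|c2] := ltP x2 t0; first by lra.
by have [c3|c3] := ltP y1 t0; have [c4|c4] := ltP y2 t0 => /=; lra.
Qed.

Lemma two_cross (eps : R) x y t0 t1 t2 : eps = 1 \/ eps = -1 -> t0 < t1 -> t1 < t2 ->
  eps * ((x < t0)%R%:R - (y < t0)%R%:R) = 1 ->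
  eps * ((x < t1)%R%:R - (y < t1)%R%:R) = 0 ->
  eps * ((x < t2)%R%:R - (y < t2)%R%:R) = 1 -> False.
Proof.
move=> e1 t01 t12.
have [a1|a1] := ltP x t1; have [a2|a2] := ltP y t1 => /=.
- by move=> _ _; rewrite (lt_trans a1 t12) (lt_trans a2 t12) /= subrr mulr0; lra.
- by move=> _; case: e1 => ->; lra.
- by move=> _; case: e1 => ->; lra.
have -> : (x < t0) = false by apply/negbTE; rewrite -leNgt; lra.
have -> : (y < t0) = false by apply/negbTE; rewrite -leNgt; lra.
by rewrite subrr mulr0; lra.
Qed.

Lemma mul_le0_le c x y : 0 < c -> c * (x - y) <= 0 -> x <= y.
Proof. by move=> c0; rewrite pmulr_rle0 // subr_le0. Qed.

Lemma mul_le0_ge c x y : c < 0 -> c * (x - y) <= 0 -> y <= x.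
Proof. by move=> c0; rewrite nmulr_rle0 // subr_ge0. Qed.

End CrossingPatterns.

Section Convexity.
Context {R : realType} (P : pentagon R) (eps : R).
Hypothesis eps1 : eps = 1 \/ eps = -1.
Hypothesis ori : forall j, oriented P j eps.
Hypothesis no_reflex : forall i, 0 <= eps * turn P i.
Notation v := (vertex P).
Notation K := (region P).

Lemma edge_convex i (x y z : plane R) : edge v i x -> edge v i y -> segment x y z -> edge v i z.
Proof.
move=> /edgeP[s /andP[s0 s1] ->] /edgeP[t /andP[t0 t1] ->] /segmentP[u /andP[u0 u1] ->].
apply/edgeP; exists ((1 - u) * s + u * t).
  by apply/andP; split; nra.
by apply: plane_eq; rewrite /edge_point !coordE; ring.
Qed.

Section Line.
Variables (p d : plane R).
Let h (i : 'I_5) : R := cr d (v i - p).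
Hypothesis hn : forall i, cr d (v i - p) != 0.
Notation sgn := (cross_sign P p d).
Notation pos := (cross_pos P p d).

(** The triangle cut off by the line at vertex [ordS i] has its signed area computed from the turn
    and again from base and height; the sign of the turn orders the two crossings. *)
Lemma turn_order i : sgn i != 0 -> sgn (ordS i) != 0 ->
  eps * h (ordS i) * (pos (ordS i) - pos i) <= 0.
Proof.
move=> s0 s1; have [/andP[t0 t1] A] := cross_point hn s0.
have [/andP[t0' t1'] B] := cross_point hn s1.
move: A B; set ti := cross_time _ _ _ _ in t0 t1 *; set ts := cross_time _ _ _ _ in t0' t1' *.
set x := pos i; set y := pos (ordS i) => A B.
have A' : (1 - ti) *: edgev P i = v (ordS i) - (p + x *: d).
  by rewrite -A; apply: plane_eq; rewrite /edge_point /edgev !coordE; ring.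
have B' : ts *: edgev P (ordS i) = p + y *: d - v (ordS i).
  by rewrite -B; apply: plane_eq; rewrite /edge_point /edgev !coordE; ring.
have E : (1 - ti) * ts * turn P i = - (y - x) * h (ordS i).
  transitivity (cr ((1 - ti) *: edgev P i) (ts *: edgev P (ordS i))).
    by rewrite /turn /cr !coordE; ring.
  by rewrite A' B' /h /cr !coordE; ring.
have -> : eps * h (ordS i) * (y - x) = - ((1 - ti) * ts * (eps * turn P i)).
  by transitivity (- eps * (- (y - x) * h (ordS i))); [ring|rewrite -E; ring].
have q0 : 0 < 1 - ti by rewrite subr_gt0.
by rewrite oppr_le0; apply: mulr_ge0; [apply: mulr_ge0; exact: ltW|exact: no_reflex].
Qed.

(* The two edges adjacent to the non-crossing edge [j] would meet. *)
Lemma adjacent_pair_order j : let k := ordS (ordS (ordS (ordS j))) in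
  sgn k != 0 -> sgn (ordS j) != 0 ->
  0 < h j * h (ordS j) -> h (ordS j) * h (ordS (ordS j)) < 0 ->
  eps * h (ordS (ordS j)) * (pos k - pos (ordS j)) <= 0.
Proof.
move=> k s0 s1 hj hS; rewrite leNgt; apply/negP => gt0.
have Sk : ordS k = j by exact: ordS5.
have [/andP[t0 t1] A] := cross_point hn s0.
have [/andP[t0' t1'] B] := cross_point hn s1.
move: A B; set tk := cross_time _ _ _ _ in t0 t1 *; set ts := cross_time _ _ _ _ in t0' t1' *.
move: gt0; set x := pos k; set y := pos (ordS j) => gt0 A B.
have A' : (1 - tk) *: edgev P k = v j - (p + x *: d).
  by rewrite -A -Sk; apply: plane_eq; rewrite /edge_point /edgev !coordE; ring.
have B' : - ts *: edgev P (ordS j) = v (ordS j) - (p + y *: d).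
  by rewrite -B; apply: plane_eq; rewrite /edge_point /edgev !coordE; ring.
have al : cr (v j - (p + x *: d)) (p + y *: d - (p + x *: d)) = (x - y) * h j.
  by rewrite /h /cr !coordE; ring.
have be : cr (v j - (p + x *: d)) (v (ordS j) - (p + x *: d)) = (1 - tk) * turn P k.
  transitivity (cr ((1 - tk) *: edgev P k) (edgev P j)).
    by rewrite A' /edgev /cr !coordE; ring.
  by rewrite /turn Sk /cr !coordE; ring.
have ga : cr (v (ordS j) - (p + y *: d)) (p + x *: d - (p + y *: d)) = - (x - y) * h (ordS j).
  by rewrite /h /cr !coordE; ring.
have de : cr (v (ordS j) - (p + y *: d)) (v j - (p + y *: d)) = - ts * turn P j.
  transitivity (cr (- ts *: edgev P (ordS j)) (- edgev P j)).
    by rewrite B' /edgev /cr !coordE; ring.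
  by rewrite /turn /cr !coordE; ring.
have xy : x - y != 0 by apply/eqP => e; rewrite e mulr0 ltxx in gt0.
have tk0 : 0 <= (1 - tk) * (eps * turn P k) by apply: mulr_ge0; [rewrite subr_ge0 ltW|exact: no_reflex].
have ts0 : 0 <= ts * (eps * turn P j) by apply: mulr_ge0; [exact: ltW|exact: no_reflex].
have s1' : eps * (x - y) * h j < 0.
  have : 0 < h (ordS (ordS j)) * h (ordS (ordS j)).
    by rewrite -expr2 lt_neqAle sqr_ge0 eq_sym sqrf_eq0 hn.
  by have := hn j; have := hn (ordS j); have := hn (ordS (ordS j));
    rewrite -/(h _) -/(h (ordS _)) -/(h (ordS (ordS _)));
    move: (h j) (h (ordS j)) (h (ordS (ordS j))) hj hS gt0;
    move=> a b c ab bc g c0 b0 a0 c2; case: (ltgtP b 0) b0 => // b0 _; nra.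
have s2' : eps * (x - y) * h (ordS j) < 0.
  by move: (h j) (h (ordS j)) hj s1' => a b ab; case: (ltgtP a 0) ab => [a0|a0|->]; nra.
(* The reversed order and the nonnegative turns put the ends of each segment on opposite sides of
   the other. *)
have [|||| z [z1 z2]] := @segment_cross _ (p + y *: d) (v (ordS j)) (p + x *: d) (v j).
- by rewrite al mulf_neq0 ?hn.
- by rewrite al be; move: s1' tk0; case: eps1 => -> ; rewrite ?mul1r ?mulN1r; nra.
- by rewrite ga mulf_neq0 ?oppr_eq0 ?hn.
- by rewrite ga de; move: s2' ts0; case: eps1 => -> ; rewrite ?mul1r ?mulN1r; nra.
apply: (@edges_disjoint _ P k z).
  apply: edge_convex z2; first by rewrite -A; apply/edgeP; exists tk => //; rewrite !ltW.
  by rewrite -Sk; apply/edgeP; exists 1; rewrite ?ler01 ?lexx // /edge_point conv1.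
rewrite Sk; apply: edge_convex z1; first by rewrite -B; apply/edgeP; exists ts => //; rewrite !ltW.
by apply/edgeP; exists 0; rewrite ?ler01 ?lexx // /edge_point conv0.
Qed.

(** A line through no vertex crosses 0, 2 or 4 edges. Only four crossings could give the pattern in,
    out, in, and then the order lemmas put every entry before every exit. *)
Lemma slice_convex (t0 t1 t2 : R) : t0 < t1 -> t1 < t2 ->
  eps * crossings P p d t0 = 1 -> eps * crossings P p d t1 = 0 ->
  eps * crossings P p d t2 = 1 -> False.
Proof.
move=> t01 t12.
(* The number of vertices is odd, so the sides of the line cannot alternate all the way around: some
   edge does not cross. *)
have [j hj] : exists j, 0 < h j * h (ordS j).
  apply: contrapT => /forallNP nj.
  have alt i : (0 < h (ordS i)) = ~~ (0 < h i).
    have := nj i; have := hn i; have := hn (ordS i); rewrite -/(h _) -/(h (ordS _)).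
    have [x|x|//] := ltgtP (h i) 0; have [y|y|//] := ltgtP (h (ordS i)) 0 => //= _ _.
      by case; nra.
    by case; nra.
  have := alt (ordS (ordS (ordS (ordS ord0)))).
  by rewrite ordS5 !alt; case: (0 < h ord0).
set j1 := ordS j; set j2 := ordS j1; set j3 := ordS j2; set j4 := ordS j3.
have S5 : ordS j4 = j by exact: ordS5.
rewrite /crossings !(sum_ordS _ j) -/j1 -/j2 -/j3 -/j4.
have sE i : sgn i = (0 < h i)%R%:R - (0 < h (ordS i))%R%:R by [].
have o4 := @turn_order j1; have o0 := @turn_order j2; have o1 := @turn_order j3.
have oc := @adjacent_pair_order j.
move: o4 o0 o1 oc; rewrite /= -/j1 -/j2 -/j3 -/j4.
have hn' i : h i != 0 by exact: hn.
rewrite !sE S5 -/j1 -/j2 -/j3 -/j4.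
have := hn' j4; have := hn' j3; have := hn' j2; have := hn' j1; have := hn' j.
move: (pos j) (pos j1) (pos j2) (pos j3) (pos j4) hj => x x1 x2 x3 x4.
rewrite -/j1; move: (h j) (h j1) (h j2) (h j3) (h j4) => y y1 y2 y3 y4 yy.
have one : (1 : R) != 0 := oner_neq0 _.
have mone : (-1 : R) != 0 by rewrite oppr_eq0.
have [[a a1]|[a a1]] : (0 < y /\ 0 < y1) \/ (y < 0 /\ y1 < 0).
  move: yy; have [a|a|->] := ltgtP y 0; last by rewrite mul0r ltxx.
    by rewrite nmulr_rgt0 //; right.
  by rewrite pmulr_rgt0 //; left.
all: rewrite ?a ?a1 ?(lt_gtF a) ?(lt_gtF a1) {yy} => _ _.
all: have [a2|a2|//] := ltgtP y2 0; have [a3|a3|//] := ltgtP y3 0;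
  have [a4|a4|//] := ltgtP y4 0 => _ _ _.
all: rewrite /= ?subrr ?subr0 ?sub0r ?eqxx.
all: try by (move=> _ _ _ _ F0 F1 F2; clear - F0; lra).
all: try by (move=> _ _ _ _ F0 F1 F2; clear -eps1 t01 t12 F0 F1 F2; first
  [ by apply: (@two_cross _ eps x1 x2 t0 t1 t2) => //; lra
  | by apply: (@two_cross _ eps x1 x3 t0 t1 t2) => //; lra
  | by apply: (@two_cross _ eps x1 x4 t0 t1 t2) => //; lra
  | by apply: (@two_cross _ eps x2 x1 t0 t1 t2) => //; lra
  | by apply: (@two_cross _ eps x2 x3 t0 t1 t2) => //; lra
  | by apply: (@two_cross _ eps x2 x4 t0 t1 t2) => //; lra
  | by apply: (@two_cross _ eps x3 x1 t0 t1 t2) => //; lra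
  | by apply: (@two_cross _ eps x3 x2 t0 t1 t2) => //; lra
  | by apply: (@two_cross _ eps x3 x4 t0 t1 t2) => //; lra
  | by apply: (@two_cross _ eps x4 x1 t0 t1 t2) => //; lra
  | by apply: (@two_cross _ eps x4 x2 t0 t1 t2) => //; lra
  | by apply: (@two_cross _ eps x4 x3 t0 t1 t2) => //; lra ]).
(* Only the alternating patterns are left: all edges but [j] cross. The four comparisons relate each
   entry to each exit. *)
all: move=> /(_ ltac:(done) ltac:(done)) o4 /(_ ltac:(done) ltac:(done)) o0
  /(_ ltac:(done) ltac:(done)) o1 /(_ ltac:(done) ltac:(done)) oc F0 F1 F2.
- have {}oc : eps * y2 * (x4 - x1) <= 0 by apply: oc; nra.
  clear a a1; case: eps1 => e; rewrite e in o4 o0 o1 oc F0 F1 F2.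
    apply: (@four_cross _ x3 x1 x2 x4 t0 t1 t2) => //; try lra.
    + by first [apply: mul_le0_le o0|apply: mul_le0_ge o0]; lra.
    + by first [apply: mul_le0_le o1|apply: mul_le0_ge o1]; lra.
    + by first [apply: mul_le0_le o4|apply: mul_le0_ge o4]; lra.
    + by first [apply: mul_le0_le oc|apply: mul_le0_ge oc]; lra.
  apply: (@four_cross _ x2 x4 x3 x1 t0 t1 t2) => //; try lra.
  + by first [apply: mul_le0_le o0|apply: mul_le0_ge o0]; lra.
  + by first [apply: mul_le0_le o4|apply: mul_le0_ge o4]; lra.
  + by first [apply: mul_le0_le o1|apply: mul_le0_ge o1]; lra.
  + by first [apply: mul_le0_le oc|apply: mul_le0_ge oc]; lra.
- have {}oc : eps * y2 * (x4 - x1) <= 0 by apply: oc; nra.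
  clear a a1; case: eps1 => e; rewrite e in o4 o0 o1 oc F0 F1 F2.
    apply: (@four_cross _ x2 x4 x3 x1 t0 t1 t2) => //; try lra. 
    + by first [apply: mul_le0_le o0|apply: mul_le0_ge o0]; lra.
    + by first [apply: mul_le0_le o4|apply: mul_le0_ge o4]; lra.
    + by first [apply: mul_le0_le o1|apply: mul_le0_ge o1]; lra.
    + by first [apply: mul_le0_le oc|apply: mul_le0_ge oc]; lra.
  apply: (@four_cross _ x3 x1 x2 x4 t0 t1 t2) => //; try lra.
  + by first [apply: mul_le0_le o0|apply: mul_le0_ge o0]; lra.
  + by first [apply: mul_le0_le o1|apply: mul_le0_ge o1]; lra.
  + by first [apply: mul_le0_le o4|apply: mul_le0_ge o4]; lra.
  + by first [apply: mul_le0_le oc|apply: mul_le0_ge oc]; lra.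
Qed.

End Line.

End Convexity.

Section RegionConvex.
Context {R : realType} (P : pentagon R) (eps : R).
Hypothesis eps1 : eps = 1 \/ eps = -1.
Hypothesis ori : forall j, oriented P j eps.
Hypothesis no_reflex : forall i, 0 <= eps * turn P i.
Notation v := (vertex P).
Notation K := (region P).

Lemma sub_nbhs_near (x : plane R) (A : set (plane R)) (w : plane R) : nbhs x A ->
  \forall s \near 0^'+, A (x + s *: w).
Proof.
move=> /nbhs_box[r r0 hr]; have [s0 s00 hs0] := box_small x w r0.
near=> s; apply/hr/hs0; near: s; [exact: nbhs_right_gt|exact: nbhs_right_lt].
Unshelve. all: end_near. Qed.

(** A failure of convexity persists when the endpoints move slightly into the interior and the whole
    segment is shifted off the vertices; [slice] then yields the pattern 1, 0, 1 excluded by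
    [slice_convex]. *)
Theorem region_convex : convex_set (K : set (convex_lmodType (plane R))).
Proof.
move=> x y lam; rewrite !inE => Kx Ky; apply: contrapT => nKz.
pose u : R := 1 - lam%:num.
have u01 : 0 <= u <= 1.
  have l0 : 0 <= lam%:num by [].
  have l1 : lam%:num <= 1 by [].
  by apply/andP; rewrite /u; split; lra.
have {nKz} nKz : ~ K ((1 - u) *: x + u *: y).
  by rewrite /u subKr.
have : nbhs ((1 - u) *: x + u *: y) (~` K).
  by apply: open_nbhs_nbhs; split => //; apply: closed_openC; exact: region_closed.
move=> /nbhs_box[r r0 hr].
have dense q : K q -> exists2 q', K° q' & box q r q'.
  rewrite -{1}(region_regclosed P) => /(_ _ (box_nbhs q r0)) [q' [h1 h2]].
  by exists q'.
have [x' Kx' bx] := dense x Kx; have [y' Ky' by_] := dense y Ky.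
have nKz' : ~ K ((1 - u) *: x' + u *: y').
  apply: hr; case: bx => a1 a2 a3 a4; case: by_ => b1 b2 b3 b4.
  split; rewrite !coordE.
  - by have := conv_gt (c := - r) u01 (_ : - r < x'.1 - x.1) (_ : - r < y'.1 - y.1); lra.
  - by have := conv_lt (c := r) u01 (_ : x'.1 - x.1 < r) (_ : y'.1 - y.1 < r); lra.
  - by have := conv_gt (c := - r) u01 (_ : - r < x'.2 - x.2) (_ : - r < y'.2 - y.2); lra.
  - by have := conv_lt (c := r) u01 (_ : x'.2 - x.2 < r) (_ : y'.2 - y.2 < r); lra.
pose d := y' - x'.
have u0 : 0 < u.
  rewrite lt_neqAle eq_sym; case/andP: (u01) => -> _; rewrite andbT; apply/eqP => e.
  by apply: nKz'; rewrite e conv0; exact: interior_subset.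
have u1 : u < 1.
  rewrite lt_neqAle; case/andP: (u01) => _ ->; rewrite andbT; apply/eqP => e.
  by apply: nKz'; rewrite e conv1; exact: interior_subset.
have d0 : d != 0.
  rewrite subr_eq0; apply/eqP => e; apply: nKz'.
  rewrite e -scalerDl subrK scale1r; exact: interior_subset.
have dd := dotpp_gt0 d0.
pose n := perp d.
(* Shifting along the normal of [d], each vertex forbids at most one value of [s]. *)
have [s [Ks1 Ks2 Ks3 hs]] : exists s : R, [/\ K° (x' + s *: n), K° (y' + s *: n),
    (~` K) ((1 - u) *: x' + u *: y' + s *: n) & forall i, cr d (v i - (x' + s *: n)) != 0].
  have N1 := sub_nbhs_near n (open_nbhs_nbhs (conj (open_interior K) Kx')).
  have N2 := sub_nbhs_near n (open_nbhs_nbhs (conj (open_interior K) Ky')).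
  have N3 := sub_nbhs_near n (open_nbhs_nbhs (conj (closed_openC (@region_closed _ P)) nKz')).
  have N4 : \forall s \near 0^'+, forall i, cr d (v i - (x' + s *: n)) != 0.
    apply: (@filter_forall _ _ (fun i s => cr d (v i - (x' + s *: n)) != 0) (0^'+)) => i.
    pose si := cr d (v i - x') / dotp d d.
    have E s : cr d (v i - (x' + s *: n)) = (si - s) * dotp d d.
      rewrite mulrBl divfK ?gt_eqF // /n /perp /cr /dotp !coordE /=; ring.
    have [si0|si0] := ltP 0 si.
      near=> s; rewrite E mulf_neq0 ?gt_eqF // subr_gt0.
      by near: s; exact: nbhs_right_lt.
    near=> s; rewrite E mulf_neq0 ?(gt_eqF dd) // lt_eqF // subr_lt0.
    by apply: le_lt_trans si0 _; near: s; exact: nbhs_right_gt.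
  have [s [h1 [h2 [h3 h4]]]] := filter_ex (filterI N1 (filterI N2 (filterI N3 N4))).
  by exists s.
have L t : x' + s *: n + t *: d = (1 - t) *: x' + t *: y' + s *: n.
  by rewrite /d; apply: plane_eq; rewrite !coordE; ring.
have inner q : K° q -> ~ curve P q by move=> Kq /curve_interior.
apply: (slice_convex eps1 no_reflex hs (t0 := 0) (t1 := u) (t2 := 1)) => //.
- rewrite -slice //; last by rewrite L conv0; exact: inner.
  by rewrite L conv0 asboolT //; exact: interior_subset.
- rewrite -slice //; last by rewrite L => /curve_region.
  by rewrite L asboolF.
- rewrite -slice //; last by rewrite L conv1; exact: inner.
  by rewrite L conv1 asboolT //; exact: interior_subset.
Unshelve. all: end_near. Qed.

End RegionConvex.

Section PerimeterBounds.
Context {R : realType} (P : pentagon R).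
Hypothesis area1 : unit_area P.

Lemma non_convex_perimeter : non_convex P -> 16 <= perimeter P ^+ 2.
Proof.
have [eps e1 ori] := orientation_ex P => nc.
apply: contrapT => h; apply: nc; apply: (region_convex e1 ori) => i.
rewrite leNgt; apply/negP => /(reflex_perimeter e1 ori area1); exact: h.
Qed.

Lemma reflex_count_perimeter : (1 < reflex_count P)%N ->
  12 * Num.sqrt 3 <= perimeter P ^+ 2.
Proof.
have [eps e1 ori] := orientation_ex P.
move=> /card_gt1P[x [y [+ + xy]]]; rewrite !inE.
have [i xE] := ordS_surj x; have [j yE] := ordS_surj y.
rewrite xE yE !(reflexP e1 ori) in xy *; apply: two_reflex_perimeter => //.
by apply: contra xy => /eqP ->.
Qed.

Lemma unit_area_perimeter : 20 * tan (pi / 5%:R) <= perimeter P ^+ 2.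
Proof.
by have [eps e1 ori] := orientation_ex P; exact: pentagon_perimeter e1 ori area1.
Qed.

Lemma perimeter_gt0 : 0 < perimeter P.
Proof.
rewrite /perimeter (bigD1 ord0) //= ltr_wpDr ?elen_gt0 // sumr_ge0 // => i _.
exact: enorm_ge0.
Qed.

End PerimeterBounds.

(** * The perimeter of a prismatic pentagon *)
Section Circumscribed.
Context {R : realType} (P : pentagon R) (eps : R).
Hypothesis eps1 : eps = 1 \/ eps = -1.
Hypothesis ori : forall j, oriented P j eps.
Notation v := (vertex P).
Notation K := (region P).
Variables (c : plane R) (r : R).
Hypothesis r0 : 0 < r.
Hypothesis diskK : disk c r `<=` K.
Hypothesis touch : forall i, exists p, edge v i p /\ edist c p = r.
Hypothesis strict : forall i, 0 < eps * turn P i.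

Lemma enorm_le1 (p : plane R) : enorm p <= `|p.1| + `|p.2|.
Proof.
rewrite -(@ler_pXn2r _ 2) ?nnegrE ?addr_ge0 ?enorm_ge0 //.
rewrite sqr_enorm /dotp sqrrD !real_normK ?num_real // -!expr2.
by have : 0 <= `|p.1| * `|p.2| by []; rewrite -mulr_natl; lra.
Qed.

Lemma disk_interior q : edist c q < r -> K° q.
Proof.
move=> cq; have s0 : 0 < (r - edist c q) / 2 by rewrite divr_gt0 // subr_gt0.
apply: filterS (box_nbhs q s0) => p [h1 h2 h3 h4]; apply: diskK.
rewrite /disk /mkset; apply: le_trans (edist_triangle q c p) _.
rewrite -lerBrDl; apply: le_trans (enorm_le1 _) _; rewrite !coordE.
have : `|q.1 - p.1| < (r - edist c q) / 2 by rewrite ltr_norml; lra.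
have : `|q.2 - p.2| < (r - edist c q) / 2 by rewrite ltr_norml; lra.
lra.
Qed.

Lemma edge_far i q : edge v i q -> r ^+ 2 <= dotp (q - c) (q - c).
Proof.
move=> eq; rewrite -sqr_enorm -/(edist q c) edistC.
rewrite ler_pXn2r ?nnegrE ?enorm_ge0 ?(ltW r0) // leNgt; apply/negP.
by move=> /disk_interior; apply: curve_interior; exists i.
Qed.

(** The first-order condition at a minimum: lets [s] tend to 0 in the expansion of a squared
    distance along an edge. *)
Lemma slope_le (a b : R) : 0 <= b -> (forall s, 0 < s -> s <= 1 -> 2 * a <= s * b) -> a <= 0.
Proof.
move=> b0 h; rewrite leNgt; apply/negP => a0.
have b1 : 0 < 1 + a + b by lra.
have := h (a / (1 + a + b)); rewrite divr_gt0 // ler_pdivrMr // mul1r.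
have l : a <= 1 + a + b by lra.
move=> /(_ isT l); rewrite mulrAC ler_pdivlMr // => H; nra.
Qed.

(** If the circle passed through the vertex [w], then [w] would be the nearest point to [c] on both
    edges, while [c] is on the inner side of both. The identity [key] then makes the turn
    nonpositive. *)
Lemma vertex_not_touching i : edist c (v (ordS i)) != r.
Proof.
apply/eqP => cr_; pose w := v (ordS i); pose u := c - w.
pose e := edgev P i; pose e' := edgev P (ordS i).
have uu : dotp u u = r ^+ 2 by rewrite /u -cr_ -sqr_enorm.
have ue' : dotp u e' <= 0.
  apply: (@slope_le _ (dotp e' e')); first by rewrite ltW // dotpp_gt0 ?edgev_neq0.
  move=> s s0 s1.
  have : edge v (ordS i) (edge_point P (ordS i) s) by apply/edgeP; exists s => //; rewrite (ltW s0) s1.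
  move=> /edge_far.
  have -> : dotp (edge_point P (ordS i) s - c) (edge_point P (ordS i) s - c) =
    dotp u u - s * (2 * dotp u e' - s * dotp e' e').
    by rewrite /u /e' /w /dotp /edge_point /edgev !coordE; ring.
  rewrite uu; nra.
have ue : - dotp u e <= 0.
  apply: (@slope_le _ (dotp e e)); first by rewrite ltW // dotpp_gt0 ?edgev_neq0.
  move=> s s0 s1.
  have : edge v i (edge_point P i (1 - s)).
    by apply/edgeP; exists (1 - s) => //; apply/andP; split; lra.
  move=> /edge_far.
  have -> : dotp (edge_point P i (1 - s) - c) (edge_point P i (1 - s) - c) =
    dotp u u - s * (2 * - dotp u e - s * dotp e e).
    by rewrite /u /e /w /dotp /edge_point /edgev !coordE; ring.
  rewrite uu; nra.
have Ku s : 0 < s -> s < 1 -> K (w + s *: u).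
  move=> s0 s1; apply: diskK; rewrite /disk /mkset.
  have -> : edist c (w + s *: u) = (1 - s) * r.
    apply/eqP; rewrite -(@eqrXn2 _ 2) ?enorm_ge0 ?mulr_ge0 ?subr_ge0 ?ltW //.
    rewrite sqr_enorm exprMn -uu /u /dotp !coordE; apply/eqP; ring.
  by rewrite ger_pMl //; lra.
have crs f s : cr f (w + s *: u - w) = s * cr f u by rewrite /cr !coordE; ring.
have tn := strict i; have tn0 : turn P i != 0 by apply/eqP => e0; rewrite e0 mulr0 ltxx in tn.
have prod (x y : R) : 0 < eps * x -> eps * y < 0 -> y * x <= 0.
  by case: eps1 => ->; rewrite ?mul1r ?mulN1r => *; nra.
have ceu : 0 <= eps * cr e u.
  rewrite leNgt; apply/negP => neg.
  have [rho rho0 hrho] := prev_side (ori i).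
  have [s0 s00 hs0] := box_small w u rho0.
  have [s [sgt0 ss0 s1]] := small2 s00 ltr01.
  have := Ku s sgt0 s1; rewrite (hrho _ (hs0 _ sgt0 ss0)) crs.
  - by rewrite mulrCA pmulr_rgt0 // ltNge ltW.
  - by rewrite mulf_neq0 ?(gt_eqF sgt0) //; apply/eqP => h; rewrite h mulr0 ltxx in neg.
  - by rewrite -mulrA pmulr_rle0 //; exact: prod.
have ceu' : 0 <= eps * cr e' u.
  rewrite leNgt; apply/negP => neg.
  have [rho rho0 hrho] := next_side (ori (ordS i)).
  have [s0 s00 hs0] := box_small w u rho0.
  have [s [sgt0 ss0 s1]] := small2 s00 ltr01.
  have := Ku s sgt0 s1; rewrite (hrho _ (hs0 _ sgt0 ss0)) crs.
  - by rewrite mulrCA pmulr_rgt0 // ltNge ltW.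
  - by rewrite mulf_neq0 ?(gt_eqF sgt0) //; apply/eqP => h; rewrite h mulr0 ltxx in neg.
  - by rewrite -mulrA pmulr_rle0 //; exact: prod.
have key : eps * turn P i * dotp u u =
    (eps * cr e' u) * - dotp u e + (eps * cr e u) * dotp u e'.
  by rewrite /turn -/e -/e' /cr /dotp; ring.
have : 0 < eps * turn P i * dotp u u by rewrite uu mulr_gt0 // exprn_gt0.
rewrite key ltNge; case/negP.
have h1 := mulr_ge0_le0 ceu' ue; have h2 := mulr_ge0_le0 ceu ue'; lra.
Qed.

(** The point of contact is an inner point of the edge and minimizes the distance to the centre, so
    the radius is perpendicular there; the disk lying in the region gives the sign. *)
Lemma tangency i : exists t, [/\ 0 < t < 1,
  dotp (edgev P i) (c - edge_point P i t) = 0 &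
  eps * cr (edgev P i) (c - edge_point P i t) = edist (v i) (v (ordS i)) * r].
Proof.
have [q [/edgeP[t /andP[t0 t1] ->] cq]] := touch i.
have t0' : 0 < t.
  rewrite lt_neqAle t0 andbT; apply/eqP => te.
  have [k kE] := ordS_surj i; have := vertex_not_touching k.
  by rewrite -kE -cq -te /edge_point conv0 eqxx.
have t1' : t < 1.
  rewrite lt_neqAle t1 andbT; apply/eqP => te.
  by have := vertex_not_touching i; rewrite -cq te /edge_point conv1 eqxx.
have t01 : 0 < t < 1 by rewrite t0'.
set z := edge_point P i t in cq *; set e := edgev P i.
have ee : 0 < dotp e e by rewrite dotpp_gt0 ?edgev_neq0.
have zz : dotp (c - z) (c - z) = r ^+ 2 by rewrite -cq -sqr_enorm.
have shift s : 0 <= t + s <= 1 -> 2 * s * dotp e (c - z) <= s * s * dotp e e.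
  move=> ts; have : edge v i (edge_point P i (t + s)) by apply/edgeP; exists (t + s).
  move=> /edge_far; rewrite -zz.
  have -> : dotp (edge_point P i (t + s) - c) (edge_point P i (t + s) - c) =
    dotp (c - z) (c - z) - 2 * s * dotp e (c - z) + s * s * dotp e e.
    by rewrite /z /e /dotp /edge_point /edgev !coordE; ring.
  lra.
have d0 : dotp e (c - z) = 0.
  apply/eqP; rewrite eq_le; apply/andP; split.
    apply: (@slope_le _ ((1 - t) * dotp e e)); first by apply: mulr_ge0; [rewrite subr_ge0|exact: ltW].
    move=> s s0 s1; have := shift (s * (1 - t)).
    have -> : 0 <= t + s * (1 - t) <= 1 by apply/andP; split; nra.
    move=> /(_ isT) H; rewrite -(ler_pM2l (_ : 0 < s * (1 - t))) ?mulr_gt0 ?subr_gt0 //; lra.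
  rewrite -oppr_le0; apply: (@slope_le _ (t * dotp e e)); first by apply: mulr_ge0; exact: ltW.
  move=> s s0 s1; have := shift (- (s * t)).
  have -> : 0 <= t + - (s * t) <= 1 by apply/andP; split; nra.
  move=> /(_ isT) H; rewrite -(ler_pM2l (_ : 0 < s * t)) ?mulr_gt0 //; lra.
have len : edist (v i) (v (ordS i)) ^+ 2 = dotp e e by rewrite edistC sqr_enorm.
have sq : (cr e (c - z)) ^+ 2 = (edist (v i) (v (ordS i)) * r) ^+ 2.
  by rewrite exprMn len -zz -lagrange d0 expr0n add0r.
have lr : 0 < edist (v i) (v (ordS i)) * r by rewrite mulr_gt0 ?elen_gt0.
have cn0 : cr e (c - z) != 0 by rewrite -sqrf_eq0 sq sqrf_eq0 gt_eqF.
have pos : 0 < eps * cr e (c - z).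
  have [rho rho0 hrho] := ori i t01.
  have [s0 s00 hs0] := box_small z (c - z) rho0.
  have [s [sgt0 ss0 s1]] := small2 s00 ltr01.
  have crs : cr e (z + s *: (c - z) - z) = s * cr e (c - z) by rewrite /cr !coordE; ring.
  have : K (z + s *: (c - z)).
    apply: diskK; rewrite /disk /mkset.
    have -> : edist c (z + s *: (c - z)) = (1 - s) * r.
      apply/eqP; rewrite -(@eqrXn2 _ 2) ?enorm_ge0 ?mulr_ge0 ?subr_ge0 ?ltW //.
      rewrite sqr_enorm exprMn -zz /dotp !coordE; apply/eqP; ring.
    by rewrite ger_pMl //; lra.
  rewrite (hrho _ (hs0 _ sgt0 ss0)) -/z -/e crs; last by rewrite mulf_neq0 // gt_eqF.
  by rewrite mulrCA pmulr_rgt0.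
exists t; split => //; apply/eqP; rewrite -(@eqrXn2 _ 2) ?(ltW pos) ?(ltW lr) //.
by rewrite exprMn sq; case: eps1 => ->; rewrite ?sqrrN expr1n mul1r.
Qed.

(** Each edge spans with the centre a triangle of height [r]. *)
Lemma circumscribed_area : eps * \sum_i cr (v i) (v (ordS i)) = r * perimeter P.
Proof.
have E i : eps * cr (v i - c) (v (ordS i) - c) = edist (v i) (v (ordS i)) * r.
  have [t [_ _ <-]] := tangency i; congr (_ * _).
  by rewrite /edge_point /edgev /cr !coordE; ring.
rewrite /perimeter [RHS]mulrC mulr_suml -(eq_bigr _ (fun i _ => E i)) mulr_sumr.
have tele (f : 'I_5 -> R) : \sum_i f (ordS i) = \sum_i f i.
  by rewrite [RHS](reindex_inj (@ordS_inj 5)).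
rewrite [RHS](eq_bigr (fun i : 'I_5 => eps * cr (v i) (v (ordS i)) +
   (eps * cr (v (ordS i)) c - eps * cr (v i) c))); last first.
  by move=> i _; rewrite /cr !coordE; ring.
by rewrite [RHS]big_split sumrB /= (tele (fun i => eps * cr (v i) c)) subrr addr0.
Qed.

(* [tau i] is the common length of the two tangent segments from [v i]. *)
Lemma tangent_lengths : exists tau : 'I_5 -> R, [/\ forall i, 0 < tau i,
  forall i, dotp (side_next P i) (side_prev P i) * (tau i ^+ 2 + r ^+ 2) =
            tau i ^+ 2 - r ^+ 2 &
  perimeter P = 2 * \sum_i tau i].
Proof.
have [t ht] := choice tangency.
pose l i := edist (v i) (v (ordS i)).
have l0 i : 0 < l i := elen_gt0 P i.
(* Both [tau i] and [tau' i] belong to the vertex [ordS i], the first along the edge that leaves it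
   and the second along the edge that arrives. *)
pose tau i := t (ordS i) * l (ordS i).
pose tau' i := (1 - t i) * l i.
have dn i : dotp (side_next P i) (c - v (ordS i)) = tau i.
  have [_ d0 _] := ht (ordS i).
  have -> : dotp (side_next P i) (c - v (ordS i)) =
    (l (ordS i))^-1 * (dotp (edgev P (ordS i)) (c - edge_point P (ordS i) (t (ordS i))) +
       t (ordS i) * dotp (edgev P (ordS i)) (edgev P (ordS i))).
    by rewrite side_nextE /edge_point /edgev /dotp !coordE; ring.
  rewrite d0 add0r -sqr_enorm -/(edist _ _) edistC -/(l (ordS i)) /tau.
  by field; rewrite gt_eqF.
have dp i : dotp (side_prev P i) (c - v (ordS i)) = tau' i.
  have [_ d0 _] := ht i.
  have -> : dotp (side_prev P i) (c - v (ordS i)) =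
    (l i)^-1 * (- dotp (edgev P i) (c - edge_point P i (t i)) +
       (1 - t i) * dotp (edgev P i) (edgev P i)).
    by rewrite side_prevE /edge_point /edgev /dotp !coordE; ring.
  rewrite d0 oppr0 add0r -sqr_enorm -/(edist _ _) edistC -/(l i) /tau'.
  by field; rewrite gt_eqF.
have cn i : eps * cr (side_next P i) (c - v (ordS i)) = r.
  have [_ _ c0] := ht (ordS i).
  have -> : eps * cr (side_next P i) (c - v (ordS i)) =
    (l (ordS i))^-1 * (eps * cr (edgev P (ordS i)) (c - edge_point P (ordS i) (t (ordS i)))).
    by rewrite side_nextE /edge_point /edgev /cr !coordE; ring.
  by rewrite c0 -/(l (ordS i)); field; rewrite gt_eqF.
have cp i : eps * cr (side_prev P i) (c - v (ordS i)) = - r.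
  have [_ _ c0] := ht i.
  have -> : eps * cr (side_prev P i) (c - v (ordS i)) =
    - ((l i)^-1 * (eps * cr (edgev P i) (c - edge_point P i (t i)))).
    by rewrite side_prevE /edge_point /edgev /cr !coordE; ring.
  by rewrite c0 -/(l i); field; rewrite gt_eqF.
have ee : eps * eps = 1 by case: eps1 => ->; ring.
have sq x : (eps * x) ^+ 2 = x ^+ 2 by rewrite exprMn expr2 ee mul1r.
have tau0 i : 0 < tau i by rewrite mulr_gt0 //; have [/andP[]] := ht (ordS i).
have tau'0 i : 0 < tau' i.
  by rewrite mulr_gt0 // subr_gt0; have [/andP[]] := ht i.
have uu i : dotp (c - v (ordS i)) (c - v (ordS i)) = tau i ^+ 2 + r ^+ 2.
  have := lagrange (side_next P i) (c - v (ordS i)).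
  rewrite udir_unit ?vertex_neq // mul1r => <-; rewrite dn -[in RHS](cn i).
  by rewrite sq.
have uu' i : dotp (c - v (ordS i)) (c - v (ordS i)) = tau' i ^+ 2 + r ^+ 2.
  have := lagrange (side_prev P i) (c - v (ordS i)).
  rewrite udir_unit 1?eq_sym ?vertex_neq // mul1r => <-; rewrite dp.
  by rewrite -[in RHS](sqrrN r) -[in RHS](cp i) sq.
have tauE i : tau' i = tau i.
  apply/eqP; rewrite -(@eqrXn2 _ 2) ?(ltW (tau0 i)) ?(ltW (tau'0 i)) //.
  by apply/eqP; have := uu i; rewrite uu'; lra.
exists tau; split => //.
  move=> i; rewrite -uu.
  have -> : dotp (side_next P i) (side_prev P i) * dotp (c - v (ordS i)) (c - v (ordS i)) =
    dotp (side_next P i) (c - v (ordS i)) * dotp (side_prev P i) (c - v (ordS i)) +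
    cr (side_next P i) (c - v (ordS i)) * cr (side_prev P i) (c - v (ordS i)).
    by rewrite /dotp /cr; ring.
  rewrite dn dp tauE -expr2.
  have -> : cr (side_next P i) (c - v (ordS i)) * cr (side_prev P i) (c - v (ordS i)) =
    (eps * cr (side_next P i) (c - v (ordS i))) * (eps * cr (side_prev P i) (c - v (ordS i))).
    by rewrite mulrACA ee mul1r.
  by rewrite cn cp mulrN -expr2.
rewrite /perimeter (eq_bigr (fun i : 'I_5 => t i * l i + tau' i)); last first.
  by move=> i _; rewrite /tau' /l; ring.
rewrite big_split /= (eq_bigr _ (fun i _ => tauE i)).
have -> : \sum_(i < 5) t i * l i = \sum_i tau i by rewrite (reindex_inj (@ordS_inj 5)).
by rewrite mulr_natl.
Qed.

End Circumscribed.

Section Prismatic.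
Context {R : realType} (P : pentagon R).

(** A right angle has tangent length [r] and an angle 2pi/3 has r/sqrt 3, so the perimeter is 2r(2 +
    sqrt 3); unit area makes [r] times the perimeter equal to 2, which eliminates [r]. *)
Lemma prismatic_perimeter : prismatic P -> unit_area P ->
  perimeter P ^+ 2 = 4 * (2 + Num.sqrt 3).
Proof.
move=> [[c [r [r0 diskK touch]]] [a [b [ab _ [ha hb hk]]]]] area1.
have [eps e1 ori] := orientation_ex P.
have p0 := pi_gt0 R.
have angle_cases k : interior_angle P k = pi / 2 \/ interior_angle P k = 2 * pi / 3.
  have [->|ka] := eqVneq k a; first by left.
  have [->|kb] := eqVneq k b; first by left.
  by right; exact: hk.
have strict i : 0 < eps * turn P i.
  have lt : interior_angle P (ordS i) < pi by have [->|->] := angle_cases (ordS i); lra.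
  rewrite ltNge le_eqVlt; apply/negP => /orP[/eqP t0|]; last first.
    by rewrite -(reflexP e1 ori) ltNge ltW.
  have t0' : turn P i = 0.
    by case: e1 t0 => ->; rewrite ?mul1r // mulN1r => /eqP; rewrite oppr_eq0 => /eqP.
  by rewrite flat_angle // ltxx in lt.
have rp : r * perimeter P = 2.
  by rewrite -(circumscribed_area e1 ori r0 diskK touch strict) shoelace_unit.
have [tau [tau0 tauD perE]] := tangent_lengths e1 ori r0 diskK touch strict.
have q3 : 0 < Num.sqrt 3 :> R by rewrite sqrtr_gt0.
have qq : Num.sqrt 3 * Num.sqrt 3 = 3 :> R by rewrite -expr2 sqr_sqrtr.
have dot i : dotp (side_next P i) (side_prev P i) = cos (interior_angle P (ordS i)).
  have [-> _] := convex_angle ori (strict i).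
  by rewrite acosK // in_itv /= sides_dot_bound.
have c3 : cos (2 * pi / 3 : R) = - (1 / 2).
  have c0 : 0 < cos (pi / 3%:R : R) by apply: cos_gt0_pihalf; lra.
  have := @tan_pi3 R; rewrite /tan => /(congr1 (fun x => x * cos (pi / 3%:R : R))).
  rewrite divfK ?gt_eqF // => sE.
  have := cos2Dsin2 (pi / 3%:R : R); rewrite sE.
  have -> : 2 * pi / 3 = pi / 3%:R + pi / 3%:R :> R by field.
  rewrite cosD sE; move: (cos _) c0 => x x0; rewrite exprMn [X in _ + X]mulrC expr2.
  move=> h; nra.
have tauE i : tau i = if (ordS i == a) || (ordS i == b) then r else r * Num.sqrt 3 / 3.
  have := tauD i; rewrite dot; have := tau0 i; case: ifPn => [/orP hab t0|].
    have -> : interior_angle P (ordS i) = pi / 2 by case: hab => /eqP ->.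
    rewrite cos_pihalf mul0r => h; apply/eqP.
    by rewrite -(@eqrXn2 _ 2) ?(ltW t0) ?(ltW r0) //; apply/eqP; lra.
  rewrite negb_or => /andP[na nb] t0; rewrite hk // c3 => h.
  apply/eqP; rewrite -(@eqrXn2 _ 2) ?(ltW t0) // ?divr_ge0 ?mulr_ge0 ?ltW //.
  apply/eqP; rewrite expr_div_n exprMn [Num.sqrt 3 ^+ 2]expr2 qq; lra.
have sumE : \sum_i tau i = r * (2 + Num.sqrt 3).
  pose f (k : 'I_5) := r * Num.sqrt 3 / 3 +
     ((k == a)%:R + (k == b)%:R) * (r - r * Num.sqrt 3 / 3).
  have -> : \sum_i tau i = \sum_k f k.
    rewrite [RHS](reindex_inj (@ordS_inj 5)); apply: eq_bigr => i _.
    rewrite tauE /f; have [->|na] := eqVneq (ordS i) a => /=.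
      by rewrite (negPf ab) addr0 mul1r; ring.
    by have [_|_] := eqVneq (ordS i) b => /=; rewrite ?add0r ?mul1r ?mul0r; ring.
  have one x : \sum_(k : 'I_5) ((k == x)%:R : R) = 1.
    by rewrite (bigD1 x) //= eqxx big1 ?addr0 // => k /negPf ->.
  rewrite big_split /= sumr_const card_ord -mulr_suml big_split /= !one -mulr_natl.
  by field.
have -> : perimeter P ^+ 2 = (r * perimeter P) * (2 * (2 + Num.sqrt 3)).
  by rewrite expr2 {1}perE sumE; ring.
by rewrite rp; ring.
Qed.

End Prismatic.

(** * Counting tiles in a disk *)
Section DiskArea.
Context {R : realType}.
Local Notation mu := (@lebesgue_measure R).
Implicit Types (p q c : plane R) (x y r rho th : R).

Lemma cvg_enorm (T : Type) (F : set_system T) (FF : Filter F) (f : T -> plane R) p :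
  f t @[t --> F] --> p -> enorm (f t) @[t --> F] --> enorm p.
Proof.
move=> fp; rewrite /enorm /dotp.
have f1 : (f t).1 @[t --> F] --> p.1 by apply: cvg_comp fp _; exact: cvg_fst.
have f2 : (f t).2 @[t --> F] --> p.2 by apply: cvg_comp fp _; exact: cvg_snd.
apply: continuous_cvg; first exact: sqrt_continuous.
by apply: cvgD; apply: cvgM.
Qed.

Lemma closed_disk c r : closed (disk c r).
Proof.
have ce : continuous (fun p => edist c p).
  by move=> p; apply: cvg_enorm; apply: cvgB; [exact: cvg_cst|exact: cvg_id].
have -> : disk c r = (fun p => edist c p) @^-1` [set x | x <= r] by [].
by apply: closed_comp; [move=> x _; exact: ce|exact: closed_le].
Qed.

Lemma edist0 p : edist 0 p = enorm p.
Proof. by rewrite /edist sub0r enormN. Qed.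

Lemma disk0P p r : 0 <= r -> disk 0 r p <-> dotp p p <= r ^+ 2.
Proof.
move=> r0; rewrite /disk /mkset edist0 -sqr_enorm.
by rewrite ler_pXn2r ?nnegrE ?enorm_ge0.
Qed.

(** The antiderivative involves [asin], singular at the ends of the diameter, so only abscissas up
    to [r * sin th] are integrated; [th] later tends to [pi / 2]. *)
Lemma area_disk_ge_angle r th : 0 < r -> 0 < th -> th < pi / 2 ->
  ((2 * th * r ^+ 2)%:E <= area (disk 0%R r))%E.
Proof.
move=> r0 th0 thp; have p0 := pi_gt0 R.
have s0 : 0 < sin th by apply: sin_gt0_pi; lra.
have c0 : 0 < cos th by apply: cos_gt0_pihalf; rewrite thp andbT; lra.
have s1 : sin th < 1.
  have := cos2Dsin2 th; have : 0 < cos th ^+ 2 by rewrite exprn_gt0.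
  by move=> h1 h2; rewrite -(@ltr_pXn2r _ 2) ?nnegrE ?(ltW s0) // expr1n; lra.
pose a := r * sin th.
have a0 : 0 < a by rewrite mulr_gt0.
pose f x := 2 * r * Num.sqrt (1 - (x / r) ^+ 2).
pose F x := r ^+ 2 * (x / r * cos (asin (x / r)) + asin (x / r)).
have inside x : - a <= x <= a -> -1 < x / r < 1.
  move=> /andP[h1 h2]; rewrite ltr_pdivrMr // ltr_pdivlMr //.
  have : r * sin th < r by rewrite gtr_pMr.
  by rewrite /a in h1 h2; lra.
have cf : continuous f.
  have c1 : continuous (fun x : R => 1 - (x / r) ^+ 2).
    move=> x; apply: cvgB; first exact: cvg_cst.
    by apply: cvgM; apply: cvgMl; exact: cvg_id.
  by move=> x; apply: cvgMr; apply: (continuous_comp (c1 x)); exact: sqrt_continuous.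
have dF x : - a <= x <= a -> is_derive x 1 F (f x).
  move=> xa; have y1 := inside x xa.
  have dy : is_derive x 1 (fun x : R => x / r) r^-1.
    by apply: is_derive_eq; rewrite /GRing.scale /= ?mulr1 ?mul1r ?mulr0 ?add0r ?addr0.
  have da : is_derive x 1 (fun x => asin (x / r)) ((Num.sqrt (1 - (x / r) ^+ 2))^-1 * r^-1).
    by apply: (@is_derive1_comp _ asin (fun x => x / r)); exact: is_derive1_asin.
  have dc : is_derive x 1 (fun x => cos (asin (x / r)))
      (- sin (asin (x / r)) * ((Num.sqrt (1 - (x / r) ^+ 2))^-1 * r^-1)).
    by apply: (@is_derive1_comp _ cos (fun x => asin (x / r))).
  have q0 : 0 < 1 - (x / r) ^+ 2.
    by move: y1 => /andP[h1 h2]; nra.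
  have sq0 : 0 < Num.sqrt (1 - (x / r) ^+ 2) by rewrite sqrtr_gt0.
  have sqE : Num.sqrt (1 - (x / r) ^+ 2) ^+ 2 = 1 - (x / r) ^+ 2 by rewrite sqr_sqrtr // ltW.
  have yin : x / r \in `[-1, 1] by case/andP: y1 => *; rewrite in_itv /= !ltW.
  have sa : sin (asin (x / r)) = x / r by rewrite asinK.
  have ca : cos (asin (x / r)) = Num.sqrt (1 - (x / r) ^+ 2).
    by rewrite cos_asin //; case/andP: y1 => *; rewrite !ltW.
  rewrite /F; apply: is_derive_eq.
  rewrite /GRing.scale /= sa ca /f.
  move: (Num.sqrt _) sq0 sqE => q q0' qE.
  move: (x / r) qE => y qE.
  have -> : r ^+ 2 * (y * (- y * (q^-1 / r)) + q / r + q^-1 / r) = r * (q + (1 - y ^+ 2) / q).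
    by field; rewrite !gt_eqF.
  by rewrite -qE; field; rewrite gt_eqF.
have ar : a / r = sin th by rewrite /a mulrC mulKf ?gt_eqF.
have Fa : F a = r ^+ 2 * (sin th * cos th + th).
  rewrite /F ar sinK //.
  by rewrite in_itv /=; lra.
have FNa : F (- a) = - F a.
  rewrite Fa /F mulNr ar -sinN sinK ?cosN ?sinN; first by ring.
  by rewrite in_itv /=; lra.
have mD : measurable (disk 0 r : set (measurableTypeR R * measurableTypeR R)).
  by apply: closed_measurable_plane; exact: closed_disk.
have mf : measurable_fun setT (EFin \o f).
  by apply/measurable_EFinP; exact: continuous_measurable_fun.
have f0 x : 0 <= f x by rewrite mulr_ge0 ?mulr_ge0 ?sqrtr_ge0 ?ltW.
have mX := measurable_fun_xsection mu mD.
apply: (@le_trans _ _ (\int[mu]_(x in `[(- a)%R, a]) (f x)%:E)%E).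
  rewrite (@continuous_FTC2 _ _ F) //.
  - rewrite -EFinB lee_fin FNa opprK Fa.
    have : 0 < sin th * cos th * r ^+ 2 by rewrite !mulr_gt0 ?exprn_gt0.
    lra.
  - lra.
  - exact: continuous_subspaceT.
  - have cF x : - a <= x <= a -> F @ x --> F x.
      move=> xa; have [dFx _] := dF x xa.
      by apply/differentiable_continuous/derivable1_diffP.
    split.
    + by move=> x; rewrite in_itv /= => /andP[h1 h2]; have [] := dF x ltac:(by rewrite !ltW).
    + by apply: cvg_at_right_filter; apply: cF; lra.
    + by apply: cvg_at_left_filter; apply: cF; lra.
  - move=> x; rewrite in_itv /= => /andP[h1 h2]; rewrite derive1E.
    by have [] := dF x ltac:(by rewrite !ltW).
apply: (@le_trans _ _ (\int[mu]_(x in `[(- a)%R, a]) mu (xsection (disk 0%R r) x))%E); last first.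
  by apply: ge0_subset_integral.
apply: ge0_le_integral => //.
- by move=> x _; rewrite lee_fin.
- exact: measurable_funTS.
- exact: measurable_funTS.
move=> x; rewrite /= in_itv /= => xa; have y1 := inside x xa.
pose h := r * Num.sqrt (1 - (x / r) ^+ 2).
have h0 : 0 <= h by rewrite mulr_ge0 ?sqrtr_ge0 ?ltW.
have h2 : h ^+ 2 = r ^+ 2 - x ^+ 2.
  rewrite /h exprMn sqr_sqrtr; last by move: y1 => /andP[h1 h2]; nra.
  by field; rewrite gt_eqF.
have -> : (f x)%:E = mu (`[- h, h] : set R).
  rewrite lebesgue_measure_itv /= lte_fin.
  case: ltP => hh; first by rewrite -EFinB opprK /f /h; congr (_%:E); ring.
  by congr (_%:E); rewrite /f; rewrite /h in hh h0; lra.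
apply: le_measure; rewrite ?inE //; first exact: measurable_xsection.
move=> s; rewrite /= in_itv /= => /andP[s1' s2']; rewrite /xsection /mkset inE.
apply/disk0P; first exact: ltW.
rewrite /dotp /= -!expr2; have : s ^+ 2 <= h ^+ 2 by nra.
by rewrite h2; lra.
Qed.

Theorem area_disk_ge r : 0 < r -> ((pi * r ^+ 2)%:E <= area (disk 0%R r))%E.
Proof.
move=> r0; have p0 := pi_gt0 R.
have r2 : 0 < r ^+ 2 by rewrite exprn_gt0.
apply/lee_addgt0Pr => e e0.
have [th [t0 tp te]] : exists th, [/\ 0 < th, th < pi / 2 & pi * r ^+ 2 <= 2 * th * r ^+ 2 + e].
  pose d := Num.min (pi / 4) (e / (2 * r ^+ 2)).
  have d0 : 0 < d by rewrite lt_min !divr_gt0 // mulr_gt0.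
  have d1 : d <= pi / 4 by rewrite ge_min lexx.
  have d2 : 2 * r ^+ 2 * d <= e by rewrite mulrC -ler_pdivlMr ?mulr_gt0 // ge_min lexx orbT.
  by exists (pi / 2 - d); split; lra.
apply: (@le_trans _ _ ((2 * th * r ^+ 2)%:E + e%:E)%E); first by rewrite -EFinD lee_fin.
by apply: leeD => //; exact: area_disk_ge_angle.
Qed.

End DiskArea.

(** * Lengths of edges inside a disk *)

Section Clip.
Context {R : realType}.
Implicit Types (p q a b : plane R) (r : R) (e : set (plane R)).

Lemma edist_le_disk r p q : disk 0 r p -> disk 0 r q -> edist p q <= 2 * r.
Proof.
rewrite /disk /mkset => hp hq; apply: le_trans (edist_triangle 0 p q) _.
rewrite edistC; lra.
Qed.

Lemma seg_length_ge r e p q : e p -> e q -> disk 0 r p -> disk 0 r q ->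
  edist p q <= seg_length (e `&` disk 0 r).
Proof.
move=> ep eq dp dq; apply: sup_ubound; last by exists p => //; exists q.
exists (2 * r) => x [p' [_ dp'] [q' [_ dq'] <-]]; exact: edist_le_disk.
Qed.

Lemma seg_length_ge0 r e : 0 <= seg_length (e `&` disk 0 r).
Proof.
have [[p [ep dp]]|] := pselect (e `&` disk 0 r !=set0).
  by apply: le_trans (seg_length_ge ep ep dp dp); exact: enorm_ge0.
move=> /set0P/negP/negPn/eqP ->; rewrite /seg_length (_ : [set _ | _ in _ & _ in _] = set0) ?sup0 //.
by apply/seteqP; split => // x [p []].
Qed.

(** Constant outside the disk and 1-Lipschitz, so only the part of an edge inside the disk can
    change it. *)
Definition clip r p : R := Num.min (enorm p) r.

Lemma enormB p q : enorm q - enorm p <= edist p q.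
Proof.
rewrite edistC /edist; have := enormD (q - p) p; rewrite subrK; lra.
Qed.

Lemma clip_le r a b p q : 0 <= r -> segment a b p -> segment a b q ->
  clip r q - clip r p <= seg_length (segment a b `&` disk 0 r).
Proof.
move=> r0 ep eq; have s0 := seg_length_ge0 r (segment a b).
rewrite /clip; have [pr|rp] := leP (enorm p) r; last first.
  by apply: le_trans s0; rewrite subr_le0 ge_min lexx orbT.
have dp : disk 0 r p by rewrite /disk /mkset edist0.
have [qr|rq] := leP (enorm q) r.
  apply: le_trans (enormB p q) _; apply: seg_length_ge => //.
  by rewrite /disk /mkset edist0.
have ce : continuous (fun t : R => enorm ((1 - t) *: p + t *: q)).
  by move=> t; apply: cvg_enorm; exact: continuous_path.
have [||t t01 tE] := @IVT _ (fun t : R => enorm ((1 - t) *: p + t *: q)) 0 1 r ler01.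
- exact: continuous_subspaceT.
- by rewrite conv0 conv1 ge_min le_max pr (ltW rq) orbT.
rewrite in_itv /= in t01.
have er : segment a b ((1 - t) *: p + t *: q).
  move: ep eq t01 => /segmentP[s /andP[u0 u1] ->] /segmentP[s' /andP[u0' u1'] ->] /andP[t0 t1].
  apply/segmentP; exists ((1 - t) * s + t * s'); first by apply/andP; split; nra.
  by apply: plane_eq; rewrite !coordE; ring.
have dr : disk 0 r ((1 - t) *: p + t *: q) by rewrite /disk /mkset edist0 tE.
apply: le_trans (seg_length_ge ep er dp dr).
by apply: le_trans (enormB _ _); rewrite tE.
Qed.

End Clip.

Lemma ordS_cases (k l : 'I_5) : [\/ l = k, l = ordS k | l = ordS (ordS k)] \/
   (l = ordS (ordS (ordS k)) \/ l = ordS (ordS (ordS (ordS k)))).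
Proof.
by case: k => [[|[|[|[|[|]]]]]] // hk; case: l => [[|[|[|[|[|]]]]]] // hl;
  first [by left; apply: Or31; apply/val_inj|by left; apply: Or32; apply/val_inj
        |by left; apply: Or33; apply/val_inj|by right; left; apply/val_inj
        |by right; right; apply/val_inj].
Qed.

Section DeepTile.
Context {R : realType} (P : pentagon R).
Hypothesis area1 : unit_area P.
Notation v := (vertex P).
Notation K := (region P).
Implicit Types (r rho : R).

Definition length_in_disk r : R := \sum_(k < 5) seg_length (edge v k `&` disk 0 r).

Lemma clip_vertices r k l : 0 <= r -> clip r (v l) - clip r (v k) <= length_in_disk r.
Proof.
move=> r0.
have st i : clip r (v (ordS i)) - clip r (v i) <= seg_length (edge v i `&` disk 0 r).
  apply: clip_le => //; apply/segmentP; [exists 0|exists 1]; rewrite ?conv0 ?conv1 ?lexx ?ler01 //.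
rewrite /length_in_disk (sum_ordS _ k).
have := st k; have := st (ordS k); have := st (ordS (ordS k)).
have := st (ordS (ordS (ordS k))).
have p0 := seg_length_ge0 r (edge v k).
have p1 := seg_length_ge0 r (edge v (ordS k)).
have p2 := seg_length_ge0 r (edge v (ordS (ordS k))).
have p3 := seg_length_ge0 r (edge v (ordS (ordS (ordS k)))).
have p4 := seg_length_ge0 r (edge v (ordS (ordS (ordS (ordS k))))).
have [[]|[]] := ordS_cases k l.
all: move=> ->; lra.
Qed.

(** The factor 3 counts the way from [x] to a vertex, between two vertices, and from a vertex to
    [y], each at most the total length. *)
Lemma clip_curve r x y : 0 <= r -> curve P x -> curve P y ->
  clip r y - clip r x <= 3 * length_in_disk r.
Proof.
move=> r0 [k _ ex] [l _ ey].
have vk i : edge v i (v i) by apply/edgeP; exists 0; rewrite ?lexx ?ler01 // /edge_point conv0.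
have h1 : clip r (v k) - clip r x <= seg_length (edge v k `&` disk 0 r) by apply: (clip_le r0 ex (vk k)).
have h2 : clip r y - clip r (v l) <= seg_length (edge v l `&` disk 0 r) by apply: (clip_le r0 (vk l) ey).
have h3 := clip_vertices k l r0.
have le i : seg_length (edge v i `&` disk 0 r) <= length_in_disk r.
  by rewrite /length_in_disk (bigD1 i) //= lerDl sumr_ge0 // => j _; exact: seg_length_ge0.
have := le k; have := le l; lra.
Qed.

(* A tile reaching from the small disk to outside the large one has a boundary
   point in the small disk, since it cannot contain it. *)
Lemma deep_tile_length r rho : 0 < rho -> rho <= r -> 1 < pi * rho ^+ 2 ->
  K `&` disk 0 rho !=set0 -> ~ K `<=` disk 0 r -> r - rho <= 3 * length_in_disk r.
Proof.
move=> rho0 rr big [p [Kp dp]] nK.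
have r0 : 0 < r by lra.
(* From a point of the tile outside the disk, the ray away from the origin must leave the bounded
   tile, and it does so through the curve. *)
have [y cy ry] : exists2 y, curve P y & r < enorm y.
  have [y [Ky /negP]] : exists y, K y /\ ~ disk 0 r y.
    by apply: contrapT => /forallNP h; apply: nK => y Ky; apply: contrapT => nd; apply: (h y).
  rewrite edist0 -ltNge => ry; have [M M0 hM] := region_bounded P.
  have yn0 : 0 < enorm y by lra.
  have y2 : 0 < dotp y y by rewrite -sqr_enorm exprn_gt0.
  pose s := 1 + 2 * M ^+ 2 / dotp y y.
  have s1 : 1 <= s by rewrite lerDl divr_ge0 ?mulr_ge0 ?sqr_ge0 ?ltW.
  have nKs : ~ K (s *: y).
    move=> /hM[]; rewrite !coordE => /andP[h1 h2] /andP[h3 h4].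
    have g1 : (s * y.1) ^+ 2 < M ^+ 2 by nra.
    have g2 : (s * y.2) ^+ 2 < M ^+ 2 by nra.
    have : s ^+ 2 * dotp y y < 2 * M ^+ 2 by rewrite /dotp; lra.
    have g3 : s * dotp y y = dotp y y + 2 * M ^+ 2 by rewrite /s; field; rewrite gt_eqF.
    rewrite expr2 -mulrA g3; nra.
  apply: contrapT => nc; apply: nKs; apply: (@seg_side _ _ y) => // t /andP[t0 t1] cu.
  have E : (1 - t) *: y + t *: (s *: y) = (1 + t * (s - 1)) *: y.
    by apply: plane_eq; rewrite !coordE; ring.
  rewrite E in cu; apply: nc; exists ((1 + t * (s - 1)) *: y) => //.
  have k1 : 1 <= 1 + t * (s - 1) by rewrite lerDl mulr_ge0 // subr_ge0.
  have -> : enorm ((1 + t * (s - 1)) *: y) = (1 + t * (s - 1)) * enorm y.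
    apply/eqP; rewrite -(@eqrXn2 _ 2) ?enorm_ge0 ?mulr_ge0 ?enorm_ge0 //; last by lra.
    by rewrite exprMn !sqr_enorm /dotp !coordE; apply/eqP; ring.
  by apply: lt_le_trans ry _; rewrite ler_peMl ?enorm_ge0.
have [x cx xr] : exists2 x, curve P x & enorm x <= rho.
  apply: contrapT => nc.
  have sub : disk 0 rho `<=` K.
    move=> q dq; apply: (@seg_side _ _ p) => // t /andP[t0 t1] cu; apply: nc.
    exists ((1 - t) *: p + t *: q) => //.
    apply: le_trans (enormD _ _) _.
    have nZ (c : R) (z : plane R) : 0 <= c -> enorm (c *: z) = c * enorm z.
      move=> c0; apply/eqP; rewrite -(@eqrXn2 _ 2) ?enorm_ge0 ?mulr_ge0 ?enorm_ge0 //.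
      by rewrite exprMn !sqr_enorm /dotp !coordE; apply/eqP; ring.
    rewrite !nZ // ?subr_ge0 //; move: dp dq; rewrite /disk /mkset !edist0 => hp hq; nra.
  have := area_disk_ge rho0.
  have : (area (disk 0%R rho) <= area K)%E.
    apply: le_measure => //; rewrite inE; apply: closed_measurable_plane.
      exact: closed_disk.
    exact: region_closed.
  by move=> h1 /le_trans /(_ h1); rewrite area1 lee_fin leNgt big.
have := clip_curve (ltW r0) cx cy; apply: le_trans.
rewrite /clip (min_idPr (ltW ry)) lerD2l lerN2.
by rewrite ge_min xr.
Qed.

Lemma inside_length r : K `<=` disk 0 r -> perimeter P <= length_in_disk r.
Proof.
move=> sub; apply: ler_sum => k _; apply: seg_length_ge.
- by apply/segmentP; exists 0; rewrite ?conv0 ?lexx ?ler01.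
- by apply/segmentP; exists 1; rewrite ?conv1 ?lexx ?ler01.
- apply/sub/curve_region; exists k => //.
  by apply/segmentP; exists 0; rewrite ?conv0 ?lexx ?ler01.
- apply/sub/curve_region; exists k => //.
  by apply/segmentP; exists 1; rewrite ?conv1 ?lexx ?ler01.
Qed.

End DeepTile.

(** * An edge belongs to at most two tiles *)

Section SharedEdge.
Context {R : realType}.
Implicit Types (P Q : pentagon R) (a b : plane R).

Lemma edge_inj P : injective (edge (vertex P)).
Proof.
move=> i j ij; have h01 : (0 < (2^-1 : R) < 1)%R by rewrite invr_gt0 invf_lt1 //; lra.
have : edge (vertex P) j (edge_point P i 2^-1).
  rewrite -ij; apply/edgeP; exists 2^-1 => //.
  by case/andP: h01 => *; rewrite !ltW.
by move/(edge_point_unique h01).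
Qed.

(* Exactly one side of a shared edge belongs to each tile; the side is read off at
   the midpoint, along the normal of a chosen representation of the edge. *)
Lemma edge_side P k a b : a != b -> edge (vertex P) k a -> edge (vertex P) k b ->
  exists2 sg, sg = 1 \/ sg = -1 & exists2 s0, 0 < s0 & forall s, 0 < s -> s < s0 ->
    (region P)° (2^-1 *: (a + b) + s *: (sg *: perp (b - a))).
Proof.
move=> ab /edgeP[al /andP[al0 al1] aE] /edgeP[be /andP[be0 be1] bE].
have [eps e1 ori] := orientation_ex P.
have albe : be - al != 0.
  by rewrite subr_eq0; apply: contra ab => /eqP h; rewrite aE bE h.
pose t := 2^-1 * (al + be); set e := edgev P k.
have t01 : 0 < t < 1.
  rewrite /t; have : al != be by rewrite eq_sym -subr_eq0.
  by have [h|h|//] := ltgtP al be => _; apply/andP; split; lra.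
have baE : b - a = (be - al) *: e.
  by rewrite aE bE; apply: plane_eq; rewrite /edge_point /e /edgev !coordE; ring.
have zE : 2^-1 *: (a + b) = edge_point P k t.
  by rewrite aE bE; apply: plane_eq; rewrite /edge_point /t !coordE; field.
have en : 0 < cr e (perp e) := cr_perp_gt0 P k.
have [r r0 hr] := ori k t t01; have [r' r'0 hr'] := near_edges P (edge_point P k t).
(* The orientation of [P], corrected by whether edge [k] runs from [a] to [b] or back. *)
have [sg sg1 sgp] : exists2 sg, sg = 1 \/ sg = -1 & 0 < eps * sg * (be - al).
  have [h|h|h] := ltgtP (be - al) 0; last by rewrite h eqxx in albe.
    exists (- eps); first by case: e1 => ->; rewrite ?opprK; [right|left].
    by rewrite mulrN; case: e1 => ->; rewrite ?mulrNN mulr1 mulN1r oppr_gt0.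
  by exists eps => //; case: e1 => ->; rewrite ?mulrNN mulr1 mul1r.
exists sg => //.
have [s0 s00 hs0] := box_small (edge_point P k t) (sg *: perp (b - a)) r0.
have [s1 s10 hs1] := box_small (edge_point P k t) (sg *: perp (b - a)) r'0.
have [m [m0 ms0 ms1]] := small2 s00 s10.
exists m => // s sgt0 sm; rewrite zE.
set p := _ + _.
have crE : cr e (p - edge_point P k t) = s * (sg * (be - al)) * cr e (perp e).
  have -> : cr e (p - edge_point P k t) = s * sg * cr e (perp (b - a)).
    by rewrite /p /cr !coordE; ring.
  have -> : perp (b - a) = (be - al) *: perp e.
    by rewrite baE; apply: plane_eq => //; exact: esym (mulrN _ _).
  by rewrite /cr !coordE; ring.
have c0 : cr e (p - edge_point P k t) != 0.
  rewrite crE; apply/eqP => h; have : s * (eps * sg * (be - al)) * cr e (perp e) = 0.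
    by rewrite -[RHS](mulr0 eps) -h; ring.
  by move/eqP; rewrite gt_eqF // mulr_gt0 // mulr_gt0.
apply: region_interior.
  apply/hr => //; first by apply: hs0 => //; lra.
  by rewrite crE !mulrA mulr_gt0 //; move: (mulr_gt0 sgt0 sgp); congr (_ < _); ring.
move=> [j _ ej]; have bp : box (edge_point P k t) r' p by apply: hs1 => //; lra.
have /(edge_point_unique t01) jk := hr' _ _ bp ej.
by move: c0; rewrite /e (edge_cr0 t) ?eqxx // -jk.
Qed.

End SharedEdge.

Section Multiplicity.
Context {R : realType} {I : choiceType} (T : I -> pentagon R).
Hypothesis htiling : tiling T.

(** The edge has two sides, so two of three tiles would have common interior points just off its
    midpoint. *)
Lemma three_share i1 i2 i3 k1 k2 k3 : i1 != i2 -> i1 != i3 -> i2 != i3 ->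
  edge (vertex (T i1)) k1 = edge (vertex (T i2)) k2 ->
  edge (vertex (T i1)) k1 = edge (vertex (T i3)) k3 -> False.
Proof.
move=> n12 n13 n23 e12 e13.
pose a := vertex (T i1) k1; pose b := vertex (T i1) (ordS k1).
have ab : a != b by exact: vertex_neq.
have ea : edge (vertex (T i1)) k1 a by apply/edgeP; exists 0; rewrite ?lexx ?ler01 // /edge_point conv0.
have eb : edge (vertex (T i1)) k1 b by apply/edgeP; exists 1; rewrite ?lexx ?ler01 // /edge_point conv1.
have [g1 g11 [s1 s10 h1]] := edge_side ab ea eb.
have [g2 g21 [s2 s20 h2]] : exists2 sg, sg = 1 \/ sg = -1 & exists2 s0, 0 < s0 &
    forall s, 0 < s -> s < s0 ->
    (region (T i2))° (2^-1 *: (a + b) + s *: (sg *: perp (b - a))).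
  by apply: (@edge_side _ _ k2); rewrite // -e12.
have [g3 g31 [s3 s30 h3]] : exists2 sg, sg = 1 \/ sg = -1 & exists2 s0, 0 < s0 &
    forall s, 0 < s -> s < s0 ->
    (region (T i3))° (2^-1 *: (a + b) + s *: (sg *: perp (b - a))).
  by apply: (@edge_side _ _ k3); rewrite // -e13.
have [_ disj] := htiling.
have [m [m0 ms1 ms2]] := small2 s10 s20; have [n [n0 nm n3]] := small2 m0 s30.
have {}h1 := h1 n n0 ltac:(lra); have {}h2 := h2 n n0 ltac:(lra).
have {}h3 := h3 n n0 n3.
have D i j p : i != j -> (region (T i))° p -> (region (T j))° p -> False.
  by move=> ij hi hj; have : ((region (T i))° `&` (region (T j))°) p by []; rewrite disj.
move: g11 g21 g31 h1 h2 h3 => [] -> [] -> [] -> h1 h2 h3;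
  by [exact: (D _ _ _ n12 h1 h2)|exact: (D _ _ _ n13 h1 h3)|exact: (D _ _ _ n23 h2 h3)].
Qed.

Lemma edge_multiplicity (F : seq I) (e : set (plane R)) : uniq F ->
  (count (fun x : I * 'I_5 => edge (vertex (T x.1)) x.2 == e)
     [seq (i, k) | i <- F, k <- enum 'I_5] <= 2)%N.
Proof.
move=> uF; set L := [seq _ | _ <- _, _ <- _].
have uL : uniq L by apply: allpairs_uniq => //; [exact: enum_uniq|move=> [x y] [x' y']].
rewrite leqNgt; apply/negP; rewrite -size_filter.
set s := [seq x <- L | _] => sz.
have us : uniq s by rewrite filter_uniq.
have hs x : x \in s -> edge (vertex (T x.1)) x.2 = e.
  by rewrite mem_filter => /andP[/eqP].
case: s us hs sz {uL} => [|x1 [|x2 [|x3 s]]] //= us hs _.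
have E1 := hs x1 (mem_head _ _).
have E2 : edge (vertex (T x2.1)) x2.2 = e by apply: hs; rewrite !inE eqxx orbT.
have E3 : edge (vertex (T x3.1)) x3.2 = e by apply: hs; rewrite !inE eqxx !orbT.
have ne (x y : I * 'I_5) : x != y -> edge (vertex (T x.1)) x.2 = e ->
    edge (vertex (T y.1)) y.2 = e -> x.1 != y.1.
  case: x y => [i k] [j l] /= ne Ex Ey; apply: contra ne => /eqP ij; subst j.
  by rewrite (edge_inj (etrans Ex (esym Ey))).
move: us; rewrite !inE !negb_or -!andbA => /and5P[n12 n13 _ n23 _].
apply: (@three_share x1.1 x2.1 x3.1 x1.2 x2.2 x3.2); rewrite ?E1 //; exact: ne.
Qed.

(** Double counting of the pairs of a tile and one of its edges, grouped by the edge as a point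
    set. *)
Lemma total_length_le (F : seq I) (r : R) : uniq F ->
  ((\sum_(i <- F) length_in_disk (T i) r)%:E <= 2%:E * perimeter_in_disk T r)%E.
Proof.
move=> uF; pose w e := seg_length (e `&` disk (0 : plane R) r).
pose L := [seq (i, k) | i <- F, k <- enum 'I_5].
pose g (x : I * 'I_5) := edge (vertex (T x.1)) x.2.
pose E := undup [seq g x | x <- L].
have w0 e : 0 <= w e by exact: seg_length_ge0.
have -> : \sum_(i <- F) length_in_disk (T i) r = \sum_(x <- L) w (g x).
  rewrite big_allpairs_dep /=; apply: eq_bigr => i _.
  by rewrite big_enum.
have -> : \sum_(x <- L) w (g x) = \sum_(e <- E) (count (fun x => g x == e) L)%:R * w e.
  rewrite (eq_big_seq (fun x => \sum_(e <- E) (g x == e)%:R * w e)); last first.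
    move=> x xL; rewrite (bigD1_seq (g x)) ?undup_uniq //=; last first.
      by rewrite mem_undup map_f.
    by rewrite eqxx mul1r big1 ?addr0 // => e; rewrite eq_sym => /negPf ->; rewrite mul0r.
  rewrite exchange_big /=; apply: eq_bigr => e _.
  by rewrite -mulr_suml -sum1_count natr_sum [in RHS]big_mkcond; congr (_ * _);
    apply: eq_bigr => x _; case: (g x == e).
have h : \sum_(e <- E) (count (fun x => g x == e) L)%:R * w e <= 2 * \sum_(e <- E) w e.
  rewrite mulr_sumr; apply: ler_sum => e _; apply: ler_wpM2r => //.
  by rewrite ler_nat edge_multiplicity.
apply: (@le_trans _ _ (2 * \sum_(e <- E) w e)%:E); first by rewrite lee_fin.
rewrite EFinM lee_pmul2l //.
apply: esum_ge; exists [set` E].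
  split; first exact: finite_seq.
  move=> e; rewrite /= mem_undup => /mapP[[i k] _ ->]; by exists i, k.
by rewrite -fsbig_seq ?undup_uniq // sumEFin.
Qed.

End Multiplicity.

(** * Numerical bounds and the weight of a tile *)

Section Numerics.
Context {R : realType}.
Implicit Types (P C : pentagon R) (x y : R).

Lemma ge_of_sqr x y : 0 <= x -> y ^+ 2 <= x ^+ 2 -> y <= x.
Proof. by move=> x0 h; rewrite leNgt; apply/negP => xy; nra. Qed.

(** The decimal 1.732050, its digits grouped in threes; the other bounds are written alike. *)
Lemma sqrt3_lo : 1 + 732 / 1000 + 50 / 1000 / 1000 <= Num.sqrt 3 :> R.
Proof.
have q0 : 0 <= Num.sqrt 3 :> R by [].
have q3 : Num.sqrt 3 ^+ 2 = 3 :> R by rewrite sqr_sqrtr.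
by apply: ge_of_sqr; [|rewrite q3; lra].
Qed.

Lemma sqrt3_hi : Num.sqrt 3 <= 1 + 732 / 1000 + 51 / 1000 / 1000 :> R.
Proof.
have q3 : Num.sqrt 3 ^+ 2 = 3 :> R by rewrite sqr_sqrtr.
by apply: ge_of_sqr; [|rewrite q3]; lra.
Qed.

Lemma tan_pi5_lo : 726 / 1000 + 540 / 1000 / 1000 <= tan (pi / 5%:R) :> R.
Proof.
have p0 := pi_gt0 R.
have t0 : 0 < tan (pi / 5%:R : R).
  rewrite /tan divr_gt0 //; first by apply: sin_gt0_pi; lra.
  by apply: cos_gt0_pihalf; lra.
apply: ge_of_sqr; first exact: ltW.
rewrite tan_pi5.
have : Num.sqrt 5 <= 2 + 236 / 1000 + 68 / 1000 / 1000 :> R.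
  have q5 : Num.sqrt 5 ^+ 2 = 5 :> R by rewrite sqr_sqrtr.
  by apply: ge_of_sqr; [|rewrite q5]; lra.
lra.
Qed.

Lemma unit_area_perimeter_lo P : unit_area P -> 3 + 811 / 1000 + 9 / 10 / 1000 <= perimeter P.
Proof.
move=> /unit_area_perimeter h; have := tan_pi5_lo => t.
by apply: ge_of_sqr; [exact/ltW/perimeter_gt0|apply: le_trans h; lra].
Qed.

Lemma non_convex_perimeter_lo P : unit_area P -> non_convex P -> 4 <= perimeter P.
Proof.
move=> a1 nc; apply: ge_of_sqr; first exact/ltW/perimeter_gt0.
by have := non_convex_perimeter a1 nc; lra.
Qed.

Lemma two_reflex_perimeter_lo P : unit_area P -> (1 < reflex_count P)%N ->
  4 + 559 / 1000 <= perimeter P.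
Proof.
move=> a1 rc; apply: ge_of_sqr; first exact/ltW/perimeter_gt0.
by have := reflex_count_perimeter a1 rc; have := sqrt3_lo; lra.
Qed.

Lemma prismatic_perimeter_hi P : unit_area P -> prismatic P ->
  perimeter P <= 3 + 863 / 1000 + 704 / 1000 / 1000.
Proof.
move=> a1 pr; apply: ge_of_sqr; first by lra.
by rewrite prismatic_perimeter //; have := sqrt3_hi; lra.
Qed.

Definition weight C P : R := (`[< efficient C P >])%:R -
  26 / 10 * (`[< type1 P >])%:R - 134 / 10 * (`[< type2 P >])%:R.

(* The multiplier 19.29 lies in the narrow window (13.4 / 0.69530, 1 / 0.05180)
   given by the perimeters of the square, the triangle and the regular pentagon
   of unit area compared with the prismatic one. *)
Lemma weight_ge C P : unit_area P -> efficient C P \/ non_convex P ->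
  (19 + 29 / 100) * (3 + 863 / 1000 + 707 / 1000 / 1000 - perimeter P) + 1 / 1000 / 10
  <= weight C P.
Proof.
move=> a1 enc; rewrite /weight.
have e0 : 0 <= (`[< efficient C P >])%:R :> R by [].
have [rc|rc] := ltnP 1 (reflex_count P).
  have p0 := two_reflex_perimeter_lo a1 rc.
  have [/asboolP [_ t1]|_] := boolP `[< type1 P >]; first by rewrite t1 in rc.
  by case: `[< type2 P >] => /=; lra.
have -> : `[< type2 P >] = false.
  by apply/asboolF => -[_ t2]; rewrite t2 in rc.
have [nc|cv] := pselect (non_convex P).
  have p0 := non_convex_perimeter_lo a1 nc.
  by case: `[< type1 P >] => /=; lra.
have -> : `[< type1 P >] = false by apply/asboolF => -[].
have -> : `[< efficient C P >] = true by apply/asboolT; case: enc.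
have p0 := unit_area_perimeter_lo a1.
by rewrite /=; lra.
Qed.

End Numerics.

(** * The mean perimeter of the tiles inside the disk *)

Section Counting.
Context {R : realType} {I : choiceType} (T : I -> pentagon R).
Hypothesis htiling : tiling T.
Hypothesis hunit : forall i, unit_area (T i).
Variables (r q : R).
Hypothesis r25 : 25 <= r.
Hypothesis q0 : 0 <= q.
Hypothesis q4 : q <= 4.
Hypothesis hper : (perimeter_in_disk T r <= (q / 2 * (pi * r ^+ 2))%:E)%E.

Lemma sum_length (F : seq I) : uniq F ->
  \sum_(i <- F) length_in_disk (T i) r <= q * (pi * r ^+ 2).
Proof.
move=> uF; rewrite -lee_fin; apply: le_trans (total_length_le htiling r uF) _.
have -> : (q * (pi * r ^+ 2))%:E = (2%:E * (q / 2 * (pi * r ^+ 2))%:E)%E.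
  by rewrite -EFinM; congr (_%:E); field.
by rewrite lee_pmul2l.
Qed.

(** An infinite family would contain finite ones with total length beyond the bound of
    [sum_length]. *)
Lemma finite_long (A : set I) : (forall i, A i -> 1 <= length_in_disk (T i) r) ->
  finite_set A.
Proof.
move=> h; apply: contrapT => /(infinite_set_fset (Num.truncn (q * (pi * r ^+ 2))).+1).
move=> [B BA]; rewrite leqNgt => /negP; apply; rewrite -(ltr_nat R).
apply: (@le_lt_trans _ _ (q * (pi * r ^+ 2))); last by exact: truncnS_gt.
apply: le_trans (sum_length (fset_uniq B)).
rewrite (_ : #|` B|%:R = \sum_(i <- B) 1); last first.
  by rewrite big_const_seq count_predT iter_addr addr0.
by rewrite big_seq [leRHS]big_seq; apply: ler_sum => i iB; apply/h/BA.
Qed.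

Let S := tiles_in_disk T r.
(** The width 24 gives each of these tiles length at least 24 / 3 = 8 in the disk, through
    [deep_tile_length]. *)
Let D := [set i | region (T i) `&` disk 0 (r - 24) !=set0 /\ ~ region (T i) `<=` disk 0 r].

Lemma inside_long i : S i -> perimeter (T i) <= length_in_disk (T i) r.
Proof. exact: inside_length. Qed.

Lemma deep_long i : D i -> 8 <= length_in_disk (T i) r.
Proof.
move=> [h1 h2]; have p2 := pi_ge2 R.
have rho0 : 0 < r - 24 by move: r25; lra.
have rr : r - 24 <= r by lra.
have big : 1 < pi * (r - 24) ^+ 2.
  have x1 : 1 <= r - 24 by move: r25; lra.
  have x2 : 1 <= (r - 24) ^+ 2 by rewrite expr2; nra.
  nra.
have := deep_tile_length (hunit i) rho0 rr big h1 h2; lra.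
Qed.

Lemma finite_inside : finite_set S.
Proof.
apply: finite_long => i /inside_long; apply: le_trans.
have := unit_area_perimeter_lo (hunit i); lra.
Qed.

Lemma finite_deep : finite_set D.
Proof. by apply: finite_long => i /deep_long; lra. Qed.

(** A tile meeting the small disk is in [S] or in [D], and each has area 1. *)
Lemma cover_count : pi * (r - 24) ^+ 2 <= #|` fset_set S|%:R + #|` fset_set D|%:R.
Proof.
have rho0 : 0 < r - 24 by move: r25; lra.
have fSD : finite_set (S `|` D) by rewrite finite_setU; split; [exact: finite_inside|exact: finite_deep].
have mreg i : measurable (region (T i) : set (measurableTypeR R * measurableTypeR R)).
  exact: measurable_region.
have sub : disk 0 (r - 24) `<=` \bigcup_(i in S `|` D) region (T i).
  move=> p dp; have [full _] := htiling.
  have : (\bigcup_i region (T i)) p by rewrite full.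
  move=> [i _ Kp]; exists i => //.
  have [Si|nSi] := pselect (S i); first by left.
  by right; split => //; exists p.
have mD : measurable (disk 0 (r - 24) : set (measurableTypeR R * measurableTypeR R)).
  by apply: closed_measurable_plane; exact: closed_disk.
have := @content_sub_fsum _ _ _ (lebesgue_measure \x lebesgue_measure)%E _ _ _ _ fSD
  (fun i _ => mreg i) mD sub.
move=> /(le_trans (area_disk_ge rho0)).
rewrite (eq_fsbigr (fun=> 1%E)); last by move=> i _; exact: hunit.
rewrite fsbig_finite //= fset_setU; [|exact: finite_inside|exact: finite_deep].
rewrite (_ : (\sum_(i <- _) 1)%E = (#|` fset_set S `|` fset_set D|%fset%:R)%:E); last first.
  by rewrite sumEFin big_const_seq count_predT iter_addr addr0.
rewrite lee_fin => /le_trans; apply.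
by rewrite -natrD ler_nat cardfsU leq_subr.
Qed.

Lemma inside_disjoint_deep i : S i -> D i -> False.
Proof. by move=> Si [_ /(_ Si)]. Qed.

Lemma inside_perimeters :
  \sum_(i <- fset_set S) perimeter (T i) + 8 * #|` fset_set D|%:R <= q * (pi * r ^+ 2).
Proof.
have fS := finite_inside; have fD := finite_deep.
have uF : uniq (fset_set S ++ fset_set D).
  rewrite cat_uniq !fset_uniq andbT /=; apply/hasPn => i.
  rewrite in_fset_set // inE => Di; apply/negP; rewrite in_fset_set // inE => Si.
  exact: inside_disjoint_deep Si Di.
apply: le_trans (sum_length uF); rewrite big_cat /=; apply: lerD.
  rewrite big_seq [leRHS]big_seq; apply: ler_sum => i.
  by rewrite in_fset_set // inE => /inside_long.
rewrite (_ : 8 * #|` fset_set D|%:R = \sum_(i <- fset_set D) 8); last first.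
  by rewrite big_const_seq count_predT iter_addr addr0 mulr_natr.
rewrite big_seq [leRHS]big_seq; apply: ler_sum => i.
by rewrite in_fset_set // inE => /deep_long.
Qed.

(** With n tiles inside, m in [D] and s the sum of the inner perimeters, s + 8m is at most q pi r^2,
    which is at most q(n + m) up to an error linear in r. As q <= 4, the m terms drop out, and the
    linear error is absorbed by [eta * n]. *)
Lemma mean_perimeter (eta : R) : 0 < eta -> eta <= 1 -> 1000 <= eta * r ->
  0 < #|` fset_set S|%:R :> R /\
  \sum_(i <- fset_set S) perimeter (T i) <= (q + eta) * #|` fset_set S|%:R.
Proof.
move=> e0 e1 er; have := inside_perimeters; have := cover_count.
have p2 := pi_ge2 R; have p0 := pi_gt0 R.
have s0 : 0 <= \sum_(i <- fset_set S) perimeter (T i).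
  by apply: sumr_ge0 => i _; exact/ltW/perimeter_gt0.
have := ler0n R #|` fset_set S|; have := ler0n R #|` fset_set D|.
move: (\sum_(i <- _) _) s0 (#|` fset_set S|%:R : R) (#|` fset_set D|%:R : R).
move=> s s0 n m m0 n0 cov per.
pose A := pi * r ^+ 2; pose B := pi * r.
have r0 : 0 < r by move: r25; lra.
have r1000 : 1000 <= r by apply: (le_trans er); rewrite ger_pMl.
have B0 : 0 < B by rewrite mulr_gt0.
have AB : 1000 * B <= A.
  have -> : A = r * B by rewrite /A /B; ring.
  by rewrite ler_pM2r.
have {}cov : A - 48 * B <= n + m by move: cov; rewrite /A /B; lra.
have {}per : s + 8 * m <= q * A by [].
have qA : q * A <= 4 * A by rewrite ler_pM2r //; move: B0 AB; lra.
have qB : q * B <= 4 * B by rewrite ler_pM2r.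
have qm : q * m <= 4 * m by exact: ler_wpM2r.
have qcov : q * (A - 48 * B) <= q * (n + m) by exact: ler_wpM2l.
(* Here 8m <= 4A, so m is at most half of A, and the rim 48B is at most 0.048 A. *)
have nA : 2 / 5 * A <= n by lra.
have en : 2 / 5 * (eta * A) <= eta * n by rewrite mulrCA ler_pM2l.
have eA : 1000 * B <= eta * A.
  have -> : eta * A = eta * r * B by rewrite /A /B; ring.
  by rewrite ler_pM2r.
split; lra.
Qed.

End Counting.

(** * From the limit superior to fractions of tiles *)

Section Fractions.
Context {R : realType} {I : choiceType} (T : I -> pentagon R).

Lemma perimeter_ratio_near (c eta : R) : 0 < eta -> (perimeter_ratio T <= c%:E)%E ->
  \forall r \near +oo, (perimeter_in_disk T r <= ((c + eta) * (pi * r ^+ 2))%:E)%E.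
Proof.
move=> e0 h; have : (perimeter_ratio T < (c + eta)%:E)%E.
  by apply: le_lt_trans h _; rewrite lte_fin ltrDl.
move=> /ereal_inf_lt[_ [V FV <-] supV].
apply: filterS2 FV (nbhs_pinfty_gt (num_real (0 : R))) => r Vr r0.
have A0 : 0 < pi * r ^+ 2 by rewrite mulr_gt0 ?pi_gt0 ?exprn_gt0.
rewrite EFinM -lee_pdivrMr //; apply: le_trans (ltW supV).
by apply: ereal_sup_ubound; exists r.
Qed.

(** Finiteness matters: [fset_set] of an infinite set is empty, which would turn the fraction into
    0. *)
Lemma fraction_in_diskE (A : pentagon R -> Prop) r : finite_set (tiles_in_disk T r) ->
  fraction_in_disk T A r =
  (\sum_(i <- fset_set (tiles_in_disk T r)) (`[< A (T i) >])%:R) /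
  #|` fset_set (tiles_in_disk T r)|%:R.
Proof.
move=> fS; rewrite /fraction_in_disk; congr (_ / _).
rewrite -natr_sum; congr (_%:R).
have -> : (\sum_(i <- fset_set (tiles_in_disk T r)) `[< A (T i) >] =
    count (fun i => `[< A (T i) >]) (fset_set (tiles_in_disk T r)))%N.
  by rewrite -sum1_count [RHS]big_mkcond; apply: eq_bigr => i _; case: `[< _ >].
rewrite -size_filter; apply/perm_size/uniq_perm; rewrite ?filter_uniq ?fset_uniq //.
move=> i; rewrite mem_filter in_fset_set; last exact: finite_setIl.
rewrite in_fset_set // in_setI andbC; congr (_ && _).
Qed.

End Fractions.

(** Stated for all large radii: as long as the disk contains no tile, every fraction is 0 / 0, that
    is 0, and the strict inequality fails. *)
Theorem proposition5p4 (R : realType) (I : choiceType) (T : I -> pentagon R)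
    (C Pr : pentagon R)
    (hC : cairo C) (hC1 : unit_area C)
    (hPr : prismatic Pr) (hPr1 : unit_area Pr)
    (htiling : tiling T) (hedge : edge_to_edge T)
    (hunit : forall i, unit_area (T i))
    (htiles : forall i, efficient C (T i) \/ non_convex (T i))
    (hratio : (perimeter_ratio T <= (perimeter Pr / 2)%:E)%E) :
  \forall r \near +oo,
    fraction_in_disk T (efficient C) r >
    26 / 10 * fraction_in_disk T type1 r +
    134 / 10 * fraction_in_disk T type2 r.
Proof.
(* Three times [eta] is lost, twice in [q] and once in the mean; this raises the bound 3.863704 on
   the prismatic perimeter to the 3.863707 of [weight_ge]. *)
pose eta : R := 1 / 1000 / 1000.
have eta0 : 0 < eta by rewrite /eta; lra.
have Pm0 := perimeter_gt0 Pr; have Pm := prismatic_perimeter_hi hPr1 hPr.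
apply: filterS2 (perimeter_ratio_near eta0 hratio)
  (nbhs_pinfty_ge (num_real (1000 / eta))) => r hper hr.
have er : 1000 <= eta * r by rewrite mulrC -ler_pdivrMr.
have eta1 : eta <= 1 by rewrite /eta; lra.
have r25 : 25 <= r.
  have r0 : 0 < r by rewrite -(pmulr_rgt0 _ eta0); lra.
  have : eta * r <= r by rewrite ger_pMl.
  lra.
pose q := perimeter Pr + 2 * eta.
have q0 : 0 <= q by rewrite /q; lra.
have qE : q <= 3 + 863 / 1000 + 706 / 1000 / 1000 by rewrite /q /eta; lra.
have q4 : q <= 4 by lra.
have hq : (perimeter_in_disk T r <= (q / 2 * (pi * r ^+ 2))%:E)%E.
  apply: le_trans hper _; rewrite lee_fin le_eqVlt; apply/orP; left; apply/eqP.
  by rewrite /q; field.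
have [N0 mean] := mean_perimeter htiling hunit r25 q0 q4 hq eta0 eta1 er.
have fS := finite_inside htiling hunit hq.
rewrite !fraction_in_diskE //.
move: mean N0; set F := fset_set _; set N : R := #|` F|%:R => mean N0.
(* In the sum of [weight_ge] the perimeter terms are nonnegative by the mean bound; the slack 0.0001
   per tile makes the inequality strict. *)
have Wsum : (1 / 1000 / 10) * N <= \sum_(i <- F) weight C (T i).
  apply: (@le_trans _ _ (\sum_(i <- F) ((19 + 29 / 100) *
      (3 + 863 / 1000 + 707 / 1000 / 1000 - perimeter (T i)) + 1 / 1000 / 10))).
    rewrite big_split /= -mulr_sumr sumrB !big_const_seq !count_predT !iter_addr !addr0.
    rewrite -[_ *+ size F]mulr_natr -[X in _ <= _ + X]mulr_natr -/N.
    have : (q + eta) * N <= (3 + 863 / 1000 + 707 / 1000 / 1000) * N.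
      by rewrite ler_pM2r // /eta; lra.
    lra.
  by apply: ler_sum => i _; apply: weight_ge.
have {}Wsum : 0 < \sum_(i <- F) weight C (T i).
  by apply: lt_le_trans Wsum; lra.
rewrite !mulrA -mulrDl ltr_pM2r ?invr_gt0 // -subr_gt0.
have -> : \sum_(i <- F) (`[< efficient C (T i) >])%:R -
    (26 / 10 * (\sum_(i <- F) (`[< type1 (T i) >])%:R) +
     134 / 10 * (\sum_(i <- F) (`[< type2 (T i) >])%:R)) =
    \sum_(i <- F) weight C (T i) :> R.
  by rewrite !mulr_sumr -big_split -sumrB /=; apply: eq_bigr => i _; rewrite /weight; ring.
exact: Wsum.
Qed.
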